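(* Let $\mathcal{A}$ be a cluster algebra of odd rank $n$ with coefficients in a semifield $\mathbb{P}$, given by a cluster pattern $t\mapsto(\mathbf x_t,\mathbf y_t,B_t)$ on $\mathbb{T}_n$ with totally sign-skew-symmetric, indecomposable exchange matrices. Then: (1) if $\sigma\in S_n$ and $t,t'\in\mathbb{T}_n$ satisfy $\sigma(\mathbf x_{t'})=\mathbf x_t$, then $(\mathbf x_t,\mathbf y_t,B_t)=\sigma(\mathbf x_{t'},\mathbf y_{t'},B_{t'})$; (2) for $t,t'\in\mathbb{T}_n$, the unlabeled seeds of $(\mathbf x_t,\mathbf y_t,B_t)$ and $(\mathbf x_{t'},\mathbf y_{t'},B_{t'})$ are adjacent in the exchange graph if and only if their clusters have exactly $n-1$ common cluster variables.
   Context: For real $a$, $[a]_+=\max(a,0)$. An integer $n\times n$ matrix $B=(b_{ij})$ is sign-skew-symmetric if $b_{ij}b_{ji}\le0$ and $b_{ij}b_{ji}=0$ implies $b_{ij}=b_{ji}=0$; its mutation at $k$ is $\mu_k(B)=(b'_{ij})$ with $b'_{ij}=-b_{ij}$ if $i=k$ or $j=k$, and $b'_{ij}=b_{ij}+\mathrm{sign}(b_{ik})[b_{ik}b_{kj}]_+$ otherwise; $B$ is totally sign-skew-symmetric if all matrices obtained by finitely many mutations are sign-skew-symmetric. $B$ is indecomposable if there is no partition $\{1,\dots,n\}=I\sqcup J$ with $I,J$ nonempty and $b_{ij}=b_{ji}=0$ for all $i\in I$, $j\in J$. A semifield $\mathbb{P}$ is an abelian multiplicative group with a commutative associative addition $\oplus$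 distributive over multiplication; $\mathbb{QP}$ is the fraction field of $\mathbb{ZP}$. A seed is $(\mathbf x,\mathbf y,B)$ with $\mathbf x=(x_1,\dots,x_n)$ a free generating set of a field $\mathcal F$ of rational functions over $\mathbb{QP}$, $\mathbf y\in\mathbb{P}^n$, $B$ totally sign-skew-symmetric. Its mutation $\mu_k$ gives $(\mathbf x',\mathbf y',B')$ with $B'=\mu_k(B)$, $x'_i=x_i$ ($i\ne k$), $x'_k=\frac{y_k\prod_i x_i^{[b_{ik}]_+}+\prod_i x_i^{[-b_{ik}]_+}}{(y_k\oplus1)x_k}$, $y'_k=y_k^{-1}$, $y'_i=y_iy_k^{[b_{ki}]_+}(y_k\oplus1)^{-b_{ki}}$ ($i\ne k$). $\mathbb{T}_n$ is the $n$-regular tree with edges labeled $1,\dots,n$, distinct at each vertex. A cluster pattern assigns a seed $(\mathbf x_t,\mathbf y_t,B_t)$ to each $t$ with adjacent seeds related by mutation at the edge label; the $x_{i,t}$ are cluster variables, $\mathbf x_t$ (as a set) clusters. For $\sigma\in S_n$: $\sigma(\mathbf x_t)=(x_{\sigma(1),t},\dots,x_{\sigma(n),t})$, $\sigma(\mathbf y_t)=(y_{\sigma(1),t},\dots,y_{\sigma(n),t})$, $\sigma(B_t)=(b_{\sigma(i)\sigma(j),t})$. Seeds differing by such a simultaneous permutation define the same unlabeled seed; the exchange graph has unlabeled seeds as vertices, joined when related by a single mutation. *)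

(* Defs.v *)
From HB Require Import structures.
From mathcomp Require Import all_boot all_order all_algebra all_fingroup finmap.
From mathcomp Require Import mpoly.

Set Implicit Arguments.
Unset Strict Implicit.
Unset Printing Implicit Defensive.

Import Order.TTheory GRing.Theory Num.Theory.
Local Open Scope ring_scope.

(** * Semifields *)

HB.mixin Record Group_isSemifield P of monoid.Group P := {
  oplus : P -> P -> P;
  semifield_mulgC : forall p q : P, (p * q = q * p)%g;
  oplusC : commutative oplus;
  oplusA : associative oplus;
  mulg_oplusr : forall p q r : P, (p * oplus q r = oplus (p * q) (p * r))%g
}.

#[short(type="semifieldType")]
HB.structure Definition Semifield :=
  {P of monoid.Group P & Group_isSemifield P}.

Definition zexpg (P : semifieldType) (p : P) (m : int) : P :=
  match m with
  | Posz a => (p ^+ a)%g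
  | Negz a => (p ^- a.+1)%g
  end.

(** * The group ring ZP and its fraction field QP *)

(* The underlying set of ZP: finitely supported functions P -> Z. *)
Definition group_ring (P : semifieldType) := {fsfun P -> int with 0}.

(* The additive extension ZP -> K of [iota : P -> K]; it is a ring morphism
   for the convolution product as soon as [iota] is multiplicative. *)
Definition group_ring_ext (P : semifieldType) (K : fieldType) (iota : P -> K)
    (a : group_ring P) : K :=
  \sum_(p <- finsupp a) (a p)%:~R * iota p.

(* [iota] exhibits K as the fraction field of ZP: the induced ring morphism
   ZP -> K is injective and every element of K is a quotient of elements of its
   image.  This determines (K, iota) up to a unique isomorphism. *)
Record is_QP (P : semifieldType) (K : fieldType) (iota : P -> K) : Prop :=
  IsQP {
    QP_one : iota 1%g = 1;
    QP_mul : forall p q : P, iota (p * q)%g = iota p * iota q;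
    QP_inj : injective (group_ring_ext iota);
    QP_frac : forall z : K, exists a b : group_ring P,
      group_ring_ext iota b != 0 /\
      z = group_ring_ext iota a / group_ring_ext iota b
  }.

(** * Exchange matrices *)

Definition pospart (a : int) : int := Num.max a 0.

Definition sign_skew_symmetric n (B : 'M[int]_n) : Prop :=
  forall i j, B i j * B j i <= 0 /\
              (B i j * B j i = 0 -> B i j = 0 /\ B j i = 0).

Definition mx_mut n (k : 'I_n) (B : 'M[int]_n) : 'M[int]_n :=
  \matrix_(i, j) if (i == k) || (j == k) then - B i j
                 else B i j + Num.sg (B i k) * pospart (B i k * B k j).

Definition totally_sign_skew_symmetric n (B : 'M[int]_n) : Prop :=
  forall ks : seq 'I_n,
    sign_skew_symmetric (foldl (fun C k => mx_mut k C) B ks).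

Definition indecomposable n (B : 'M[int]_n) : Prop :=
  ~ exists I J : {set 'I_n},
      [/\ I :|: J = [set: 'I_n], [disjoint I & J], I != set0, J != set0 &
          forall i j, i \in I -> j \in J -> B i j = 0 /\ B j i = 0].

(** * Seeds *)

Record seed (P : semifieldType) (F : fieldType) n := Seed {
  xs : {ffun 'I_n -> F};
  ys : {ffun 'I_n -> P};
  bmx : 'M[int]_n
}.

(* Here K plays the role of QP, embedded in F by [phi].  The second clause says
   F = K(x_1, ..., x_n), so F is a field of rational functions in n variables
   over K. *)
Definition free_generating (K F : fieldType) (phi : {rmorphism K -> F}) n
    (x : 'I_n -> F) : Prop :=
  (forall p : {mpoly K[n]}, mmap phi x p = 0 -> p = 0) /\
  (forall z : F, exists p q : {mpoly K[n]},
     mmap phi x q != 0 /\ z = mmap phi x p / mmap phi x q).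

Definition is_seed (P : semifieldType) (K F : fieldType)
    (phi : {rmorphism K -> F}) n (s : seed P F n) : Prop :=
  free_generating phi (xs s) /\ totally_sign_skew_symmetric (bmx s).

(* [e : P -> F] is the inclusion of P in F through QP. *)
Definition seed_mut (P : semifieldType) (F : fieldType) (e : P -> F) n
    (k : 'I_n) (s : seed P F n) : seed P F n :=
  let x := xs s in let y := ys s in let B := bmx s in
  Seed
    [ffun i => if i == k then
        (e (y k) * \prod_j x j ^ pospart (B j k)
           + \prod_j x j ^ pospart (- B j k))
        / (e (oplus (y k) 1%g) * x k)
      else x i]
    [ffun i => if i == k then ((y k)^-1)%g
      else (y i * zexpg (y k) (pospart (B k i))
              * zexpg (oplus (y k) 1) (- B k i)%R)%g]
    (mx_mut k B).

Definition seed_perm (P : semifieldType) (F : fieldType) n (sigma : 'S_n)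
    (s : seed P F n) : seed P F n :=
  Seed [ffun i => xs s (sigma i)] [ffun i => ys s (sigma i)]
       (\matrix_(i, j) bmx s (sigma i) (sigma j)).

(** * The n-regular tree and cluster patterns *)

(* T_n is realised as the Cayley graph of the free product of n copies of Z/2:
   vertices are words in the labels without two equal consecutive letters, and
   an edge labelled k prepends the letter k. *)
Record tree n := TreeVertex {
  word : seq 'I_n;
  _ : sorted (fun i j => i != j) word
}.

Definition tree_edge n (k : 'I_n) (t t' : tree n) : Prop :=
  word t' = k :: word t \/ word t = k :: word t'.

Definition cluster_pattern (P : semifieldType) (K F : fieldType)
    (iota : P -> K) (phi : {rmorphism K -> F}) n
    (S : tree n -> seed P F n) : Prop :=
  (forall t, is_seed phi (S t)) /\
  (forall (k : 'I_n) (t t' : tree n),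
     tree_edge k t t' -> S t' = seed_mut (fun p => phi (iota p)) k (S t)).

(** * Clusters, unlabeled seeds and the exchange graph *)

Definition cluster (P : semifieldType) (F : fieldType) n (s : seed P F n) :
  {fset F} := [fset xs s i | i in 'I_n]%fset.

(* The class of a labeled seed under simultaneous permutations. *)
Definition unlabeled (P : semifieldType) (F : fieldType) n (s : seed P F n) :
  seed P F n -> Prop := fun s' => exists sigma : 'S_n, s' = seed_perm sigma s.

Definition exchange_adj (P : semifieldType) (F : fieldType) (e : P -> F) n
    (U V : seed P F n -> Prop) : Prop :=
  exists (s s' : seed P F n) (k : 'I_n),
    [/\ U s, V s' & s' = seed_mut e k s].

(* Main.v *)
Require Import Defs.
From HB Require Import structures.
From mathcomp Require Import all_boot all_order all_algebra all_fingroup finmap.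
From mathcomp Require Import mpoly.
From mathcomp Require Import ring zify.

Set Implicit Arguments.
Unset Strict Implicit.
Unset Printing Implicit Defensive.

Import Order.TTheory GRing.Theory Num.Theory.
Local Open Scope ring_scope.

(** Laurent phenomenon: over the field of rational functions in the cluster and
    in independent coefficients, three consecutive mutations [i], [j], [i] give
    denominators that are coprime to that of the first one; arbitrary
    coefficients are obtained by specialization.

    If two seeds have the same cluster, Laurent expansions in the mutated
    clusters show that corresponding exchange binomials are proportional, hence
    [(y', B') = (y, B)] or [(y^-1, -B)] column by column, and one sign serves all
    columns because [B] is indecomposable.  The sign [-1] is impossible: a
    subtraction-free identity holds in every semifield, so the coincidence of
    the clusters is inherited by their tropicalizations, and therefore by the
    seeds with independent coefficients up to factors free of the cluster
    variables.  With lexicographic tropical values each mutation acts on the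
    exponent matrix of the cluster, and on that of the variables [hat y], by a
    matrix of determinant [-1]; comparing the two determinants gives
    [(-1)^n = 1].

    If two clusters share all but one variable, the two remaining variables are,
    after at most one mutation, proportional by a unit; Laurent expansions in
    the other mutations make it a constant [u], whose value in the semifield is
    [1] since every cluster variable evaluates to [1] there.  A nonzero power of
    [u] is a coefficient, hence [u = 1]. *)

(** * Laurent polynomials over subrings of a field *)

(** Independent coefficients are what makes the determinant argument possible. If all coefficients
    had the trivial tropical value, the values of the variables [ghat] would be those of the cluster
    multiplied by the exchange matrix, which may be singular, as a skew-symmetric matrix of odd size
    always is. With independent coefficients sent to the powers ['X^i] and the cluster to 0, the
    initial matrix of the [ghat] is the identity.

    Mutation takes place over an arbitrary field, with a free scalar [mu] in place of y_k ⊕ 1. For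
    [mu = 1] it needs no semifield addition, and since the [ghat] do not see [mu], the seeds of a
    pattern differ from the ones so obtained by constants only. The price is that mutation with
    [mu = 1] is not an involution: a preimage is obtained with [mu = y_k]. The neighbours of a
    standard seed are no longer standard, so the Laurent induction runs over all seeds at once; a
    set of positive elements that is closed under the semifield operations and avoids 0 ensures that
    no denominator vanishes.

    In rank one the only column of [B] is zero and exchange binomials carry no information; there
    the tree is a single edge. *)

Section LaurentPolynomials.

Variable F : fieldType.
Implicit Types (A C : F -> Prop) (t f g h : F) (p q : {poly F}).

Record subring A : Prop := Subring {
  sr1 : A 1;
  srN1 : A (-1);
  srD : forall f g, A f -> A g -> A (f + g);
  srM : forall f g, A f -> A g -> A (f * g)
}.

Lemma sr0 A : subring A -> A 0.
Proof. by case=> A1 AN1 AD _; rewrite -(subrr 1); apply: AD. Qed.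

Lemma srN A f : subring A -> A f -> A (- f).
Proof. by case=> _ AN1 _ AM Af; rewrite -mulN1r; apply: AM. Qed.

Lemma srB A f g : subring A -> A f -> A g -> A (f - g).
Proof. by move=> sA Af Ag; apply: srD => //; apply: srN. Qed.

Lemma srX A f m : subring A -> A f -> A (f ^+ m).
Proof.
move=> sA Af; elim: m => [|m IH]; first by rewrite expr0; apply: sr1.
by rewrite exprS; apply: srM.
Qed.

Lemma sr_nat A m : subring A -> A m%:R.
Proof.
move=> sA; elim: m => [|m IH]; first exact: sr0.
by rewrite -addn1 natrD; apply: srD => //; apply: sr1.
Qed.

Lemma sr_sum A (I : Type) (r : seq I) (P : pred I) (G : I -> F) :
  subring A -> (forall i, P i -> A (G i)) -> A (\sum_(i <- r | P i) G i).
Proof.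
by move=> sA AG; apply: (big_ind A) => //; [apply: sr0 | apply: srD].
Qed.

Lemma sr_prod A (I : Type) (r : seq I) (P : pred I) (G : I -> F) :
  subring A -> (forall i, P i -> A (G i)) -> A (\prod_(i <- r | P i) G i).
Proof.
by move=> sA AG; apply: (big_ind A) => //; [apply: sr1 | apply: srM].
Qed.

Lemma sr_exprz A f (m : int) : subring A -> A f -> A f^-1 -> A (f ^ m).
Proof.
move=> sA Af AVf; case: m => m; first exact: srX.
by rewrite NegzE -exprnN -exprVn; apply: srX.
Qed.

Definition over A p := forall i, A p`_i.

Lemma overC A f : subring A -> A f -> over A f%:P.
Proof. by move=> sA Af i; rewrite coefC; case: eqP => _ //; apply: sr0. Qed.

Lemma overXn A m : subring A -> over A 'X^m.
Proof.
by move=> sA i; rewrite coefXn; case: eqP => _; [apply: sr1|apply: sr0].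
Qed.

Lemma overD A p q : subring A -> over A p -> over A q -> over A (p + q).
Proof. by move=> sA Ap Aq i; rewrite coefD; apply: srD. Qed.

Lemma overN A p : subring A -> over A p -> over A (- p).
Proof. by move=> sA Ap i; rewrite coefN; apply: srN. Qed.

Lemma overM A p q : subring A -> over A p -> over A q -> over A (p * q).
Proof.
by move=> sA Ap Aq i; rewrite coefM; apply: sr_sum => // j _; apply: srM.
Qed.

Definition transc A t := forall p, over A p -> p.[t] = 0 -> p = 0.

Definition lpoly A t f := exists p d, over A p /\ f * t ^+ d = p.[t].

Lemma transc_neq0 A t : subring A -> transc A t -> t != 0.
Proof.
move=> sA tt; apply/eqP => t0.
have /eqP : 'X = 0 :> {poly F}.
  by apply: tt; [rewrite -['X]expr1; apply: overXn | rewrite hornerX].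
by rewrite polyX_eq0.
Qed.

Lemma transc_sub A A' t : (forall f, A' f -> A f) -> transc A t -> transc A' t.
Proof. by move=> sub tt p Ap; apply: tt => i; apply: sub. Qed.

Lemma transc_inj A t p q : subring A -> transc A t -> over A p -> over A q ->
  p.[t] = q.[t] -> p = q.
Proof.
move=> sA tt Ap Aq e; apply/eqP; rewrite -subr_eq0; apply/eqP; apply: tt.
  by apply: overD => //; apply: overN.
by rewrite !hornerE e subrr.
Qed.

Lemma lpolyA A t f : subring A -> A f -> lpoly A t f.
Proof.
move=> sA Af; exists f%:P, 0%N; split; first exact: overC.
by rewrite expr0 mulr1 hornerC.
Qed.

Lemma lpolyX A t : subring A -> lpoly A t t.
Proof.
move=> sA; exists 'X^1, 0%N; split; first exact: overXn.
by rewrite expr0 mulr1 hornerXn expr1.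
Qed.

Lemma lpolyV A t : subring A -> t != 0 -> lpoly A t t^-1.
Proof.
move=> sA t0; exists 1, 1%N; split; first by apply: overC => //; apply: sr1.
by rewrite expr1 hornerC mulVf.
Qed.

Lemma lpoly_subring A t : subring A -> subring (lpoly A t).
Proof.
move=> sA; split.
- by apply: lpolyA => //; apply: sr1.
- by apply: lpolyA => //; apply: srN1.
- move=> f g [p [d [Ap Ep]]] [q [e [Aq Eq]]].
  exists (p * 'X^e + q * 'X^d), (d + e)%N; split.
    by apply: overD => //; apply: overM => //; apply: overXn.
  by rewrite !hornerE -Ep -Eq exprD /=; ring.
- move=> f g [p [d [Ap Ep]]] [q [e [Aq Eq]]].
  exists (p * q), (d + e)%N; split; first exact: overM.
  by rewrite hornerM -Ep -Eq exprD; ring.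
Qed.

(** A denominator in [A] cannot be absorbed by a transcendental: [h * p] must equal [h * f] times
    ['X^d], and the coefficient of degree [d] gives [f]. *)
Lemma lpoly_div A t f h : subring A -> transc A t -> lpoly A t f ->
  A h -> h != 0 -> A (h * f) -> A f.
Proof.
move=> sA tt [p [d [Ap Ep]]] Ah h0 Ahf.
have e : h%:P * p = (h * f)%:P * 'X^d.
  apply: (transc_inj sA tt); first by apply: overM => //; apply: overC.
    by apply: overM; [|apply: overC|apply: overXn].
  by rewrite !hornerE -Ep mulrA.
have := congr1 (fun q : {poly F} => q`_d) e.
by rewrite coefCM coefCM coefXn eqxx mulr1 => /(mulfI h0) <-.
Qed.

(* Modulo [h] the leading coefficient [alpha] is invertible, so dividing the
   coefficients of [f] by [h] succeeds one after the other from the top. *)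
Lemma lpoly_regular A t f h alpha beta : subring A -> transc A t ->
  lpoly A t f -> h != 0 -> A beta -> A alpha^-1 -> A h -> A alpha ->
  alpha != 0 -> lpoly A t (f * (alpha * t + beta) / h) -> lpoly A t (f / h).
Proof.
move=> sA tt [p [d [Ap Ep]]] h0 Abeta AValpha Ah Aalpha alpha0.
case=> q [e [Aq Eq]].
pose P := p * 'X^e; pose Q := q * 'X^d.
have AP : over A P by apply: overM => //; apply: overXn.
have AQ : over A Q by apply: overM => //; apply: overXn.
have E : P * (alpha%:P * 'X + beta%:P) = h%:P * Q.
  have AX : over A 'X by rewrite -['X]expr1; apply: overXn.
  have AL : over A (alpha%:P * 'X + beta%:P).
    by apply: overD => //; [apply: overM => // |]; apply: overC.
  apply: (transc_inj sA tt).
  - exact: overM.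
  - by apply: overM => //; apply: overC.
  by rewrite !hornerE -Ep -Eq /=; field.
have Acoef : forall k r, (size P <= r + k)%N -> A (P`_r / h).
  elim=> [|k IH] r.
    by rewrite addn0 => sP; rewrite nth_default // mul0r; apply: sr0.
  move=> sP; have := congr1 (fun q : {poly F} => q`_r.+1) E.
  have -> : P * (alpha%:P * 'X + beta%:P) = alpha%:P * (P * 'X) + beta%:P * P.
    by ring.
  rewrite coefD !coefCM coefMX /= => E'.
  have -> : P`_r / h = alpha^-1 * (Q`_r.+1 - beta * (P`_r.+1 / h)).
    apply: (mulfI alpha0); rewrite mulVKf //.
    by apply: (mulfI h0); rewrite !mulrBr -E'; field.
  apply: srM => //; apply: srB => //; apply: srM => //.
  by apply: IH; rewrite addSn -addnS.
exists (h^-1 *: P), (d + e)%N; split.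
  by move=> i; rewrite coefZ mulrC; apply: (Acoef (size P)); apply: leq_addl.
by rewrite hornerZ /P !hornerE -Ep exprD /=; ring.
Qed.

Lemma lpoly_normal A t f : t != 0 -> lpoly A t f -> f != 0 ->
  exists (e : int) p, [/\ over A p, p`_0 != 0 & f = t ^ e * p.[t]].
Proof.
move=> t0 [p [d [Ap Ep]]] f0.
have p0 : p != 0.
  apply: contraNneq f0 => p0; move/eqP: Ep; rewrite p0 horner0.
  by rewrite mulf_eq0 expf_eq0 (negbTE t0) andbF orbF.
have ex : exists m, p`_m != 0.
  by exists (size p).-1; rewrite -lead_coefE lead_coef_eq0.
case: (ex_minnP ex) => m pm min.
exists (m%:Z - d%:Z), (drop_poly m p); split.
- by move=> i; rewrite coef_drop_poly.
- by rewrite coef_drop_poly.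
have E : p = drop_poly m p * 'X^m.
  rewrite -{1}[p](poly_take_drop m) -[RHS]add0r; congr (_ + _).
  apply/polyP => i; rewrite coef_take_poly coef0; case: ltnP => // im.
  by apply/eqP; apply: contraTT im => /min; rewrite -leqNgt.
apply: (mulIf (expf_neq0 d t0)); rewrite Ep {1}E hornerM hornerXn.
rewrite expfzDr // -exprnP -exprnN -[LHS]mulr1 -(mulVf (expf_neq0 d t0)).
by rewrite -!exprVn; ring.
Qed.

Lemma lpoly_normal_uniq A t (e e' : int) p q : subring A -> transc A t ->
  over A p -> over A q -> p`_0 != 0 -> q`_0 != 0 ->
  t ^ e * p.[t] = t ^ e' * q.[t] -> e = e' /\ p = q.
Proof.
move=> sA tt; have t0 := transc_neq0 sA tt.
wlog le_e : e e' p q / (e <= e')%R.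
  move=> H Ap Aq p0 q0 E; have [le|/ltW le] := lerP e e'; first exact: H.
  by have [-> ->] := H _ _ _ _ le Aq Ap q0 p0 (esym E).
move=> Ap Aq p0 q0 E.
have [m Em] : exists m : nat, e' = e + m%:Z.
  by exists `|e' - e|%N; rewrite gez0_abs ?subr_ge0 // addrCA subrr addr0.
have E2 : p = q * 'X^m.
  apply: (transc_inj sA tt) => //; first by apply: overM => //; apply: overXn.
  apply: (mulfI (expfz_neq0 e t0)).
  by rewrite E Em expfzDr // !hornerE -exprnP /=; ring.
move: p0; rewrite E2 coefMXn; case: m Em E2 => [|m] Em E2 //=.
  by rewrite Em addr0 expr0 mulr1.
by rewrite eqxx.
Qed.

(** Once the powers of [t] are removed, the product of two polynomials is a nonzero constant, so
    both are constant. *)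
Lemma lpoly_factor A t f g c : subring A -> transc A t ->
  lpoly A t f -> lpoly A t g -> A c -> c != 0 -> f * g = c ->
  exists (e : int) rho rho', [/\ A rho, A rho', f = rho * t ^ e,
    g = rho' * t ^ (- e) & rho * rho' = c].
Proof.
move=> sA tt Lf Lg Ac c0 fg; have t0 := transc_neq0 sA tt.
have f0 : f != 0 by apply: contraNneq c0 => f0; rewrite -fg f0 mul0r.
have g0 : g != 0 by apply: contraNneq c0 => g0; rewrite -fg g0 mulr0.
have [e [p [Ap p0 Ef]]] := lpoly_normal t0 Lf f0.
have [e' [q [Aq q0 Eg]]] := lpoly_normal t0 Lg g0.
have [ee pq] : e + e' = 0 /\ p * q = c%:P.
  apply: (lpoly_normal_uniq sA tt); rewrite ?coefC //.
  - exact: overM.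
  - exact: overC.
  - by rewrite coefM big_ord1 mulf_neq0.
  by rewrite expr0z mul1r hornerC -fg Ef Eg expfzDr // hornerM; ring.
have pn0 : p != 0 by apply: contraNneq p0 => ->; rewrite coef0.
have qn0 : q != 0 by apply: contraNneq q0 => ->; rewrite coef0.
have [sp sq] : size p = 1%N /\ size q = 1%N.
  have := size_mul pn0 qn0; rewrite pq size_polyC c0.
  move: pn0 qn0; rewrite -!size_poly_gt0.
  by case: (size p) => [|[|a]] //; case: (size q) => [|[|b]] //=; rewrite ?addnS.
have Ep := size1_polyC (eq_leq sp); have Eq := size1_polyC (eq_leq sq).
exists e, p`_0, q`_0; split => //.
- by rewrite Ef {1}Ep hornerC mulrC.
- rewrite Eg {1}Eq hornerC mulrC; congr (_ * _ ^ _).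
  by apply/eqP; rewrite -addr_eq0 addrC ee.
- by apply: polyC_inj; rewrite polyCM -Ep -Eq.
Qed.

Lemma lpoly_monomial_eq A t a b (e e' : int) : subring A -> transc A t ->
  A a -> A b -> a != 0 -> b != 0 -> a * t ^ e = b * t ^ e' -> e = e' /\ a = b.
Proof.
move=> sA tt Aa Ab a0 b0 E.
have [] := @lpoly_normal_uniq A t e e' a%:P b%:P sA tt; rewrite ?coefC //.
- exact: overC.
- exact: overC.
- by rewrite !hornerC !(mulrC (t ^ _)).
by move=> -> /polyC_inj ->.
Qed.

Lemma coef_binomial (u v : F) c i : (0 < c)%N ->
  (u%:P + v%:P * 'X^c)`_i = if i == 0%N then u else v * (i == c)%:R.
Proof.
move=> c0; rewrite coefD coefC coefCM coefXn; case: eqP => [->|_].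
  by case: c c0 => // c _; rewrite mulr0 addr0.
by rewrite add0r.
Qed.

Lemma binomial_inj (u v u' v' : F) c c' : (0 < c)%N -> (0 < c')%N -> v != 0 ->
  u%:P + v%:P * 'X^c = u'%:P + v'%:P * 'X^c' -> [/\ u = u', v = v' & c = c'].
Proof.
move=> c0 c'0 v0 E; have Ei i := congr1 (fun q : {poly F} => q`_i) E.
move: (Ei 0%N) (Ei c); rewrite !coef_binomial // !eqxx => -> /=.
rewrite -[c == 0%N]negbK -lt0n c0 /= mulr1; case: eqP => [->|_]; first by rewrite mulr1.
by rewrite mulr0 => /eqP; rewrite (negbTE v0).
Qed.

Lemma size_binomial (u v : F) c : (0 < c)%N -> v != 0 ->
  size (u%:P + v%:P * 'X^c) = c.+1.
Proof.
move=> c0 v0; rewrite addrC size_polyDl size_Cmul // ?size_polyXn //.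
by rewrite size_polyC; case: (u != 0).
Qed.

Lemma over_binomial A u v c : subring A -> A u -> A v ->
  over A (u%:P + v%:P * 'X^c).
Proof.
move=> sA Au Av; apply: overD => //; first exact: overC.
by apply: overM => //; [apply: overC | apply: overXn].
Qed.

(* [1 + a t^b] is, up to a power of [t], the polynomial [1 + a X^b] or
   [a + X^(-b)], according to the sign of [b]. *)
Lemma binomial_normal t a (b : int) : t != 0 -> b != 0 ->
  exists (m : int) (s : bool), [/\ (0 < `|b|)%N,
    1 + a * t ^ b =
      t ^ m * ((if s then 1 else a)%:P + (if s then a else 1)%:P * 'X^`|b|).[t]
    & b = if s then `|b|%N%:Z else - `|b|%N%:Z].
Proof.
move=> t0 b0; case: b b0 => b b0.
  exists 0, true; rewrite absz_nat; split => //; first by rewrite lt0n.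
  by rewrite expr0z mul1r !hornerE -exprnP.
exists (Negz b), false; split => //.
rewrite NegzE !hornerE /= -exprnN mulrDr mulVf ?expf_neq0 //.
by rewrite addrC mulrC.
Qed.

(** Normal forms are unique, so the coefficients match in pairs. The lowest coefficient is 1 or [a]
    according to the sign of the exponent, whence the two outcomes. *)
Lemma binomial_ratio_unit A t a a' rho (b b' e : int) : subring A ->
  transc A t -> A a -> A a' -> A rho -> a != 0 -> a' != 0 -> rho != 0 ->
  b != 0 -> rho * t ^ e * (1 + a * t ^ b) = 1 + a' * t ^ b' ->
  (b' = b /\ a' = a) \/ (b' = - b /\ a' * a = 1).
Proof.
move=> sA tt Aa Aa' Arho a0 a'0 rho0 b0; have t0 := transc_neq0 sA tt.
have [m [s [c0 -> Eb]]] := binomial_normal a t0 b0.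
set u := (if s then 1 else a); set v := (if s then a else 1).
have u0 : u != 0 by rewrite /u; case: (s); rewrite ?oner_eq0.
have v0 : v != 0 by rewrite /v; case: (s); rewrite ?oner_eq0.
have Au : A u by rewrite /u; case: (s) => //; apply: sr1.
have Av : A v by rewrite /v; case: (s) => //; apply: sr1.
have nf p m' : over A p -> p`_0 != 0 ->
    rho * t ^ e * (t ^ m * (u%:P + v%:P * 'X^`|b|).[t]) = t ^ m' * p.[t] ->
    (rho * u)%:P + (rho * v)%:P * 'X^`|b| = p.
  move=> Ap p0 E.
  have [] := @lpoly_normal_uniq A t (e + m) m'
    ((rho * u)%:P + (rho * v)%:P * 'X^`|b|) p sA tt => //.
  - by apply: over_binomial => //; apply: srM.
  - by rewrite coef_binomial //= mulf_neq0.
  - by rewrite -E expfzDr // !hornerE /=; ring.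
have rv : rho * v != 0 by rewrite mulf_neq0.
(* For [b' = 0] the right side is a constant; a binomial of positive degree is neither zero at a
   transcendental nor a constant up to a monomial. *)
have [b'0|b'0] := eqVneq b' 0.
  rewrite b'0 expr0z mulr1 => E.
  have [a1|a1] := eqVneq (1 + a') 0.
    move/eqP: E; rewrite a1 !mulf_eq0 (negbTE rho0) !expfz_eq0 !(negbTE t0) !andbF /=.
    move/eqP=> /(tt _ (over_binomial _ sA Au Av)) /(congr1 (fun q => q`_0)).
    by rewrite coef_binomial //= coef0 => /eqP; rewrite (negbTE u0).
  have Aa1 : over A (1 + a')%:P.
    by apply: overC => //; apply: srD => //; apply: sr1.
  have := nf (1 + a')%:P 0 Aa1.
  rewrite coefC eqxx hornerC expr0z mul1r => /(_ a1 E).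
  move/(congr1 (fun q : {poly F} => size q)).
  by rewrite size_binomial // size_polyC; case: eqP => //; case: absz c0.
have [m' [s' [c'0 -> Eb']]] := binomial_normal a' t0 b'0.
move=> E.
have /(nf _ _) H : over A ((if s' then 1 else a')%:P +
    (if s' then a' else 1)%:P * 'X^`|b'|).
  by apply: over_binomial => //; case: (s') => //; apply: sr1.
have /H/(_ E) : ((if s' then 1 else a')%:P +
    (if s' then a' else 1)%:P * 'X^`|b'|)`_0 != 0.
  by rewrite coef_binomial //=; case: (s'); rewrite ?oner_eq0.
case/(binomial_inj c0 c'0 rv) => E1 E2 E3.
move: E1 E2 Eb Eb'; rewrite -E3 /u /v; move: (`|b|%N) => c.
case: (s); case: (s'); rewrite ?mulr1 => E1 E2 -> ->.
- by left; rewrite -E2 E1 mul1r.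
- by right; rewrite -E1 E2.
- by right; rewrite opprK -E2 E1.
- by left; rewrite -E1 E2 mul1r.
Qed.

(** Nothing is assumed about the inverse of [r]. Opposite exponents give both binomials the same
    degree, which already forces [r] to be a monomial; then [b = - b] is the only other outcome and
    is excluded. *)
Lemma binomial_ratio_opp A t a a' r (b : int) : subring A ->
  transc A t -> lpoly A t r -> A a -> A a' -> a != 0 -> a' != 0 ->
  b != 0 -> r * (1 + a * t ^ b) = 1 + a' * t ^ (- b) -> a' * a = 1.
Proof.
move=> sA tt Lr Aa Aa' a0 a'0 b0; have t0 := transc_neq0 sA tt.
move=> E; have [m [s [c0 E1 Eb]]] := binomial_normal a t0 b0.
have Nb0 : - b != 0 by rewrite oppr_eq0.
have [m' [s' [c'0 E2 Eb']]] := binomial_normal a' t0 Nb0.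
set u := (if s then 1 else a) in E1; set v := (if s then a else 1) in E1.
set u' := (if s' then 1 else a') in E2; set v' := (if s' then a' else 1) in E2.
have u0 : u != 0 by rewrite /u; case: (s); rewrite ?oner_eq0.
have v0 : v != 0 by rewrite /v; case: (s); rewrite ?oner_eq0.
have Au : A u by rewrite /u; case: (s) => //; apply: sr1.
have Av : A v by rewrite /v; case: (s) => //; apply: sr1.
have u'0 : u' != 0 by rewrite /u'; case: (s'); rewrite ?oner_eq0.
have v'0 : v' != 0 by rewrite /v'; case: (s'); rewrite ?oner_eq0.
have Au' : A u' by rewrite /u'; case: (s') => //; apply: sr1.
have Av' : A v' by rewrite /v'; case: (s') => //; apply: sr1.
rewrite abszN in c'0 E2.
have r0 : r != 0.
  apply/eqP => r0; move/eqP: E; rewrite r0 mul0r E2 eq_sym mulf_eq0.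
  rewrite expfz_eq0 (negbTE t0) andbF /=.
  move/eqP=> /(tt _ (over_binomial _ sA Au' Av')) /(congr1 (fun q => q`_0)).
  by rewrite coef_binomial //= coef0 => /eqP; rewrite (negbTE u'0).
have [e [q [Aq q0 Er]]] := lpoly_normal t0 Lr r0.
have [_ Eq] : e + m = m' /\
    q * (u%:P + v%:P * 'X^`|b|) = u'%:P + v'%:P * 'X^`|b|.
  apply: (lpoly_normal_uniq sA tt).
  - by apply: overM => //; apply: over_binomial.
  - exact: over_binomial.
  - by rewrite coefM big_ord1 subnn coef_binomial //= mulf_neq0.
  - by rewrite coef_binomial.
  - by rewrite -E2 -E E1 Er expfzDr // hornerM; ring.
have qn0 : q != 0 by apply: contraNneq q0 => ->; rewrite coef0.
have sq : size q = 1%N.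
  have := congr1 (fun q : {poly F} => size q) Eq.
  rewrite size_mul ?size_binomial // -?size_poly_eq0 ?size_binomial //.
  move=> E'; apply/eqP; rewrite -(eqn_add2r `|b|%N) add1n.
  by apply/eqP; rewrite -E' addnS.
rewrite (size1_polyC (eq_leq sq)) hornerC in Er.
have E' : q`_0 * t ^ e * (1 + a * t ^ b) = 1 + a' * t ^ (- b).
  by rewrite -E Er [t ^ e * _]mulrC.
have [[Ebb _]|[]//] :=
  binomial_ratio_unit sA tt Aa Aa' (Aq 0%N) a0 a'0 q0 b0 E'.
by move: b0 Ebb; lia.
Qed.

End LaurentPolynomials.

(** * Laurent rings in several variables *)

Section LaurentRings.

Variables (F : fieldType) (I : eqType).
Implicit Types (A C : F -> Prop) (v : I -> F) (S : pred I).

(** The ring C[v_i^±1 : i in S], as a generated subring: inclusions follow from minimality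
    ([laur_min]), without exponents or normal forms. *)
Inductive laur C v S : F -> Prop :=
| laur_const c of C c : laur C v S c
| laur_var i of S i : laur C v S (v i)
| laur_inv i of S i : laur C v S (v i)^-1
| laur_add f g of laur C v S f & laur C v S g : laur C v S (f + g)
| laur_mul f g of laur C v S f & laur C v S g : laur C v S (f * g).

Lemma laur_min C v S A : subring A -> (forall c, C c -> A c) ->
  (forall i, S i -> A (v i) /\ A (v i)^-1) -> forall f, laur C v S f -> A f.
Proof.
move=> sA CA vA f; elim=> {f} [c /CA //|i /vA[]//|i /vA[]//|f g _ Af _ Ag|].
  exact: srD.
by move=> f g _ Af _ Ag; apply: srM.
Qed.

Lemma laur_subring C v S : subring C -> subring (laur C v S).
Proof.
move=> sC; split; [by apply: laur_const; apply: sr1 |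
  by apply: laur_const; apply: srN1 | exact: laur_add | exact: laur_mul].
Qed.

Lemma laur_subset C v S S' f : subring C -> (forall i, S i -> S' i) ->
  laur C v S f -> laur C v S' f.
Proof.
move=> sC sub; apply: laur_min; first exact: laur_subring.
  by move=> c; apply: laur_const.
by move=> i /sub Si; split; [apply: laur_var | apply: laur_inv].
Qed.

Lemma laur_lpoly C v S S' l f : subring C -> v l != 0 ->
  (forall i, S i -> i = l \/ S' i) -> laur C v S f ->
  lpoly (laur C v S') (v l) f.
Proof.
move=> sC vl0 sub; have sA := laur_subring v S' sC.
apply: laur_min; first exact: lpoly_subring.
  by move=> c Cc; apply: lpolyA => //; apply: laur_const.
move=> i /sub[->|Si]; first by split; [apply: lpolyX | apply: lpolyV].
by split; apply: lpolyA => //; [apply: laur_var | apply: laur_inv].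
Qed.

Lemma lpoly_laur C v S l f : subring C -> v l != 0 -> S l ->
  lpoly (laur C v S) (v l) f -> laur C v S f.
Proof.
move=> sC vl0 Sl [p [d [Ap Ep]]]; have sA := laur_subring v S sC.
have -> : f = p.[v l] * (v l)^-1 ^+ d.
  by rewrite -Ep exprVn mulfK // expf_neq0.
apply: srM => //; last by apply: srX => //; apply: laur_inv.
rewrite horner_coef; apply: sr_sum => // i _; apply: srM => //.
by apply: srX => //; apply: laur_var.
Qed.

Lemma laur_cap C v (s : seq I) f : subring C ->
  (forall l, transc (laur C v (predC1 l)) (v l)) ->
  laur C v (mem s) f -> (forall l, l \in s -> laur C v (predC1 l) f) -> C f.
Proof.
move=> sC tr; elim: s f => [|l s IH] f Lf Af.
  by move: Lf; apply: laur_min.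
have sAl := laur_subring v (predC1 l) sC; have vl0 := transc_neq0 sAl (tr l).
case ls: (l \in s).
  apply: IH; last by move=> l' l's; apply: Af; rewrite inE l's orbT.
  apply: laur_subset Lf => // i; rewrite /= inE.
  by case/predU1P => [->|].
have sub g : laur C v (mem s) g -> laur C v (predC1 l) g.
  apply: laur_subset => // i /= si; apply: contraTneq si => ->.
  by rewrite ls.
have [p [d [Ap Ep]]] : lpoly (laur C v (mem s)) (v l) f.
  apply: laur_lpoly Lf => // i; rewrite /= inE.
  by case/predU1P => [->|si]; [left | right].
apply: IH; last by move=> l' l's; apply: Af; rewrite inE l's orbT.
suff -> : f = p`_d by apply: Ap.
have -> : p = f%:P * 'X^d.
  apply: (transc_inj sAl (tr l)).
  - by move=> i; apply: sub.
  - apply: overM => //; last exact: overXn.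
    by apply: overC => //; apply: Af; rewrite inE eqxx.
  - by rewrite -Ep !hornerE.
by rewrite coefCM coefXn eqxx mulr1.
Qed.

End LaurentRings.

Lemma laur_reindex (F : fieldType) (I J : eqType) (C : F -> Prop)
    (v : I -> F) (w : J -> F) (h : I -> J) (S : pred I) (S' : pred J) f :
  subring C -> (forall i, w (h i) = v i) -> (forall i, S i -> S' (h i)) ->
  laur C v S f -> laur C w S' f.
Proof.
move=> sC wh sub; apply: laur_min; first exact: laur_subring.
  by move=> c; apply: laur_const.
by move=> i /sub Si; rewrite -wh; split; [apply: laur_var | apply: laur_inv].
Qed.

(** * Free families and transcendence over the Laurent ring of the other variables *)

Section Freeness.

Variables (K : comNzRingType) (F : fieldType) (phi : {rmorphism K -> F}).
Variable m : nat.

Definition img (f : F) := exists c, f = phi c.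

Lemma img_subring : subring img.
Proof.
split.
- by exists 1; rewrite rmorph1.
- by exists (-1); rewrite rmorphN1.
- by move=> _ _ [a ->] [b ->]; exists (a + b); rewrite rmorphD.
- by move=> _ _ [a ->] [b ->]; exists (a * b); rewrite rmorphM.
Qed.

Definition free_over (v : 'I_m -> F) :=
  forall p : {mpoly K[m]}, mmap phi v p = 0 -> p = 0.

Lemma free_neq0 (v : 'I_m -> F) i : free_over v -> v i != 0.
Proof.
move=> fv; apply/eqP => vi0.
have : 'X_i = 0 :> {mpoly K[m]} by apply: fv; rewrite mmapX mmap1U.
move/(congr1 (mcoeff U_(i))); rewrite mcoeffX eqxx mcoeff0 => /eqP.
by rewrite oner_eq0.
Qed.

(** The isolation of the variable ['X_l]; the equation [unipoly l q = q%:P] is the way to say that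
    [q] does not involve it. *)
Definition unipoly (l : 'I_m) : {mpoly K[m]} -> {poly {mpoly K[m]}} :=
  mmap (polyC \o @mpolyC m K) (fun i => if i == l then 'X else ('X_i)%:P).

HB.instance Definition _ l :=
  GRing.RMorphism.on (unipoly l).

Lemma laur_fraction (v : 'I_m -> F) l f : (forall i, v i != 0) ->
  laur img v (predC1 l) f -> exists (q : {mpoly K[m]}) (d : 'X_{1..m}),
    [/\ unipoly l q = q%:P, unipoly l 'X_[d] = 'X_[d]%:P &
        f * mmap1 v d = mmap phi v q].
Proof.
move=> v0; elim=> {f}.
- move=> _ [c ->]; exists c%:MP, 0%MM; split.
  + by rewrite /unipoly mmapC.
  + by rewrite mpolyX0 rmorph1.
  + by rewrite mmapC mmap11 mulr1.
- move=> i /= il; exists 'X_i, 0%MM; split.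
  + by rewrite /unipoly mmapX mmap1U (negbTE il).
  + by rewrite mpolyX0 rmorph1.
  + by rewrite mmapX mmap11 mulr1 mmap1U.
- move=> i /= il; exists 1, U_(i)%MM; split.
  + by rewrite rmorph1.
  + by rewrite /unipoly mmapX mmap1U (negbTE il).
  + by rewrite rmorph1 mmap1U mulVf.
- move=> f g _ [q [d [uq ud Ef]]] _ [r [e [ur ue Eg]]].
  exists (q * 'X_[e] + r * 'X_[d]), (d + e)%MM; split.
  + by rewrite rmorphD !rmorphM /= uq ur ud ue ?polyCD ?polyCM.
  + by rewrite mpolyXD !rmorphM /= ud ue ?polyCM.
  + rewrite rmorphD !rmorphM /= -Ef -Eg -!(mmapX _ phi) mpolyXD rmorphM /=.
    by ring.
- move=> f g _ [q [d [uq ud Ef]]] _ [r [e [ur ue Eg]]].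
  exists (q * r), (d + e)%MM; split.
  + by rewrite !rmorphM /= uq ur ?polyCM.
  + by rewrite mpolyXD !rmorphM /= ud ue ?polyCM.
  + by rewrite !rmorphM /= -Ef -Eg -!(mmapX _ phi) mpolyXD rmorphM /=; ring.
Qed.

(** A common monomial denominator turns the coefficients of [p] into polynomials without ['X_l]. The
    relation at [v l] then lifts to an identity of polynomials, in which [unipoly l] separates the
    powers of ['X_l]. *)
Lemma free_transc (v : 'I_m -> F) l : free_over v ->
  transc (laur img v (predC1 l)) (v l).
Proof.
move=> fv p Ap p0; have v0 i := free_neq0 i fv.
have common k : exists (q : nat -> {mpoly K[m]}) (d : 'X_{1..m}),
    unipoly l 'X_[d] = 'X_[d]%:P /\ forall r, (r < k)%N ->
      unipoly l (q r) = (q r)%:P /\ p`_r * mmap1 v d = mmap phi v (q r).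
  elim: k => [|k [q [d [ud Hq]]]].
    by exists (fun=> 0), 0%MM; rewrite mpolyX0 rmorph1.
  have [qk [dk [uqk udk Ek]]] := laur_fraction v0 (Ap k).
  exists (fun r => if (r < k)%N then q r * 'X_[dk] else qk * 'X_[d]), (d + dk)%MM.
  split; first by rewrite mpolyXD !rmorphM /= ud udk.
  move=> r; rewrite ltnS leq_eqVlt => /predU1P[->|rk].
    rewrite ltnn !rmorphM /= uqk ud -Ek -!(mmapX _ phi) mpolyXD rmorphM /=.
    by split=> //; ring.
  have [uq Eq] := Hq _ rk; rewrite rk !rmorphM /= uq udk -Eq -!(mmapX _ phi) mpolyXD.
  by rewrite rmorphM /=; split=> //; ring.
have [q [d [_ Hq]]] := common (size p).
have E : \sum_(r < size p) q r * 'X_l ^+ r = 0.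
  apply: fv; rewrite rmorph_sum /=.
  transitivity (p.[v l] * mmap1 v d); last by rewrite p0 mul0r.
  rewrite horner_coef mulr_suml; apply: eq_bigr => r _.
  have [_ Eq] := Hq r (ltn_ord r).
  by rewrite rmorphM rmorphXn /= -Eq mmapX mmap1U; ring.
have {}E : \poly_(r < size p) q r = 0.
  move/(congr1 (unipoly l)): E; rewrite rmorph0 rmorph_sum /= => E.
  rewrite poly_def -[RHS]E; apply: eq_bigr => r _.
  rewrite rmorphM rmorphXn /=; have [-> _] := Hq r (ltn_ord r).
  by rewrite -mul_polyC; congr (_ * _ ^+ _); rewrite /unipoly mmapX mmap1U eqxx.
apply/polyP => r; rewrite coef0; have [rs|rs] := ltnP r (size p); last first.
  by rewrite nth_default.
have [_ Eq] := Hq _ rs; have := congr1 (fun s : {poly _} => s`_r) E.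
rewrite coef_poly rs coef0 => qr0; move/eqP: Eq; rewrite qr0 rmorph0 mulf_eq0.
rewrite /mmap1 => /orP[/eqP //|]; rewrite prodf_seq_eq0 => /hasP[i _ /=].
by rewrite expf_eq0 (negbTE (v0 i)) andbF.
Qed.

End Freeness.

(** * Specialization of integer Laurent polynomials *)

Section Specialization.

Variables (F G : fieldType) (m : nat) (v : 'I_m -> F) (w : 'I_m -> G).

(** Substitution of [w] for [v], as a relation because it is meaningful only on Laurent polynomials
    in [v]; it is single-valued by [spec_fun]. *)
Inductive spec : F -> G -> Prop :=
| spec_int (z : int) : spec z%:~R z%:~R
| spec_var i : spec (v i) (w i)
| spec_inv i : spec (v i)^-1 (w i)^-1
| spec_add f g f' g' of spec f f' & spec g g' : spec (f + g) (f' + g')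
| spec_mul f g f' g' of spec f f' & spec g g' : spec (f * g) (f' * g').

Let intF : {rmorphism int -> F} := intr.
Let intG : {rmorphism int -> G} := intr.

Lemma spec_fraction f f' : (forall i, v i != 0) -> (forall i, w i != 0) ->
  spec f f' -> exists (q : {mpoly int[m]}) (d : 'X_{1..m}),
    f * mmap1 v d = mmap intF v q /\ f' * mmap1 w d = mmap intG w q.
Proof.
move=> v0 w0; elim=> {f f'}.
- by move=> z; exists z%:MP, 0%MM; rewrite !mmapC !mmap11 !mulr1.
- by move=> i; exists 'X_i, 0%MM; rewrite !mmapX !mmap11 !mulr1 !mmap1U.
- by move=> i; exists 1, U_(i)%MM; rewrite !rmorph1 !mmap1U !mulVf.
- move=> f g f' g' _ [q [d [Ef Ef']]] _ [r [e [Eg Eg']]].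
  exists (q * 'X_[e] + r * 'X_[d]), (d + e)%MM.
  rewrite !rmorphD !rmorphM /= !mmapX -Ef -Eg -Ef' -Eg' -!(mmapX v intF).
  by rewrite -!(mmapX w intG) mpolyXD !rmorphM /=; split; ring.
- move=> f g f' g' _ [q [d [Ef Ef']]] _ [r [e [Eg Eg']]].
  exists (q * r), (d + e)%MM.
  rewrite !rmorphM /= -Ef -Eg -Ef' -Eg' -!(mmapX v intF).
  by rewrite -!(mmapX w intG) mpolyXD !rmorphM /=; split; ring.
Qed.

(** After clearing monomials, one integer polynomial represents both sides; it vanishes at the free
    family [v], hence is zero and vanishes at [w] too. *)
Lemma spec0 f' : free_over intF v -> (forall i, w i != 0) -> spec 0 f' ->
  f' = 0.
Proof.
move=> fv w0 /(spec_fraction (fun i => free_neq0 i fv) w0) [q [d [E E']]].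
move: E'; rewrite (fv q) -?E ?mul0r // rmorph0 => /eqP.
rewrite mulf_eq0 /mmap1 => /orP[/eqP //|].
rewrite prodf_seq_eq0 => /hasP[i _ /=].
by rewrite expf_eq0 (negbTE (w0 i)) andbF.
Qed.

Lemma spec_fun f f' f'' : free_over intF v -> (forall i, w i != 0) ->
  spec f f' -> spec f f'' -> f' = f''.
Proof.
move=> fv w0 sf sf'; apply/eqP; rewrite -subr_eq0; apply/eqP.
apply: spec0 => //; rewrite -(subrr f); apply: spec_add => //.
rewrite -mulN1r -[in X in spec _ X]mulN1r -[in X in spec X _](intrN _ 1).
by rewrite -[in X in spec _ X](intrN _ 1); apply: spec_mul => //; apply: spec_int.
Qed.

Lemma laur_spec f : laur (img intF) v predT f -> exists f', spec f f'.
Proof.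
elim=> {f} [_ [z ->]|i _|i _|f g _ [f' sf] _ [g' sg]|f g _ [f' sf] _ [g' sg]].
- by exists z%:~R; apply: spec_int.
- by exists (w i); apply: spec_var.
- by exists (w i)^-1; apply: spec_inv.
- by exists (f' + g'); apply: spec_add.
- by exists (f' * g'); apply: spec_mul.
Qed.

Lemma spec_laur f f' : spec f f' -> laur (img intG) w predT f'.
Proof.
elim=> {f f'} [z|i|i|f g f' g' _ sf _ sg|f g f' g' _ sf _ sg].
- by apply: laur_const; exists z.
- exact: laur_var.
- exact: laur_inv.
- exact: laur_add.
- exact: laur_mul.
Qed.

End Specialization.

(** * Exchange matrices *)

Lemma pospart_ge0 (a : int) : 0 <= pospart a.
Proof. by rewrite /pospart le_max lexx orbT. Qed.

Lemma pospartE (a : int) : pospart a = if 0 <= a then a else 0.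
Proof. by rewrite /pospart; case: lerP => [/max_idPl|/ltW/max_idPr]. Qed.

Lemma pospartB (a : int) : pospart a - pospart (- a) = a.
Proof. by rewrite !pospartE; case: ifP; case: ifP; lia. Qed.

Lemma pospart0 : pospart 0 = 0.
Proof. by rewrite pospartE. Qed.

Lemma pospart_nat (m : nat) : pospart m%:Z = m%:Z.
Proof. by rewrite pospartE. Qed.

Lemma pospart_opp_nat (m : nat) : pospart (- m%:Z) = 0.
Proof. by rewrite pospartE; case: ifP => //; lia. Qed.

Section ExchangeMatrices.

Variable n : nat.
Implicit Types (B : 'M[int]_n) (i j k : 'I_n).

Lemma mx_mut_edge k B i j : (i == k) || (j == k) -> mx_mut k B i j = - B i j.
Proof. by move=> H; rewrite mxE H. Qed.

(** In this form the change is a combination of the exponents of the two exchange monomials at [k],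
    which lets [ghat_mut] collect powers of those monomials. *)
Lemma mx_mutE k B i j : i != k -> j != k -> mx_mut k B i j = B i j +
  pospart (B i k) * pospart (B k j) - pospart (- B i k) * pospart (- B k j).
Proof.
move=> /negbTE ik /negbTE jk; rewrite mxE ik jk /= -addrA; congr (_ + _).
move: (B i k) (B k j) => a b; rewrite !pospartE.
have [a0|a0|->] := ltrgtP a 0; last by rewrite sgr0 oppr0 !mul0r subr0.
- rewrite ltr0_sg // nmulr_rge0 //.
  by do ![case: ifP => ?]; nia.
- rewrite gtr0_sg // pmulr_rge0 // mul1r.
  by do ![case: ifP => ?]; nia.
Qed.

Lemma mx_mutK k : involutive (@mx_mut n k).
Proof.
move=> B; apply/matrixP => i j; rewrite [LHS]mxE.
case E: ((i == k) || (j == k)); first by rewrite mx_mut_edge // opprK.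
rewrite (mx_mut_edge B (i := i) (j := k)) ?eqxx ?orbT //.
rewrite (mx_mut_edge B (i := k) (j := j)) ?eqxx //.
by rewrite mxE E mulrNN sgrN mulNr addrK.
Qed.

Definition mx_word B (w : seq 'I_n) := foldl (fun C k => mx_mut k C) B w.

Lemma tsss_word B w : totally_sign_skew_symmetric B ->
  totally_sign_skew_symmetric (mx_word B w).
Proof. by move=> tB ks; rewrite /mx_word -foldl_cat; apply: tB. Qed.

Lemma tsss_mut B k : totally_sign_skew_symmetric B ->
  totally_sign_skew_symmetric (mx_mut k B).
Proof. exact: (@tsss_word B [:: k]). Qed.

Lemma tsss_sss B : totally_sign_skew_symmetric B -> sign_skew_symmetric B.
Proof. by move/(_ [::]). Qed.

Lemma sss_diag B k : sign_skew_symmetric B -> B k k = 0.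
Proof. by move=> /(_ k k) [H _]; nia. Qed.

Lemma sss_eq0 B i j : sign_skew_symmetric B -> B i j = 0 -> B j i = 0.
Proof. by move=> /(_ i j)[_ H] b0; case: H => //; rewrite b0 mul0r. Qed.

Lemma sss_gt0 B i j : sign_skew_symmetric B -> 0 < B i j -> B j i < 0.
Proof.
move=> sB b0; have [H1 H2] := sB i j.
by have := sss_eq0 (i := j) (j := i) sB; nia.
Qed.

Lemma sss_lt0 B i j : sign_skew_symmetric B -> B i j < 0 -> 0 < B j i.
Proof.
move=> sB b0; have [H1 H2] := sB i j.
by have := sss_eq0 (i := j) (j := i) sB; nia.
Qed.

End ExchangeMatrices.

(** * Seeds with coefficients in a field *)

Section Monomials.

Variables (F : fieldType) (I : finType).
Implicit Types (x : I -> F) (e : I -> int).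

Definition mon x e := \prod_i x i ^ e i.

Lemma mon_neq0 x e : (forall i, x i != 0) -> mon x e != 0.
Proof. by move=> x0; apply/prodf_neq0 => i _; apply: expfz_neq0. Qed.

Lemma eq_mon x e e' : e =1 e' -> mon x e = mon x e'.
Proof. by move=> E; apply: eq_bigr => i _; rewrite E. Qed.

Lemma monD x e e' : (forall i, x i != 0) ->
  mon x (fun i => e i + e' i) = mon x e * mon x e'.
Proof.
by move=> x0; rewrite /mon -big_split /=; apply: eq_bigr => i _; rewrite expfzDr.
Qed.

Lemma monN x e : mon x (fun i => - e i) = (mon x e)^-1.
Proof. by rewrite /mon -prodfV; apply: eq_bigr => i _; rewrite invr_expz. Qed.

Lemma monZ x e (m : int) : mon x (fun i => e i * m) = mon x e ^ m.
Proof.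
rewrite /mon; apply: (big_rec2 (fun a b => a = b ^ m)); first by rewrite exp1rz.
by move=> i a b _ ->; rewrite expfzMl exprz_exp.
Qed.

Lemma monM x y e : mon (fun i => x i * y i) e = mon x e * mon y e.
Proof. by rewrite /mon -big_split /=; apply: eq_bigr => i _; rewrite expfzMl. Qed.

Lemma mon_laur (C : F -> Prop) x e (S : pred I) : subring C ->
  (forall i, ~~ S i -> e i = 0) -> laur C x S (mon x e).
Proof.
move=> sC e0; have sA := laur_subring x S sC.
apply: sr_prod => // i _; case Si: (S i); last first.
  by rewrite e0 ?Si // expr0z; apply: sr1.
by apply: sr_exprz => //; [apply: laur_var | apply: laur_inv].
Qed.

End Monomials.

(** A semifield inside [F]. Its only purpose is to certify that elements such as [1 + ghat s k] are
    nonzero without computing them. *)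
Record pos_field (F : fieldType) (Q : F -> Prop) : Prop := PosField {
  pf1 : Q 1;
  pf_neq0 : forall f, Q f -> f != 0;
  pfD : forall f g, Q f -> Q g -> Q (f + g);
  pfM : forall f g, Q f -> Q g -> Q (f * g);
  pfV : forall f, Q f -> Q f^-1
}.

Section PosFields.

Variables (F : fieldType) (Q : F -> Prop).
Hypothesis pQ : pos_field Q.

Lemma pfX f m : Q f -> Q (f ^+ m).
Proof.
move=> Qf; elim: m => [|m IH]; first by rewrite expr0; apply: pf1.
by rewrite exprS; apply: pfM.
Qed.

Lemma pf_exprz f (m : int) : Q f -> Q (f ^ m).
Proof.
move=> Qf; case: m => m; first exact: pfX.
by rewrite NegzE -exprnN; apply: pfV => //; apply: pfX.
Qed.

Lemma pf_mon (I : finType) (x : I -> F) e : (forall i, Q (x i)) -> Q (mon x e).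
Proof.
move=> Qx; apply: (big_ind Q); [exact: pf1 | exact: pfM |].
by move=> i _; apply: pf_exprz.
Qed.

End PosFields.

(** * Mutation of seeds with an arbitrary normalizing scalar *)

Section GeneralSeeds.

Variables (F : fieldType) (n : nat).

Record gseed := GSeed {
  gx : {ffun 'I_n -> F};
  gk : {ffun 'I_n -> F};
  gB : 'M[int]_n
}.

Implicit Types (s : gseed) (i j k : 'I_n) (mu : F).

Definition posexp (B : 'M[int]_n) k i := pospart (B i k).
Definition negexp (B : 'M[int]_n) k i := pospart (- B i k).

(** The scalar [mu] replaces y_k ⊕ 1. The value 1 gives mutation without normalization, and [gk s k]
    gives a preimage under the latter. *)
Definition gmut mu k s : gseed :=
  GSeed
    [ffun i => if i == k then
        (gk s k * mon (gx s) (posexp (gB s) k) + mon (gx s) (negexp (gB s) k))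
        / (mu * gx s k)
      else gx s i]
    [ffun i => if i == k then (gk s k)^-1
      else gk s i * gk s k ^ pospart (gB s k i) * mu ^ (- gB s k i)]
    (mx_mut k (gB s)).

(* The variables usually written [hat y_j]. *)
Definition ghat s j := gk s j * mon (gx s) (fun i => gB s i j).

Definition gpos (Q : F -> Prop) s :=
  (forall i, Q (gx s i)) /\ (forall i, Q (gk s i)).

Lemma gmut_pos (Q : F -> Prop) mu k s : pos_field Q -> Q mu -> gpos Q s ->
  gpos Q (gmut mu k s).
Proof.
move=> pQ Qmu [Qx Qk]; split=> i; rewrite ffunE; case: eqP => _ //.
- apply: pfM => //; last by apply: pfV => //; apply: pfM.
  by apply: pfD => //; [apply: pfM => // |]; apply: pf_mon.
- exact: pfV.
- by do 2 (apply: pfM => //; last exact: pf_exprz).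
Qed.

Lemma gpos_neq0 (Q : F -> Prop) s : pos_field Q -> gpos Q s ->
  (forall i, gx s i != 0) * (forall i, gk s i != 0).
Proof. by move=> pQ [Qx Qk]; split=> i; apply: (pf_neq0 pQ). Qed.

Lemma ghat_pos (Q : F -> Prop) s k : pos_field Q -> gpos Q s -> Q (ghat s k).
Proof. by move=> pQ [Qx Qk]; apply: pfM => //; apply: pf_mon. Qed.

Lemma gx_mut_other mu k s i : i != k -> gx (gmut mu k s) i = gx s i.
Proof. by move=> /negbTE ik; rewrite ffunE ik. Qed.

Lemma posexpE s k : (forall i, gx s i != 0) -> mon (gx s) (posexp (gB s) k) =
  mon (gx s) (fun i => gB s i k) * mon (gx s) (negexp (gB s) k).
Proof.
move=> x0; rewrite -monD //; apply: eq_mon => i.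
by rewrite /posexp /negexp -[X in _ = X + _]pospartB subrK.
Qed.

Lemma gx_mut mu k s : (forall i, gx s i != 0) -> gx (gmut mu k s) k =
  (1 + ghat s k) * mon (gx s) (negexp (gB s) k) / (mu * gx s k).
Proof.
move=> x0; rewrite ffunE eqxx posexpE // /ghat; congr (_ / _).
by ring.
Qed.

Lemma ghat_mut_same mu k s : gB s k k = 0 ->
  ghat (gmut mu k s) k = (ghat s k)^-1.
Proof.
move=> b0; rewrite /ghat ffunE eqxx invfM; congr (_ * _); rewrite -monN.
apply: eq_bigr => i _; rewrite mx_mut_edge ?eqxx ?orbT //.
by have [->|ik] := eqVneq i k; rewrite ?b0 ?oppr0 ?expr0z // gx_mut_other.
Qed.

(** The power of [mu] in the new coefficient cancels against the one in the new variable, so the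
    rule is the same for every normalization. *)
Lemma ghat_mut mu k s j : (forall i, gx s i != 0) -> (forall i, gk s i != 0) ->
  mu != 0 -> 1 + ghat s k != 0 -> gB s k k = 0 -> j != k ->
  ghat (gmut mu k s) j =
    ghat s j * ghat s k ^ pospart (gB s k j) * (1 + ghat s k) ^ (- gB s k j).
Proof.
move=> x0 k0 mu0 h0 b0 jk.
set b := gB s k j; set N := mon (gx s) (negexp (gB s) k).
have N0 : N != 0 by apply: mon_neq0.
have E1 : mon (gx s) (fun i => gB s i j + posexp (gB s) k i * pospart b
      + negexp (gB s) k i * - pospart (- b)) =
    mon (gx s) (fun i => gB s i j) *
    mon (gx s) (fun i => gB s i k) ^ pospart b * N ^ b.
  have -> : N ^ b = N ^ pospart b * N ^ (- pospart (- b)).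
    by rewrite -expfzDr // pospartB.
  by rewrite !monD // !monZ posexpE // -/N expfzMl !mulrA.
have E2 : mon (gx (gmut mu k s)) (fun i => gB (gmut mu k s) i j) =
    gx (gmut mu k s) k ^ (- b) * (mon (gx s) (fun i => gB s i j +
      posexp (gB s) k i * pospart b + negexp (gB s) k i * - pospart (- b))
      * gx s k ^ (- b)).
  rewrite /mon (bigD1 k) //= mx_mut_edge ?eqxx //; congr (_ * _).
  rewrite [in RHS](bigD1 k) //= /posexp /negexp b0 oppr0 pospart0 !mul0r !addr0.
  rewrite mulrAC -expfzDr // subrr expr0z mul1r; apply: eq_bigr => i ik.
  by rewrite -/(gx _) gx_mut_other // mx_mutE // mulrN.
rewrite [LHS]/ghat [ghat s j]/ghat E2 E1 gx_mut // -/N ffunE (negbTE jk) -/b.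
have -> : ghat s k ^ pospart b =
    gk s k ^ pospart b * mon (gx s) (fun i => gB s i k) ^ pospart b.
  by rewrite expfzMl.
rewrite !expfzMl !exprz_inv opprK !expfzMl -!invr_expz.
have := expfz_neq0 b N0; have := expfz_neq0 b mu0; have := expfz_neq0 b (x0 k).
have := expfz_neq0 b h0 => h1 h2 h3 h4.
by field; rewrite h1 h2 h3 h4.
Qed.

Definition gword s (w : seq 'I_n) := foldl (fun s k => gmut 1 k s) s w.

Lemma gword_cons s k w : gword s (k :: w) = gword (gmut 1 k s) w.
Proof. by []. Qed.

Lemma gword_pos (Q : F -> Prop) s w : pos_field Q -> gpos Q s ->
  gpos Q (gword s w).
Proof.
move=> pQ; elim: w s => //= k w IH s ps; apply: IH.
by apply: gmut_pos => //; apply: pf1.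
Qed.

Lemma gB_word s w : gB (gword s w) = mx_word (gB s) w.
Proof. by elim: w s => //= k w IH s; rewrite IH. Qed.

Lemma gseed_eq s s' : gx s =1 gx s' -> gk s =1 gk s' -> gB s = gB s' -> s = s'.
Proof.
case: s s' => [x k B] [x' k' B'] /= ex ek ->.
by congr GSeed; apply/ffunP.
Qed.

(** Two mutations at [k] with scalar 1 would divide the variable by its coefficient; the scalar
    [gk s k] in the first one compensates for this. *)
Lemma gmutK (Q : F -> Prop) k s : pos_field Q -> gpos Q s -> gB s k k = 0 ->
  gmut 1 k (gmut (gk s k) k s) = s.
Proof.
move=> pQ ps b0; have [x0 k0] := gpos_neq0 pQ ps.
have h0 : 1 + ghat s k != 0.
  by apply: (pf_neq0 pQ); apply: pfD => //; [apply: pf1 | apply: ghat_pos].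
set s' := gmut (gk s k) k s.
have ps' : gpos Q s' by apply: gmut_pos => //; case: ps => _; apply.
have [x'0 _] := gpos_neq0 pQ ps'.
apply: gseed_eq => [i|i|]; last exact: mx_mutK.
- have [->|ik] := eqVneq i k; last by rewrite !gx_mut_other.
  rewrite gx_mut // ghat_mut_same // {2}/s' gx_mut // mul1r.
  have -> : mon (gx s') (negexp (gB s') k) = mon (gx s) (posexp (gB s) k).
    apply: eq_bigr => j _; rewrite /negexp /posexp mx_mut_edge ?eqxx ?orbT //.
    rewrite opprK; have [->|jk] := eqVneq j k; last by rewrite gx_mut_other.
    by rewrite b0 pospart0 !expr0z.
  rewrite posexpE //; set M := mon _ _; set N := mon _ _.
  have M0 : M != 0 by apply: mon_neq0.
  have N0 : N != 0 by apply: mon_neq0.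
  rewrite /ghat -/M in h0 *.
  have kM0 : gk s k * M != 0 by rewrite mulf_neq0.
  by field; rewrite h0 k0 N0 M0 x0.
- rewrite ffunE; have [->|ik] := eqVneq i k.
    by rewrite ffunE eqxx invrK.
  rewrite exp1rz mulr1 !ffunE eqxx (negbTE ik) mx_mut_edge ?eqxx //.
  rewrite -mulrA -mulrA -[RHS]mulr1; congr (_ * _).
  rewrite exprz_inv -!expfzDr // -[RHS](expr0z (gk s k)); congr (_ ^ _).
  by have := pospartB (gB s k i); lia.
Qed.

End GeneralSeeds.

(** * Evaluation of subtraction-free expressions in a semifield *)

Section Evaluation.

Variables (F : fieldType) (A : semifieldType) (T : eqType) (tmul : T -> T -> T).
Variables (e : T -> F) (theta : T -> A).
Hypothesis eM : forall s t, e (tmul s t) = e s * e t.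
Hypothesis thetaM : forall s t, theta (tmul s t) = (theta s * theta t)%g.
Hypothesis e_inj : forall l l' : seq T,
  \sum_(t <- l) e t = \sum_(t <- l') e t -> perm_eq l l'.

(** Here [T] indexes monomials, [e] is their value in the field and [theta] their value in the
    semifield; a pair is related when one subtraction-free expression produces both entries. *)
Inductive ev : F -> A -> Prop :=
| ev_base t : ev (e t) (theta t)
| ev_add f g a b of ev f a & ev g b : ev (f + g) (oplus a b)
| ev_mul f g a b of ev f a & ev g b : ev (f * g) (a * b)%g
| ev_inv f a of ev f a : ev f^-1 a^-1%g.

Local Notation oadd := (oAC (@oplusA A) (@oplusC A)).

(** A semifield has no zero, so the empty sum gets the value [None]. *)
Definition osum (l : seq T) : option A :=
  \big[oadd/None]_(t <- l) Some (theta t).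

Definition esum (l : seq T) : F := \sum_(t <- l) e t.

Definition lmul (l l' : seq T) := [seq tmul s t | s <- l, t <- l'].

Definition omul (a b : option A) :=
  if (a, b) is (Some a, Some b) then Some (a * b)%g else None.

Lemma omulDr (a b c : option A) :
  omul a (oadd b c) = oadd (omul a b) (omul a c).
Proof.
by case: a b c => [a|] [b|] [c|] //=; rewrite /omul /oAC /= ?mulg_oplusr.
Qed.

Lemma omulC (a b : option A) : omul a b = omul b a.
Proof. by case: a b => [a|] [b|] //; rewrite /omul /= semifield_mulgC. Qed.

Lemma osum_lmul l l' : osum (lmul l l') = omul (osum l) (osum l').
Proof.
elim: l => [|s l IH] /=; first by rewrite /osum !big_nil.
rewrite /osum big_cat big_cons /= -/(osum _) -/(osum _) IH.
rewrite [RHS]omulC omulDr ![omul (osum l') _]omulC; congr (oadd _ _).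
elim: l' {IH} => [|t l' IH]; first by rewrite /osum !big_nil.
by rewrite /osum map_cons !big_cons omulDr -IH /= thetaM.
Qed.

Lemma esum_lmul l l' : esum (lmul l l') = esum l * esum l'.
Proof.
elim: l => [|s l IH] /=; first by rewrite /esum !big_nil mul0r.
rewrite /esum big_cat big_cons /= mulrDl; congr (_ + _); last exact: IH.
by rewrite big_map mulr_sumr; apply: eq_bigr => t _; rewrite eM.
Qed.

Lemma osum_cat l l' : osum (l ++ l') = oadd (osum l) (osum l').
Proof. by rewrite /osum big_cat. Qed.

Lemma esum_cat l l' : esum (l ++ l') = esum l + esum l'.
Proof. by rewrite /esum big_cat. Qed.

Lemma esum_neq0 l a : osum l = Some a -> esum l != 0.
Proof.
move=> E; apply/eqP => l0.
have /perm_nilP l_nil : perm_eq l [::] by apply: e_inj; rewrite big_nil.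
by move: E; rewrite l_nil /osum big_nil.
Qed.

Lemma ev_fraction f a : ev f a -> exists l l' b, [/\ osum l' = Some b,
  osum l = Some (a * b)%g & f * esum l' = esum l].
Proof.
elim=> {f a}.
- move=> t; exists [:: tmul t t], [:: t], (theta t).
  by rewrite /osum /esum !big_seq1 /oAC /= thetaM eM.
- move=> f g a b _ [l [l' [c [ol' ol Ef]]]] _ [r [r' [d [or' or Eg]]]].
  exists (lmul l r' ++ lmul r l'), (lmul l' r'), (c * d)%g.
  rewrite osum_cat !osum_lmul ol ol' or or' /=; split=> //.
    rewrite /oAC /=; congr Some.
    rewrite [in RHS]semifield_mulgC mulg_oplusr; congr (oplus _ _).
      by rewrite [RHS]semifield_mulgC mulgA.
    rewrite [RHS]semifield_mulgC -mulgA; congr (_ * _)%g.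
    exact: semifield_mulgC.
  by rewrite esum_cat !esum_lmul -Ef -Eg; ring.
- move=> f g a b _ [l [l' [c [ol' ol Ef]]]] _ [r [r' [d [or' or Eg]]]].
  exists (lmul l r), (lmul l' r'), (c * d)%g.
  rewrite !osum_lmul ol ol' or or' /=; split=> //.
    congr Some; rewrite -!mulgA; congr (_ * _)%g.
    by rewrite [RHS]mulgA [(b * c)%g]semifield_mulgC -mulgA.
  by rewrite !esum_lmul -Ef -Eg; ring.
- move=> f a _ [l [l' [c [ol' ol Ef]]]].
  exists l', l, (a * c)%g; split=> //; first by rewrite mulgA mulVg mul1g.
  rewrite -Ef mulKf //; have := esum_neq0 ol; rewrite -Ef mulf_eq0.
  by case/norP.
Qed.

(** Two expressions of [f] become, after cross-multiplication, two equal sums of monomials. By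
    [e_inj] these agree as multisets, and so have the same value in every semifield. *)
Lemma ev_fun f a b : ev f a -> ev f b -> a = b.
Proof.
move=> /ev_fraction[l [l' [c [ol' ol Ef]]]] /ev_fraction[r [r' [d [or' or Eg]]]].
have pe : perm_eq (lmul l r') (lmul r l').
  apply: e_inj; rewrite -!/(esum _) !esum_lmul -Ef -Eg.
  by ring.
have : osum (lmul l r') = osum (lmul r l') by apply: perm_big.
rewrite !osum_lmul ol ol' or or' /= => -[] E.
apply: (@mulIg _ (c * d)%g); rewrite mulgA E -mulgA.
by rewrite [(d * c)%g]semifield_mulgC.
Qed.

Lemma ev_neq0 f a : ev f a -> f != 0.
Proof.
case/ev_fraction=> l [l' [c [ol' ol Ef]]].
by have := esum_neq0 ol; rewrite -Ef mulf_eq0 => /norP[].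
Qed.

Lemma ev1 (t : T) : ev 1 1%g.
Proof.
have et := ev_base t; rewrite -(mulfV (ev_neq0 et)) -(mulgV (theta t)).
by apply: ev_mul => //; apply: ev_inv.
Qed.

Lemma ev_pos_field (t : T) : pos_field (fun f => exists a, ev f a).
Proof.
split.
- by exists 1%g; apply: ev1.
- by move=> f [a /ev_neq0].
- by move=> f g [a ef] [b eg]; exists (oplus a b); apply: ev_add.
- by move=> f g [a ef] [b eg]; exists (a * b)%g; apply: ev_mul.
- by move=> f [a ef]; exists a^-1%g; apply: ev_inv.
Qed.

Lemma ev_expr (t : T) f a m : ev f a -> ev (f ^+ m) (a ^+ m)%g.
Proof.
move=> ef; elim: m => [|m IH]; first by rewrite expr0 expg0; apply: ev1.
by rewrite exprS expgS; apply: ev_mul.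
Qed.

Lemma ev_exprz (t : T) f a (m : int) : ev f a -> ev (f ^ m) (zexpg a m).
Proof.
move=> ef; case: m => m; first exact: ev_expr.
by rewrite NegzE -exprnN /=; apply: ev_inv; apply: ev_expr.
Qed.

End Evaluation.

(** * The tropical semifield of integer polynomials *)

(** This closure under addition is the transitivity of the order that defines [tmax]. *)
Lemma lead_coef_ge0D (p q : {poly int}) :
  0 <= lead_coef p -> 0 <= lead_coef q -> 0 <= lead_coef (p + q).
Proof.
wlog pq : p q / (size q <= size p)%N.
  move=> H p0 q0; case/orP: (leq_total (size q) (size p)) => s; first exact: H.
  by rewrite addrC; apply: H.
move=> p0 q0; move: pq; rewrite leq_eqVlt => /predU1P[Es|lt]; last first.
  by rewrite lead_coefDl.
have [->|pn0] := eqVneq p 0; first by rewrite add0r.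
have ppos : 0 < lead_coef p by rewrite lt0r lead_coef_eq0 pn0.
set m := (size p).-1.
have Em : (p + q)`_m = lead_coef p + lead_coef q.
  by rewrite coefD !lead_coefE /m Es.
have pqm : 0 < (p + q)`_m by rewrite Em ltr_wpDr.
have -> : lead_coef (p + q) = (p + q)`_m; last exact: ltW.
rewrite lead_coefE; congr _`_ _; rewrite /m; apply: congr1.
apply/eqP; rewrite eqn_leq; apply/andP; split.
  by rewrite (leq_trans (size_polyD _ _)) // Es maxnn.
have /ltn_predK <- : (0 < size p)%N by rewrite size_poly_gt0.
rewrite ltnNge; apply/negP => /(nth_default 0) E; by rewrite -/m E ltxx in pqm.
Qed.

(* The integer polynomials with the addition as product and the maximum for
   the order [p <= q <-> 0 <= lead_coef (q - p)] as sum. *)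
Definition trop := {poly int}.
HB.instance Definition _ := Choice.on trop.

Definition tmax (p q : {poly int}) := if 0 <= lead_coef (p - q) then p else q.

Lemma tmax_total (p q : {poly int}) :
  (0 <= lead_coef (p - q)) || (0 <= lead_coef (q - p)).
Proof. by rewrite -[q - p]opprB lead_coefN oppr_ge0 le_total. Qed.

Lemma tmax_anti (p q : {poly int}) :
  0 <= lead_coef (p - q) -> 0 <= lead_coef (q - p) -> p = q.
Proof.
move=> H; rewrite -[q - p]opprB lead_coefN oppr_ge0 => H'.
by apply/eqP; rewrite -subr_eq0 -lead_coef_eq0 eq_le H H'.
Qed.

Lemma tmax_trans (p q r : {poly int}) : 0 <= lead_coef (p - q) ->
  0 <= lead_coef (q - r) -> 0 <= lead_coef (p - r).
Proof. by move=> H H'; rewrite -(subrKA q) lead_coef_ge0D. Qed.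

Lemma tmaxC : commutative tmax.
Proof.
move=> p q; rewrite /tmax; case: ifP => pq; case: ifP => qp //.
  exact: tmax_anti.
by have := tmax_total p q; rewrite pq qp.
Qed.

Lemma tmaxA : associative tmax.
Proof.
move=> p q r; rewrite /tmax.
case qr: (0 <= lead_coef (q - r)); case pq: (0 <= lead_coef (p - q)).
- by rewrite (tmax_trans pq qr).
- by rewrite qr.
- by [].
- rewrite qr; have rq : 0 <= lead_coef (r - q) by have := tmax_total q r; rewrite qr.
  case pr: (0 <= lead_coef (p - r)) => //.
  by have := tmax_trans pr rq; rewrite pq.
Qed.

Lemma tmaxD (p q r : {poly int}) : p + tmax q r = tmax (p + q) (p + r).
Proof.
by rewrite /tmax opprD addrACA subrr add0r; case: ifP.
Qed.

HB.instance Definition _ := isGroup.Build trop (@addrA {poly int})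
  (@add0r {poly int}) (@addr0 {poly int}) (@addNr {poly int}) (@addrN {poly int}).
HB.instance Definition _ := Group_isSemifield.Build trop
  (@addrC {poly int}) tmaxC tmaxA tmaxD.

Lemma zexpg_trop (p : trop) (m : int) : zexpg p m = p *~ m :> {poly int}.
Proof.
have E k : (p ^+ k)%g = p *+ k :> {poly int}.
  by elim: k => [|k IH]; rewrite ?expg0 // expgS IH mulrS.
by case: m => m /=; rewrite E ?NegzE ?mulrNz.
Qed.

(** * The Laurent phenomenon *)

Section Coprimality.

Variables (F : fieldType).
Implicit Types (L A : F -> Prop).

Definition runit L f := [/\ L f, L f^-1 & f != 0].

Lemma runitM L f g : subring L -> runit L f -> runit L g -> runit L (f * g).
Proof.
by move=> sL [Lf LVf f0] [Lg LVg g0]; split; rewrite ?invfM ?mulf_neq0 //; apply: srM.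
Qed.

Lemma runitV L f : runit L f -> runit L f^-1.
Proof. by move=> [Lf LVf f0]; split; rewrite ?invrK ?invr_eq0. Qed.

Lemma runitZ L f (m : int) : subring L -> runit L f -> runit L (f ^ m).
Proof.
move=> sL [Lf LVf f0]; split; rewrite ?expfz_neq0 ?invr_expz //; exact: sr_exprz.
Qed.

Lemma runit1 L : subring L -> runit L 1.
Proof. by move=> sL; split; rewrite ?invr1 ?oner_eq0 //; apply: sr1. Qed.

Lemma runit_sub L L' f : (forall g, L g -> L' g) -> runit L f -> runit L' f.
Proof. by move=> sub [Lf LVf f0]; split=> //; apply: sub. Qed.

Lemma runit_mulr L f g : subring L -> runit L g -> L (f * g) -> L f.
Proof.
by move=> sL [Lg LVg g0] Lfg; rewrite -(mulfK g0 f); apply: srM.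
Qed.

Definition loc L z f := exists d, L (f * z ^+ d).

Lemma loc_subring L z : subring L -> L z -> subring (loc L z).
Proof.
move=> sL Lz; split.
- by exists 0%N; rewrite expr0 mulr1; apply: sr1.
- by exists 0%N; rewrite expr0 mulr1; apply: srN1.
- move=> f g [d Lf] [e Lg]; exists (d + e)%N; rewrite mulrDl exprD.
  apply: srD => //; first by rewrite mulrA; apply: srM => //; apply: srX.
  by rewrite mulrCA; apply: srM => //; apply: srX.
- move=> f g [d Lf] [e Lg]; exists (d + e)%N; rewrite exprD mulrACA.
  exact: srM.
Qed.

Lemma loc_sub L z f : L f -> loc L z f.
Proof. by exists 0%N; rewrite expr0 mulr1. Qed.

(** Coprimality without factorization: multiplication by [p] is injective modulo [z]. *)
Definition copr L z p := forall f, L f -> L (f * p / z) -> L (f / z).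

Lemma coprM L z p q : subring L -> L p -> copr L z p -> copr L z q ->
  copr L z (p * q).
Proof.
move=> sL Lp cp cq f Lf; rewrite mulrA => H; apply: cp => //.
by apply: cq => //; apply: srM.
Qed.

Lemma coprX L z p d : subring L -> L p -> copr L z p -> copr L z (p ^+ d).
Proof.
move=> sL Lp cp; elim: d => [|d IH]; first by move=> f _; rewrite expr0 mulr1.
by rewrite exprS; apply: coprM.
Qed.

Lemma copr_unit L z p : subring L -> runit L p -> copr L z p.
Proof.
by move=> sL up f _; rewrite mulrAC; apply: runit_mulr.
Qed.

(** An intersection of localizations, L[1/z] ∩ L[1/p] = L: modulo [z] the factor [p ^+ e] can be
    cancelled, which lowers the exponent of [z] by one each time. *)
Lemma loc_cap L z p f : subring L -> z != 0 -> L z -> L p -> copr L z p ->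
  loc L z f -> loc L p f -> L f.
Proof.
move=> sL z0 Lz Lp cp [d Ld] [e Le]; have cpe := @coprX L z p e sL Lp cp.
elim: d Ld => [|d IH] Ld; first by rewrite expr0 mulr1 in Ld.
apply: IH; have -> : f * z ^+ d = f * z ^+ d.+1 / z by rewrite exprSr; field.
apply: cpe => //; rewrite exprSr.
have -> : f * (z ^+ d * z) * p ^+ e / z = f * p ^+ e * z ^+ d by field.
by apply: srM => //; apply: srX.
Qed.

(** * The algebra of three consecutive mutations *)

Section MutationTriple.

Variables (A : F -> Prop) (t P : F).
Hypotheses (sA : subring A) (tt : transc A t) (AP : A P) (P0 : P != 0).

Let L := lpoly A t.
Let z := P / t.

Let t0 : t != 0. Proof. exact: transc_neq0 tt. Qed.
Let sL : subring L. Proof. exact: lpoly_subring. Qed.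
Let LA f : A f -> L f. Proof. exact: lpolyA. Qed.

Let Lz : L z.
Proof. by apply: srM => //; [apply: LA | apply: lpolyV]. Qed.

Let z0 : z != 0. Proof. by rewrite mulf_neq0 ?invr_eq0. Qed.

Variables (U0 V0 eta1 eta2 zeta N : F) (b c : nat).
Hypotheses (uU : runit L U0) (uV : runit L V0) (ue1 : runit A eta1)
  (Ae2 : A eta2) (Azeta : A zeta) (uN : runit A N) (b_gt0 : (0 < b)%N).

(** The shapes of the variables met in mutations at i, j, i: [t] is the initial variable, [z] the
    first new one, [U0 * w] the second and [v] below the third. Only [t] is excluded from [A]. *)
Let w := eta1 + eta2 * z ^+ b.

Lemma triple_u_laur : L (U0 * w).
Proof.
have [LU _ _] := uU; have [Ae1 _ _] := ue1.
apply: srM => //; apply: srD => //; first exact: LA.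
by apply: srM => //; [apply: LA | apply: srX].
Qed.

(** Since [b] is positive, [w] is congruent modulo [z] to the unit [eta1]. *)
Lemma triple_u_copr : copr L z (U0 * w).
Proof.
apply: coprM => //; [by case: uU | exact: copr_unit |].
move=> f Lf; rewrite /w mulrDr mulrDl => H.
have ue1L : runit L eta1 by apply: runit_sub ue1.
apply: (runit_mulr sL ue1L); rewrite mulrAC.
rewrite -(addrK (f * (eta2 * z ^+ b) / z) (_ / z)); apply: srB => //.
case: b b_gt0 => // b' _.
have -> : f * (eta2 * z ^+ b'.+1) / z = f * eta2 * z ^+ b'.
  by rewrite exprS; field.
apply: srM => //; last exact: srX.
by apply: srM => //; apply: LA.
Qed.

(* The expansion to first order in [z], whose linear coefficient does not
   involve [t]. *)
Let expansion : exists beta gamma, [/\ A beta, L gamma &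
  w ^+ c = eta1 ^+ c + z * (beta + z * gamma)].
Proof.
have [Ae1 _ _] := ue1.
have [b0 [g0 [Ab0 Lg0 E0]]] : exists b0 g0, [/\ A b0, L g0 &
    w = eta1 + z * (b0 + z * g0)].
  rewrite /w; case: b b_gt0 => // -[|b'] _.
    exists eta2, 0; split=> //; first exact: sr0.
    by rewrite expr1 mulr0 addr0 mulrC.
  exists 0, (eta2 * z ^+ b'); split; first exact: sr0.
    by apply: srM => //; [apply: LA | apply: srX].
  by rewrite !exprS; ring.
elim: c => [|c' [beta [gamma [Abeta Lgamma E]]]].
  exists 0, 0; split; [exact: sr0 | exact: sr0 |].
  by rewrite !expr0 !mulr0 addr0 mulr0 addr0.
exists (eta1 * beta + b0 * eta1 ^+ c'),
  (eta1 * gamma + g0 * eta1 ^+ c' + (b0 + z * g0) * (beta + z * gamma)); split.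
- apply: srD => //; first exact: srM.
  by apply: srM => //; apply: srX.
- have Lb0 := LA Ab0; have Le1 := LA Ae1; have Lbeta := LA Abeta.
  apply: srD => //; first apply: srD => //; try exact: srM.
    by apply: srM => //; apply: srX.
  by apply: srM => //; apply: srD => //; apply: srM.
- by rewrite exprS E E0 exprS; ring.
Qed.

Let v := V0 * (zeta * (w ^+ c - eta1 ^+ c) / z + eta1 ^+ c * t / N).

Let v_expansion : exists alpha beta gamma, [/\ runit A alpha, A beta,
  L gamma & v = V0 * (alpha * t + beta + z * gamma)].
Proof.
have [beta [gamma [Abeta Lgamma E]]] := expansion.
exists (eta1 ^+ c / N), (zeta * beta), (zeta * gamma); split.
- apply: runitM => //; last exact: runitV.
  by rewrite exprnP; apply: runitZ.
- exact: srM.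
- by apply: srM => //; apply: LA.
- have [_ _ N0] := uN; rewrite /v E; congr (_ * _).
  by field; rewrite N0 z0.
Qed.

Lemma triple_v_laur : L v.
Proof.
have [alpha [beta [gamma [[Aa _ _] Ab Lg ->]]]] := v_expansion.
have [LV _ _] := uV; apply: srM => //; apply: srD => //; last exact: srM.
by apply: srD => //; [apply: srM => //; [apply: LA|apply: lpolyX]|apply: LA].
Qed.

(** Modulo [z], and up to the unit [V0], this is [alpha * t + beta] with [alpha] invertible in [A];
    and [z] is [P] up to the unit [t], so [lpoly_regular] applies with [h = P]. *)
Lemma triple_v_copr : copr L z v.
Proof.
have [alpha [beta [gamma [[Aa AVa a0] Ab Lg ->]]]] := v_expansion.
apply: coprM => //; [by case: uV | exact: copr_unit |].
move=> f Lf H.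
have {}H : L (f * (alpha * t + beta) / z).
  have -> : f * (alpha * t + beta) / z =
      f * (alpha * t + beta + z * gamma) / z - f * gamma by field.
  by apply: srB => //; apply: srM.
have -> : f / z = f * t / P by rewrite /z; field; rewrite t0 P0.
apply: (lpoly_regular sA tt _ P0 Ab AVa AP Aa a0).
  by apply: srM => //; apply: lpolyX.
have -> // : f * t * (alpha * t + beta) / P = f * (alpha * t + beta) / z.
by rewrite /z; field; rewrite t0 P0.
Qed.

End MutationTriple.

End Coprimality.

Lemma mon_split (F : fieldType) (I : finType) (x x' : I -> F) i (e : I -> int) :
  (forall l, l != i -> x' l = x l) ->
  mon x' e = x' i ^ e i * mon x (fun l => if l == i then 0 else e l).
Proof.
move=> E; rewrite /mon (bigD1 i) //=; congr (_ * _).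
rewrite [RHS](bigD1 i) //= eqxx expr0z mul1r; apply: eq_bigr => l li.
by rewrite (negbTE li) E.
Qed.

Lemma runit_mon (F : fieldType) (I : finType) (A : F -> Prop) (x : I -> F)
    (e : I -> int) : subring A -> (forall i, e i != 0 -> runit A (x i)) ->
  runit A (mon x e).
Proof.
move=> sA ux; apply: (big_ind (runit A)) => [|f g|i _]; first exact: runit1.
  exact: runitM.
have [->|e0] := eqVneq (e i) 0; first by rewrite expr0z; apply: runit1.
by apply: runitZ => //; apply: ux.
Qed.

(** * Intersection of the Laurent rings of two nearby seeds *)

Section LaurentStep.

Variables (F : fieldType) (n : nat).
Implicit Types (s : gseed F n) (i j k : 'I_n).

Definition gvar s (a : 'I_n + 'I_n) : F :=
  match a with inl i => gx s i | inr i => gk s i end.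

Definition Zimg : F -> Prop := img (intr : {rmorphism int -> F}).

Definition glaur s : F -> Prop := laur Zimg (gvar s) predT.

Lemma Zimg_subring : subring Zimg. Proof. exact: img_subring. Qed.

Lemma glaur_subring s : subring (glaur s).
Proof. by apply: laur_subring; apply: Zimg_subring. Qed.

Lemma runit_gvar s (S : pred ('I_n + 'I_n)) a : S a -> gvar s a != 0 ->
  runit (laur Zimg (gvar s) S) (gvar s a).
Proof. by move=> Sa a0; split=> //; [apply: laur_var | apply: laur_inv]. Qed.

Lemma runit_gk_mut (A : F -> Prop) mu k s : subring A ->
  (forall i, runit A (gk s i)) -> runit A mu ->
  forall i, runit A (gk (gmut mu k s) i).
Proof.
move=> sA uk umu i; rewrite ffunE; case: eqP => _; first exact: runitV.
by do ![apply: runitM => //]; apply: runitZ.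
Qed.

Variables (Q : F -> Prop) (s : gseed F n).
Hypotheses (pQ : pos_field Q) (ps : gpos Q s).
Hypothesis tB : totally_sign_skew_symmetric (gB s).

Let x0 : forall i, gx s i != 0. Proof. by case: (gpos_neq0 pQ ps). Qed.
Let k0 : forall i, gk s i != 0. Proof. by case: (gpos_neq0 pQ ps). Qed.
Let sL := glaur_subring s.

Lemma gvar_neq0 a : gvar s a != 0. Proof. by case: a. Qed.

Lemma runit_gx i : runit (glaur s) (gx s i).
Proof. exact: (@runit_gvar s predT (inl i) isT (x0 i)). Qed.

Lemma runit_gk i : runit (glaur s) (gk s i).
Proof. exact: (@runit_gvar s predT (inr i) isT (k0 i)). Qed.

Lemma ghat1_neq0 (s' : gseed F n) k : gpos Q s' -> 1 + ghat s' k != 0.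
Proof.
move=> ps'; apply: (pf_neq0 pQ); apply: pfD => //; first exact: pf1.
exact: ghat_pos.
Qed.

Lemma runit_ghat i : runit (glaur s) (ghat s i).
Proof.
apply: runitM => //; first exact: runit_gk.
by apply: runit_mon => // l _; apply: runit_gx.
Qed.

Lemma glaur_gx_mut mu k i : runit (glaur s) mu ->
  glaur s (gx (gmut mu k s) i).
Proof.
move=> umu; have [->|ik] := eqVneq i k; last first.
  by rewrite gx_mut_other //; have [] := runit_gx i.
rewrite gx_mut //.
have [Lm _ _] : runit (glaur s) (mon (gx s) (negexp (gB s) k)).
  by apply: runit_mon => // l _; apply: runit_gx.
have [_ LV _] : runit (glaur s) (mu * gx s k).
  by apply: runitM => //; apply: runit_gx.
have [Lh _ _] := runit_ghat k.
by do 2 (apply: srM => //); apply: srD => //; apply: sr1.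
Qed.

(** The double mutation replaces [gx s i] by its quotient by [gk s i], a unit of the Laurent ring of
    [s]. *)
Lemma glaur_back i f : glaur (gmut 1 i (gmut 1 i s)) f -> glaur s f.
Proof.
have b0 : gB s i i = 0 by apply: sss_diag; apply: tsss_sss.
have ps1 : gpos Q (gmut 1 i s) by apply: gmut_pos => //; apply: pf1.
have [x10 k10] := gpos_neq0 pQ ps1.
have u1 : runit (glaur s) 1 by apply: runit1.
apply: laur_min => //; first by move=> c Zc; apply: laur_const.
suff H a : runit (glaur s) (gvar (gmut 1 i (gmut 1 i s)) a).
  by move=> a _; case: (H a).
case: a => l; rewrite /gvar; last first.
  apply: runit_gk_mut => // l'; apply: runit_gk_mut => // l''.
  exact: runit_gk.
have [->|li] := eqVneq l i; last first.
  by rewrite !gx_mut_other //; apply: runit_gx.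
have -> : gx (gmut 1 i (gmut 1 i s)) i = gx s i / gk s i.
  rewrite gx_mut // ghat_mut_same // [in X in _ / X]gx_mut // !mul1r.
  have -> : mon (gx (gmut 1 i s)) (negexp (gB (gmut 1 i s)) i) =
      mon (gx s) (posexp (gB s) i).
    apply: eq_bigr => j _; rewrite /negexp /posexp mx_mut_edge ?eqxx ?orbT //.
    rewrite opprK; have [->|jk] := eqVneq j i; last by rewrite gx_mut_other.
    by rewrite b0 pospart0 !expr0z.
  rewrite posexpE //; set M := mon _ _; set N := mon _ _.
  have M0 : M != 0 by apply: mon_neq0.
  have N0 : N != 0 by apply: mon_neq0.
  have := ghat1_neq0 i ps; rewrite /ghat -/M => h0.
  by field; rewrite h0 k0 N0 M0 x0.
by apply: runitM => //; [apply: runit_gx | apply: runitV; apply: runit_gk].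
Qed.

Hypothesis tr : forall a, transc (laur Zimg (gvar s) (predC1 a)) (gvar s a).

Let A a := laur Zimg (gvar s) (predC1 a).
Let sA a : subring (A a). Proof. by apply: laur_subring; apply: Zimg_subring. Qed.

Let glaurP a f : glaur s f <-> lpoly (A a) (gvar s a) f.
Proof.
split=> [|[p [d [Ap Ep]]]].
  apply: laur_lpoly => //; first exact: Zimg_subring.
    exact: gvar_neq0.
  by move=> b _; have [->|ba] := eqVneq b a; [left | right].
apply: (@lpoly_laur _ _ _ _ _ a) => //; first exact: Zimg_subring.
  exact: gvar_neq0.
exists p, d; split=> // l; apply: laur_subset (Ap l) => //.
exact: Zimg_subring.
Qed.

Lemma copr_glaur a z p : copr (lpoly (A a) (gvar s a)) z p -> copr (glaur s) z p.
Proof. by move=> cp f /glaurP Lf /glaurP L2; apply/(glaurP a)/cp. Qed.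

Lemma runit_glaur a f : runit (glaur s) f -> runit (lpoly (A a) (gvar s a)) f.
Proof. by apply: runit_sub => g /glaurP. Qed.

Section Triple.

Variables i j : 'I_n.
Hypothesis ij : i != j.

Let s1 := gmut 1 i s.
Let s2 := gmut 1 j s1.
Let s3 := gmut (gk s2 i) i s2.
Let z := gx s1 i.
Let u := gx s2 j.
Let v := gx s3 i.

Let p1 : Q 1. Proof. exact: pf1. Qed.
Let ps1 : gpos Q s1. Proof. exact: gmut_pos. Qed.
Let ps2 : gpos Q s2. Proof. exact: gmut_pos. Qed.
Let ps3 : gpos Q s3. Proof. by apply: gmut_pos => //; case: ps2. Qed.
Let x10 := (gpos_neq0 pQ ps1).1.
Let k10 := (gpos_neq0 pQ ps1).2.
Let x20 := (gpos_neq0 pQ ps2).1.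
Let k20 := (gpos_neq0 pQ ps2).2.

Let tB1 : totally_sign_skew_symmetric (gB s1). Proof. exact: tsss_mut. Qed.
Let tB2 : totally_sign_skew_symmetric (gB s2). Proof. exact: tsss_mut. Qed.

Let h := ghat s i.
Let N := mon (gx s) (negexp (gB s) i).
Let P := (1 + h) * N.

Let N0 : N != 0. Proof. exact: mon_neq0. Qed.
Let h10 : 1 + h != 0. Proof. exact: ghat1_neq0. Qed.
Let P0 : P != 0. Proof. exact: mulf_neq0. Qed.
Let h0 : h != 0. Proof. by apply: (pf_neq0 pQ); apply: ghat_pos. Qed.
Let zE : z = P / gx s i. Proof. by rewrite /z gx_mut // mul1r. Qed.
Let z0 : z != 0. Proof. exact: x10. Qed.
Let hE : 1 + h = z * gx s i / N.
Proof. by rewrite zE /P; field; rewrite N0 x0. Qed.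

Let b_ii : gB s i i = 0. Proof. by apply: sss_diag; apply: tsss_sss. Qed.

Let Ai_gx l : l != i -> runit (A (inl i)) (gx s l).
Proof.
by move=> li; apply: (@runit_gvar s (predC1 (inl i)) (inl l) _ (x0 l)).
Qed.
Let Ai_gk l : runit (A (inl i)) (gk s l).
Proof. exact: (@runit_gvar s (predC1 (inl i)) (inr l) isT (k0 l)). Qed.
Let Ai_mon e : e i = 0 -> runit (A (inl i)) (mon (gx s) e).
Proof.
move=> ei; apply: runit_mon => // l el; apply: Ai_gx.
by apply: contraNneq el => ->; rewrite ei.
Qed.
Let Ai_h : runit (A (inl i)) h.
Proof. by apply: runitM => //; apply: Ai_mon. Qed.
Let Ai_N : runit (A (inl i)) N.
Proof. by apply: Ai_mon; rewrite /negexp b_ii oppr0 pospart0. Qed.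
Let Ai_P : A (inl i) P.
Proof.
have [Ah _ _] := Ai_h; have [AN _ _] := Ai_N.
by apply: srM => //; apply: srD => //; apply: sr1.
Qed.

Let M1 := mon (gx s) (fun l => if l == i then 0 else negexp (gB s1) j l).
Let M2 := mon (gx s) (fun l => if l == i then 0 else
  (if l == j then 0 else negexp (gB s2) i l)).
Let Mj := mon (gx s) (fun l => if l == i then 0 else gB s l j).

Let uM1 : runit (A (inl i)) M1. Proof. by apply: Ai_mon; rewrite eqxx. Qed.
Let uM2 : runit (A (inl i)) M2. Proof. by apply: Ai_mon; rewrite eqxx. Qed.
Let uMj : runit (A (inl i)) Mj. Proof. by apply: Ai_mon; rewrite eqxx. Qed.

Let x1j : gx s1 j = gx s j.
Proof. by rewrite gx_mut_other // eq_sym. Qed.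

Let hjE : ghat s j = gk s j * (gx s i ^ gB s i j * Mj).
Proof. by rewrite /ghat (@mon_split _ _ (gx s) _ i). Qed.

Let h1jE : ghat s1 j =
  ghat s j * h ^ pospart (gB s i j) * (1 + h) ^ (- gB s i j).
Proof. by rewrite ghat_mut ?oner_eq0 // eq_sym. Qed.

Let uE : u = (1 + ghat s1 j) * (z ^ pospart (gB s i j) * M1) / gx s j.
Proof.
rewrite /u gx_mut // mul1r x1j; congr (_ * _ / _).
rewrite (@mon_split _ _ (gx s) _ i) => [|l li]; last by rewrite gx_mut_other.
by rewrite /negexp mx_mut_edge ?eqxx // opprK.
Qed.

Let h2iE : ghat s2 i = h^-1 * ghat s1 j ^ pospart (- gB s j i) *
  (1 + ghat s1 j) ^ (gB s j i).
Proof.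
have b1 : gB s1 j j = 0 by apply: sss_diag; apply: tsss_sss.
have h1 := ghat1_neq0 j ps1.
rewrite ghat_mut ?oner_eq0 // ghat_mut_same //.
by rewrite mx_mut_edge ?eqxx ?orbT // opprK.
Qed.

Let vE : v = (1 + ghat s2 i) * (u ^ pospart (- gB s j i) * M2) / (gk s2 i * z).
Proof.
have b2 : gB s2 i i = 0 by apply: sss_diag; apply: tsss_sss.
rewrite /v gx_mut // gx_mut_other //; congr (_ * _ / _).
rewrite (@mon_split _ _ (gx s1) _ j) => [|l li]; last by rewrite gx_mut_other.
rewrite {1}/negexp mx_mut_edge ?eqxx //.
rewrite mx_mut_edge ?eqxx ?orbT // opprK; congr (_ * _).
rewrite (@mon_split _ _ (gx s) _ i) => [|l li]; last by rewrite gx_mut_other.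
by rewrite (negbTE ij) /negexp b2 oppr0 pospart0 expr0z mul1r.
Qed.

Let uk1 l : runit (glaur s) (gk s1 l).
Proof.
by apply: runit_gk_mut => //; [apply: runit_gk | apply: runit1].
Qed.

Let uk2 l : runit (glaur s) (gk s2 l).
Proof. by apply: runit_gk_mut => //; apply: runit1. Qed.

Let uk3 l : runit (glaur s) (gk s3 l).
Proof. by apply: runit_gk_mut => //; apply: runit1. Qed.

Let Ai_sub f : runit (A (inl i)) f -> runit (glaur s) f.
Proof.
apply: runit_sub => g; apply: laur_subset => //; exact: Zimg_subring.
Qed.

Let Lz : glaur s z. Proof. by apply: glaur_gx_mut; apply: runit1. Qed.

Definition triple_coprime := [/\ glaur s u, copr (glaur s) z u,
  glaur s v & copr (glaur s) z v].

Lemma triple_pos (b c : nat) : (0 < b)%N -> gB s i j = b%:Z ->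
  gB s j i = - c%:Z -> triple_coprime.
Proof.
move=> b_gt0 bij bji.
pose eta := gk s j * Mj * (h * N) ^+ b.
have ueta : runit (A (inl i)) eta.
  apply: runitM => //; first exact: runitM.
  by rewrite exprnP; apply: runitZ => //; apply: runitM.
pose W := eta + 1 * z ^+ b.
have zb0 := expf_neq0 b z0; have xb0 := expf_neq0 b (x0 i).
have Nb0 := expf_neq0 b N0.
have h1 : ghat s1 j = eta / z ^+ b.
  rewrite h1jE hjE bij pospart_nat hE -exprnN -!exprnP !exprMn exprVn.
  by rewrite /eta /h /ghat !exprMn; field; rewrite zb0 Nb0 xb0.
have uE' : u = M1 / gx s j * W.
  by rewrite uE bij pospart_nat h1 /W -!exprnP; field; rewrite zb0 x0.
have W0 : W != 0.
  have : u != 0 by apply: x20.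
  by rewrite uE' mulf_eq0 => /norP[].
have Wc0 := expf_neq0 c W0; have zbc0 := expf_neq0 c zb0.
have [_ _ eta0] := ueta; have etac0 := expf_neq0 c eta0.
pose V0 := h^-1 * (M1 / gx s j) ^+ c * M2 / gk s2 i.
(* The raw numerator is h W^c + eta^c. Splitting off h eta^c leaves one part divisible by [z],
   because [W] is [eta] modulo [z], and one part with the factor 1 + h, which [hE] rewrites as a
   multiple of [z]. *)
have vE' : v = V0 * (h * (W ^+ c - eta ^+ c) / z + eta ^+ c * gx s i / N).
  have -> : eta ^+ c * gx s i / N = eta ^+ c * (1 + h) / z.
    by rewrite hE; field; rewrite N0 z0.
  have h2 : ghat s2 i = h^-1 * (eta ^+ c / W ^+ c).
    rewrite h2iE bji opprK pospart_nat h1 -exprnN -!exprnP -mulrA; congr (_ * _).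
    have -> : 1 + eta / z ^+ b = W / z ^+ b by rewrite /W; field.
    by rewrite !exprMn !exprVn; field; rewrite Wc0 zbc0.
  rewrite vE bji opprK pospart_nat -!exprnP h2 uE' [(_ * W) ^+ c]exprMn /V0.
  by field; rewrite Wc0 k20 z0 h0.
have uU : runit (lpoly (A (inl i)) (gx s i)) (M1 / gx s j).
  apply: (@runit_glaur (inl i)); apply: runitM => //; first exact: Ai_sub.
  by apply: runitV; apply: runit_gx.
have uV : runit (lpoly (A (inl i)) (gx s i)) V0.
  apply: (@runit_glaur (inl i)); apply: runitM => //; last exact: runitV.
  apply: runitM => //; last exact: Ai_sub.
  apply: runitM => //; first by apply: runitV; apply: Ai_sub.
  rewrite exprnP; apply: runitZ => //; apply: runitM => //; first exact: Ai_sub.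
  by apply: runitV; apply: runit_gx.
have [A1 _ _] := runit1 (sA (inl i)).
have [Ah _ _] := Ai_h.
have ti : transc (A (inl i)) (gx s i) := @tr (inl i).
split.
- rewrite uE'; apply/(glaurP (inl i)); rewrite /W zE.
  exact: (@triple_u_laur _ _ _ P).
- rewrite uE'; apply: (@copr_glaur (inl i)); rewrite /W zE.
  exact: (@triple_u_copr _ _ _ P).
- rewrite vE'; apply/(glaurP (inl i)); rewrite /W zE.
  exact: (@triple_v_laur _ _ _ P).
- rewrite vE'; apply: (@copr_glaur (inl i)); rewrite /W zE.
  exact: (@triple_v_copr _ _ _ P).
Qed.

Lemma triple_neg (b c : nat) : (0 < b)%N -> gB s i j = - b%:Z ->
  gB s j i = c%:Z -> triple_coprime.
Proof.
move=> b_gt0 bij bji.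
pose eta := gk s j * Mj / N ^+ b.
have ueta : runit (A (inl i)) eta.
  apply: runitM => //; first exact: runitM.
  by apply: runitV; rewrite exprnP; apply: runitZ.
pose W := 1 + eta * z ^+ b.
have zb0 := expf_neq0 b z0; have xb0 := expf_neq0 b (x0 i).
have Nb0 := expf_neq0 b N0.
have pb := pospart_opp_nat b; have pc := pospart_opp_nat c.
have h1 : ghat s1 j = eta * z ^+ b.
  rewrite h1jE hjE bij pb expr0z opprK hE -exprnN -!exprnP !exprMn exprVn.
  by rewrite /eta; field; rewrite Nb0 xb0.
have uE' : u = M1 / gx s j * W.
  by rewrite uE bij pb h1 /W expr0z; field; rewrite x0.
pose V0 := h^-1 * M2 / gk s2 i.
have vE' : v = V0 * (1 * (W ^+ c - 1 ^+ c) / z + 1 ^+ c * gx s i / N).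
  have -> : 1 ^+ c * gx s i / N = (1 + h) / z.
    by rewrite hE expr1n; field; rewrite N0 z0.
  have h2 : ghat s2 i = h^-1 * W ^+ c.
    by rewrite h2iE bji pc h1 expr0z mulr1 -exprnP.
  rewrite vE bji pc expr0z h2 /V0 expr1n.
  by field; rewrite k20 z0 h0.
have uU : runit (lpoly (A (inl i)) (gx s i)) (M1 / gx s j).
  apply: (@runit_glaur (inl i)); apply: runitM => //; first exact: Ai_sub.
  by apply: runitV; apply: runit_gx.
have uV : runit (lpoly (A (inl i)) (gx s i)) V0.
  apply: (@runit_glaur (inl i)); apply: runitM => //; last exact: runitV.
  apply: runitM => //; last exact: Ai_sub.
  by apply: runitV; apply: Ai_sub.
have u1 := runit1 (sA (inl i)).
have [A1 _ _] := u1; have [Aeta _ _] := ueta.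
have ti : transc (A (inl i)) (gx s i) := @tr (inl i).
split.
- rewrite uE'; apply/(glaurP (inl i)); rewrite /W zE.
  exact: (@triple_u_laur _ _ _ P).
- rewrite uE'; apply: (@copr_glaur (inl i)); rewrite /W zE.
  exact: (@triple_u_copr _ _ _ P).
- rewrite vE'; apply/(glaurP (inl i)); rewrite /W zE.
  exact: (@triple_v_laur _ _ _ P).
- rewrite vE'; apply: (@copr_glaur (inl i)); rewrite /W zE.
  exact: (@triple_v_copr _ _ _ P).
Qed.

(* Here [z] and [u] are coprime because their coefficients are distinct
   variables. *)
Lemma triple_zero : gB s i j = 0 -> triple_coprime.
Proof.
move=> bij; have bji : gB s j i = 0 by apply: sss_eq0 bij; apply: tsss_sss.
have h1 : ghat s1 j = ghat s j.
  by rewrite h1jE bij oppr0 pospart0 !expr0z !mulr1.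
have uE' : u = (1 + ghat s j) * (M1 / gx s j).
  by rewrite uE bij pospart0 h1 expr0z mul1r mulrA.
have vE' : v = h^-1 * M2 * gx s i / N / gk s2 i.
  rewrite vE h2iE bji oppr0 pospart0 !expr0z !mulr1 mul1r zE /P.
  by field; rewrite h0 N0 k20 x0 h10.
have uv : runit (glaur s) v.
  rewrite vE'; apply: runitM => //; last exact: runitV.
  apply: runitM => //; last by apply: runitV; apply: Ai_sub.
  apply: runitM => //; last exact: runit_gx.
  by apply: runitM => //; [apply: runitV|]; apply: Ai_sub.
have uM : runit (glaur s) (M1 / gx s j).
  by apply: runitM => //; [apply: Ai_sub | apply: runitV; apply: runit_gx].
have [Lh _ _] := runit_ghat j; have L1 := sr1 sL.
split.
- by rewrite uE'; case: uM => Lm _ _; apply: srM => //; apply: srD.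
- rewrite uE'; apply: coprM => //; first exact: srD; last exact: copr_unit.
  have uAx l : runit (A (inr j)) (gx s l).
    exact: (@runit_gvar s (predC1 (inr j)) (inl l) isT (x0 l)).
  have uAk : runit (A (inr j)) (gk s i).
    apply: (@runit_gvar s (predC1 (inr j)) (inr i) _ (k0 i)) => /=.
    by apply: contraNneq ij => -[->].
  have uAmon e : runit (A (inr j)) (mon (gx s) e) by apply: runit_mon.
  have Az : A (inr j) z.
    have [AN _ _] := uAmon (negexp (gB s) i).
    have [_ AVx _] := uAx i; have [Ah _ _] : runit (A (inr j)) h by apply: runitM.
    rewrite zE; apply: srM => //; apply: srM => //.
    by apply: srD => //; apply: sr1.
  apply: (@copr_glaur (inr j)) => f Lf.
  have [Aa AVa a0] := uAmon (fun l => gB s l j).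
  have -> : 1 + ghat s j = mon (gx s) (fun l => gB s l j) * gvar s (inr j) + 1.
    by rewrite addrC mulrC.
  have A1 : A (inr j) 1 by apply: sr1.
  exact: (lpoly_regular (sA (inr j)) (@tr (inr j)) Lf z0 A1 AVa Az Aa a0).
- by case: uv.
- exact: copr_unit.
Qed.

Lemma triple_all : triple_coprime.
Proof.
have sB := tsss_sss tB.
have [bij|bij|bij] := ltrgtP (gB s i j) 0; last exact: triple_zero.
- have bji := sss_lt0 sB bij.
  apply: (@triple_neg `|gB s i j|%N `|gB s j i|%N); first by lia.
    by rewrite ltz0_abs // opprK.
  by rewrite gtz0_abs.
- have bji := sss_gt0 sB bij.
  apply: (@triple_pos `|gB s i j|%N `|gB s j i|%N); first by lia.
    by rewrite gtz0_abs.
  by rewrite ltz0_abs // opprK.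
Qed.

(** The Laurent ring of [s1] only adds the inverse of [z] to that of [s], and that of [s3] only the
    inverse of [u * v]; as [z] is coprime to [u * v], [loc_cap] applies. *)
Lemma laurent_step f : glaur s1 f -> glaur s3 f -> glaur s f.
Proof.
have [Lu cu Lv cv] := triple_all; move=> L1 L3.
have Lc c : Zimg c -> glaur s c by move=> Zc; apply: laur_const.
apply: (@loc_cap _ (glaur s) z (u * v)) => //.
- exact: srM.
- exact: coprM.
- move: L1; apply: laur_min; first exact: loc_subring.
    by move=> c /Lc Zc; apply: loc_sub.
  case=> l _; rewrite /gvar; last by have [Lk LVk _] := uk1 l; split; apply: loc_sub.
  have [->|li] := eqVneq l i.
    split; first exact: loc_sub.
    by exists 1%N; rewrite expr1 mulVf //; apply: sr1.
  by rewrite gx_mut_other //; have [Lx LVx _] := runit_gx l; split; apply: loc_sub.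
- move: L3; apply: laur_min; first by apply: loc_subring => //; apply: srM.
    by move=> c /Lc Zc; apply: loc_sub.
  have u0 : u != 0 by apply: x20.
  have v0 : v != 0 by case: (gpos_neq0 pQ ps3) => x30 _; apply: x30.
  case=> l _; rewrite /gvar; last by have [Lk LVk _] := uk3 l; split; apply: loc_sub.
  have [->|li] := eqVneq l i.
    by split; [apply: loc_sub | exists 1%N; rewrite expr1 mulrC mulfK].
  rewrite gx_mut_other //; have [->|lj] := eqVneq l j.
    by split; [apply: loc_sub | exists 1%N; rewrite expr1 mulKf].
  by rewrite !gx_mut_other //; have [Lx LVx _] := runit_gx l; split; apply: loc_sub.
Qed.

End Triple.

End LaurentStep.

Section FreeMonomials.

Variables (F : fieldType) (m : nat) (v : 'I_m -> F).
Hypothesis fv : free_over (intr : {rmorphism int -> F}) v.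

Lemma free_monomials_inj (l l' : seq 'X_{1..m}) :
  \sum_(k <- l) mmap1 v k = \sum_(k <- l') mmap1 v k -> perm_eq l l'.
Proof.
pose X (r : seq 'X_{1..m}) : {mpoly int[m]} := \sum_(k <- r) 'X_[k].
have E r : \sum_(k <- r) mmap1 v k = mmap (intr : {rmorphism int -> F}) v (X r).
  by rewrite rmorph_sum /=; apply: eq_bigr => k _; rewrite mmapX.
rewrite !E => H; have {}H : X l = X l'.
  by apply/eqP; rewrite -subr_eq0; apply/eqP; apply: fv; rewrite mmapB H subrr.
have C r k : (X r)@_k = (count_mem k r)%:R.
  rewrite raddf_sum /= -sum1_count natr_sum [RHS]big_mkcond /=.
  by apply: eq_bigr => k' _; rewrite mcoeffX; case: eqP.
apply/allP => k _; apply/eqP.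
by have := congr1 (mcoeff k) H; rewrite !C => /eqP; rewrite eqr_nat => /eqP.
Qed.

Lemma mmap1D k k' : mmap1 v (k + k')%MM = mmap1 v k * mmap1 v k'.
Proof.
rewrite /mmap1 -big_split /=; apply: eq_bigr => i _.
by rewrite mnmDE exprD.
Qed.

End FreeMonomials.

(** * The seed with independent variables and coefficients *)

Section StandardSeed.

Variable n : nat.

Definition stdF : fieldType := {fraction {mpoly int[n + n]}}.

Definition stdv (i : 'I_(n + n)) : stdF := FracField.tofrac 'X_i.

Definition std (B : 'M[int]_n) : gseed stdF n :=
  GSeed [ffun i => stdv (lshift n i)] [ffun i => stdv (rshift n i)] B.

Lemma std_free : free_over (intr : {rmorphism int -> stdF}) stdv.
Proof.
move=> p; have -> : mmap (intr : {rmorphism int -> stdF}) stdv p =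
    FracField.tofrac p.
  rewrite [in RHS](mpolyE p) raddf_sum; apply: eq_bigr => k _ /=.
  rewrite -mul_mpolyC tofracM; congr (_ * _).
    by rewrite -[X in X%:MP]intz !rmorph_int.
  by rewrite mpolyXE_id rmorph_prod; apply: eq_bigr => i _; rewrite rmorphXn.
by move/eqP; rewrite tofrac_eq0 => /eqP.
Qed.

Lemma stdvE B a : stdv (unsplit a) = gvar (std B) a.
Proof. by case: a => i; rewrite /gvar ffunE. Qed.

Lemma std_transc B a :
  transc (laur (@Zimg stdF) (gvar (std B)) (predC1 a)) (gvar (std B) a).
Proof.
rewrite -(stdvE B) => p Ap.
apply: (free_transc (l := unsplit a) std_free) => i; move: (Ap i).
apply: (laur_reindex (h := @unsplit n n)) => [|b|b].
- exact: Zimg_subring.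
- exact: stdvE.
- by apply: contraNneq => /(can_inj (@unsplitK n n)) ->.
Qed.

Definition std_ev (A : semifieldType) (theta : 'X_{1..n + n} -> A) :=
  ev (mmap1 stdv) theta.

(** Only the existence of a subtraction-free expression matters; the constant evaluation is a
    convenient way to record it. *)
Definition std_pos := fun f => exists a, std_ev (fun=> (0 : trop)) f a.

Lemma std_pos_field : pos_field std_pos.
Proof.
apply: (@ev_pos_field _ _ _ mnm_add) => //.
- exact: mmap1D.
- by move=> _ _; rewrite [RHS]addr0.
- exact/free_monomials_inj/std_free.
- exact: 0%MM.
Qed.

Lemma std_gpos B : gpos std_pos (std B).
Proof.
by split=> i; rewrite ffunE; exists (0 : trop); rewrite -(mmap1U stdv); apply: ev_base.
Qed.

End StandardSeed.

Section SpecializeWord.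

Variables (n : nat) (F : fieldType) (Q : F -> Prop) (s : gseed F n).
Hypotheses (pQ : pos_field Q) (ps : gpos Q s).

Let S0 := std (gB s).
Let tv (i : 'I_(n + n)) := gvar s (split i).
Let sp := spec (@stdv n) tv.

Let tv0 i : tv i != 0.
Proof. by have [x0 k0] := gpos_neq0 pQ ps; rewrite /tv; case: split. Qed.

Let sp1 : sp 1 1. Proof. exact: (spec_int _ _ 1). Qed.

Let spX f g m : sp f g -> sp (f ^+ m) (g ^+ m).
Proof.
move=> fg; elim: m => [|m IH]; first by rewrite !expr0.
by rewrite !exprS; apply: spec_mul.
Qed.

Let spZ f g (m : int) : 0 <= m -> sp f g -> sp (f ^ m) (g ^ m).
Proof. by case: m => // m _; apply: spX. Qed.

(** Division by the old variable cannot be carried through [spec]. Laurentness in the standard seed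
    supplies some image of the new variable; multiplied by the old one it is an image of the
    exchange polynomial, and [spec_fun] identifies it. *)
Lemma spec_word w :
  (forall w1 w2 j, w = w1 ++ w2 -> glaur S0 (gx (gword S0 w1) j)) ->
  forall j, sp (gx (gword S0 w) j) (gx (gword s w) j) /\
    (sp (gk (gword S0 w) j) (gk (gword s w) j) /\
     sp (gk (gword S0 w) j)^-1 (gk (gword s w) j)^-1).
Proof.
elim/last_ind: w => [|w k IH] Lw j.
  have sa a : sp (gvar S0 a) (gvar s a).
    have -> : gvar s a = tv (unsplit a) by rewrite /tv unsplitK.
    by rewrite -stdvE; apply: spec_var.
  split; first exact: (sa (inl j)).
  split; first exact: (sa (inr j)).
  have -> : gk (gword s [::]) j = tv (unsplit (inr j)) by rewrite /tv unsplitK.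
  have -> : gk (gword S0 [::]) j = stdv (unsplit (inr j)).
    by rewrite (stdvE (gB s)).
  exact: spec_inv.
have H j' : sp (gx (gword S0 w) j') (gx (gword s w) j') /\
    (sp (gk (gword S0 w) j') (gk (gword s w) j') /\
     sp (gk (gword S0 w) j')^-1 (gk (gword s w) j')^-1).
  apply: IH => w1 w2 j'' E; apply: (Lw w1 (rcons w2 k)).
  by rewrite E rcons_cat.
have Ew (G : fieldType) (s' : gseed G n) : gword s' (rcons w k) = gmut 1 k (gword s' w).
  by rewrite /gword foldl_rcons.
have LX := Lw (rcons w k) [::] k; rewrite cats0 in LX; have {}LX := LX erefl.
rewrite !Ew in LX *.
set T0 := gword S0 w in H LX *; set T := gword s w in H *.
have BE : gB T = gB T0 by rewrite !gB_word.
have pT : gpos Q T by apply: gword_pos.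
have pT0 : gpos (@std_pos n) T0.
  by apply: gword_pos; [apply: std_pos_field | apply: std_gpos].
have [x0 k0] := gpos_neq0 pQ pT.
have [y0 l0] := gpos_neq0 (std_pos_field n) pT0.
have spmon e : (forall i, 0 <= e i) -> sp (mon (gx T0) e) (mon (gx T) e).
  move=> e0; apply: (big_ind2 sp) => // [f f' g g' ff' gg'|i _].
    exact: spec_mul.
  by apply: spZ => //; case: (H i).
split.
  have [->|jk] := eqVneq j k; last by rewrite !gx_mut_other //; case: (H j).
  have [z sz] : exists z, sp (gx (gmut 1 k T0) k) z.
    apply: laur_spec; move: LX; apply: (laur_reindex (h := @unsplit n n)) => //.
      exact: Zimg_subring.
    exact: stdvE.
  suff <- : z = gx (gmut 1 k T) k by [].
  apply: (mulIf (x0 k)).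
  have E (G : fieldType) (s' : gseed G n) : gx s' k != 0 ->
      gx (gmut 1 k s') k * gx s' k = gk s' k * mon (gx s') (posexp (gB s') k)
        + mon (gx s') (negexp (gB s') k).
    by move=> xk; rewrite ffunE eqxx mul1r divfK.
  rewrite E //; apply: (@spec_fun _ _ _ _ tv (gx (gmut 1 k T0) k * gx T0 k)).
  - exact: std_free.
  - exact: tv0.
  - by apply: spec_mul => //; case: (H k).
  - rewrite E // BE; apply: spec_add; last by apply: spmon => i; apply: pospart_ge0.
    apply: spec_mul; first by case: (H k) => _ [].
    by apply: spmon => i; apply: pospart_ge0.
have [_ [kk kkV]] := H k; have [_ [kj kjV]] := H j.
rewrite !ffunE; case: eqP => _; first by rewrite !invrK.
rewrite !exp1rz !mulr1 BE !invfM !invr_expz -!exprz_inv.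
by split; apply: spec_mul => //; apply: spZ => //; apply: pospart_ge0.
Qed.

End SpecializeWord.

(** Induction on the length, over all fields and seeds: [laurent_step] on the standard seed calls
    for two neighbouring seeds that are not standard, and the general case then follows by
    specialization. *)
Theorem laurent_phenomenon n (w : seq 'I_n) (F : fieldType) (Q : F -> Prop)
    (s : gseed F n) j : pos_field Q -> gpos Q s ->
  totally_sign_skew_symmetric (gB s) -> glaur s (gx (gword s w) j).
Proof.
have [m le_wm] := ubnP (size w).
elim: m => // m IH in w le_wm F Q s j *.
have Lstd (B : 'M[int]_n) (w' : seq 'I_n) j' :
    totally_sign_skew_symmetric B -> (size w' <= size w)%N ->
    glaur (std B) (gx (gword (std B) w') j').
  move=> tB; case: w' => [|i [|k w']] sw; rewrite ?gword_cons.
  - by apply: (@laur_var _ _ _ _ _ (inl j')).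
  - apply: (@glaur_gx_mut _ _ _ _ (std_pos_field n) (std_gpos B) 1 i j').
    by apply: runit1; apply: glaur_subring.
  - have pB := std_gpos B; have pF := std_pos_field n.
    have p1 : gpos (@std_pos n) (gmut 1 i (std B)).
      by apply: gmut_pos => //; apply: pf1.
    have p2 : gpos (@std_pos n) (gmut 1 k (gmut 1 i (std B))).
      by apply: gmut_pos => //; apply: pf1.
    have tB1 := tsss_mut i tB; have tB2 := tsss_mut k tB1.
    have sw' : (size (k :: w') < m)%N.
      by rewrite ltnS in le_wm; apply: leq_trans le_wm.
    have [E|ik] := eqVneq i k.
      rewrite -E in p2 tB2 *.
      apply: (@glaur_back _ _ _ _ pF pB tB i).
      by apply: (IH w' _ _ _ _ _ pF p2); rewrite // ltnW.
    set s2 := gmut 1 k (gmut 1 i (std B)) in p2 *.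
    have p3 : gpos (@std_pos n) (gmut (gk s2 i) i s2).
      by apply: gmut_pos => //; case: p2.
    have b2 : gB s2 i i = 0 by apply: sss_diag; apply: tsss_sss.
    apply: (@laurent_step _ _ _ _ pF pB tB (@std_transc n B) i k ik).
      by apply: (IH (k :: w') _ _ _ _ _ pF p1).
    (* Seen from the third seed, [s2] is one mutation at [i] away, so the word [i :: w'] from there
       is again one letter shorter than the original. *)
    rewrite -/s2 -[in gword _ _](gmutK pF p2 b2).
    by apply: (IH (i :: w') _ _ _ _ _ pF p3) => //; apply: tsss_mut.
move=> pQ ps tB.
have [] := @spec_word n F Q s pQ ps w _ j.
  move=> w1 w2 j' Ew; apply: Lstd => //.
  by rewrite Ew size_cat leq_addr.
move/spec_laur=> + _; apply: (laur_reindex (h := @split n n)) => //.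
exact: Zimg_subring.
Qed.

(** * Cluster patterns *)

Section Rescaling.

Variables (F : fieldType) (n : nat) (C Q : F -> Prop).
Hypotheses (sC : subring C) (CV : forall f, C f -> C f^-1) (pQ : pos_field Q).
Implicit Types s : gseed F n.

(** The invariant between mutation with scalar 1 and normalized mutation along the same word:
    coefficients may differ, but the [ghat] agree and the clusters are proportional by constants. *)
Definition rescaled s s' := [/\ gB s' = gB s, forall j, ghat s' j = ghat s j &
  exists lam : 'I_n -> F, (forall i, C (lam i) /\ lam i != 0) /\
    forall i, gx s' i = lam i * gx s i].

Lemma rescaled_mut mu k s s' : gpos Q s -> gpos Q s' -> gB s k k = 0 ->
  C mu -> Q mu -> rescaled s s' -> rescaled (gmut 1 k s) (gmut mu k s').
Proof.
move=> ps ps' b0 Cmu Qmu [EB Eh [lam [Clam Ex]]].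
have [x0 k0] := gpos_neq0 pQ ps; have [x'0 k'0] := gpos_neq0 pQ ps'.
have mu0 := pf_neq0 pQ Qmu.
have h0 : 1 + ghat s k != 0.
  by apply: (pf_neq0 pQ); apply: pfD => //; [apply: pf1 | apply: ghat_pos].
split; first by rewrite /= EB.
- move=> j; have [->|jk] := eqVneq j k; first by rewrite !ghat_mut_same ?EB ?Eh.
  by rewrite !ghat_mut ?oner_eq0 ?EB ?Eh.
pose lam' i := if i == k then mon lam (negexp (gB s) k) / (mu * lam k) else lam i.
have lam0 i : lam i != 0 by case: (Clam i).
exists lam'; split=> i; rewrite /lam'.
- case: eqP => // _; split; last by rewrite !mulf_neq0 ?invr_eq0 ?mulf_neq0 // mon_neq0.
  apply: srM => //; last by apply: CV; apply: srM => //; case: (Clam k).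
  apply: sr_prod => // j _; apply: sr_exprz => //; first by case: (Clam j).
  by apply: CV; case: (Clam j).
- case: eqP => [->|/eqP ik]; last by rewrite !gx_mut_other.
  rewrite !gx_mut // Eh EB mul1r Ex.
  have -> : mon (gx s') (negexp (gB s) k) =
      mon lam (negexp (gB s) k) * mon (gx s) (negexp (gB s) k).
    by rewrite -monM; apply: eq_bigr => j _; rewrite Ex.
  by field; rewrite x0 mu0 lam0.
Qed.

End Rescaling.

Lemma img_inv (K F : fieldType) (phi : {rmorphism K -> F}) f :
  img phi f -> img phi f^-1.
Proof. by move=> [c ->]; exists c^-1; rewrite fmorphV. Qed.

(** * Sums of coefficient monomials determine their terms *)

Section GroupRing.

Variables (P : semifieldType) (QP : fieldType) (iota : P -> QP).
Hypothesis hQP : is_QP iota.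

Lemma group_ring_extE (a : group_ring P) (s : seq P) : uniq s ->
  {subset finsupp a <= s} ->
  group_ring_ext iota a = \sum_(p <- s) (a p)%:~R * iota p.
Proof.
move=> us sub; rewrite /group_ring_ext.
rewrite (perm_big [seq p <- s | p \in finsupp a]) /=; last first.
  apply: uniq_perm; rewrite ?fset_uniq ?filter_uniq // => p.
  by rewrite mem_filter; case pa: (p \in finsupp a) => //=; rewrite sub.
rewrite big_filter big_mkcond; apply: eq_bigr => p _.
by case: ifP => // /negbT; rewrite memNfinsupp => /eqP ->; rewrite mul0r.
Qed.

Definition multiplicity (l : seq P) : group_ring P :=
  [fsfun p in seq_fset tt l => (count_mem p l)%:Z].

Lemma multiplicityE l p : multiplicity l p = (count_mem p l)%:Z.
Proof.
rewrite fsfunE seq_fsetE; case: ifP => // /negbT pl.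
by rewrite (count_memPn pl).
Qed.

Lemma group_ring_ext_multiplicity l :
  group_ring_ext iota (multiplicity l) = \sum_(p <- l) iota p.
Proof.
rewrite (group_ring_extE (undup_uniq l)) => [|p].
  rewrite -[RHS]big_undup_iterop_count /=; apply: eq_bigr => p _.
  by rewrite multiplicityE -pmulrn mulr_natl.
rewrite mem_finsupp multiplicityE mem_undup -has_pred1 has_count.
by case: count.
Qed.

Lemma iota_sum_inj (l l' : seq P) :
  \sum_(p <- l) iota p = \sum_(p <- l') iota p -> perm_eq l l'.
Proof.
rewrite -!group_ring_ext_multiplicity => /(QP_inj hQP) E.
apply/allP => p _; apply/eqP.
by have := multiplicityE l p; rewrite E multiplicityE => -[].
Qed.

Variables (F : fieldType) (phi : {rmorphism QP -> F}) (n : nat).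
Variable x : 'I_n -> F.
Hypothesis fx : free_over phi x.

Definition term (t : P * 'X_{1..n}) : F := phi (iota t.1) * mmap1 x t.2.
Definition term_mul (s t : P * 'X_{1..n}) := ((s.1 * t.1)%g, (s.2 + t.2)%MM).

Lemma termM s t : term (term_mul s t) = term s * term t.
Proof. by rewrite /term /= (QP_mul hQP) rmorphM mmap1D mulrACA. Qed.

(** The coefficient of a fixed monomial is a sum of elements of [P] in the fraction field, and
    [iota_sum_inj] recovers its terms. *)
Lemma term_inj (l l' : seq (P * 'X_{1..n})) :
  \sum_(t <- l) term t = \sum_(t <- l') term t -> perm_eq l l'.
Proof.
pose X r : {mpoly QP[n]} := \sum_(t <- r) iota t.1 *: 'X_[t.2].
have E r : \sum_(t <- r) term t = mmap phi x (X r).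
  by rewrite raddf_sum /=; apply: eq_bigr => t _; rewrite mmapZ mmapX.
rewrite !E => H; have {}H : X l = X l'.
  by apply/eqP; rewrite -subr_eq0; apply/eqP; apply: fx; rewrite mmapB H subrr.
have C r k : (X r)@_k = \sum_(p <- [seq t.1 | t <- r & t.2 == k]) iota p.
  rewrite raddf_sum big_map big_filter [RHS]big_mkcond /=.
  by apply: eq_bigr => t _; rewrite mcoeffZ mcoeffX; case: eqP; rewrite ?mulr1 ?mulr0.
have D (r : seq (P * 'X_{1..n})) p k :
    count_mem (p, k) r = count_mem p [seq t.1 | t <- r & t.2 == k].
  rewrite count_map count_filter; apply: eq_count => -[p' k'] /=.
  by rewrite xpair_eqE.
apply/allP => -[p k] _; apply/eqP; rewrite !D.
have /seq.permP -> // : perm_eq [seq t.1 | t <- l & t.2 == k]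
  [seq t.1 | t <- l' & t.2 == k] by apply: iota_sum_inj; rewrite -!C H.
Qed.

End GroupRing.

(** * Tropical evaluation of seeds *)

Section TropicalPattern.

Variable n : nat.
Implicit Types (g : 'I_n -> {poly int}) (B : 'M[int]_n).

Definition tlin g (e : 'I_n -> int) : {poly int} := \sum_i g i *~ e i.

(** The tropical exchange relation when coefficients and scalars have value 0, the unit of [trop];
    it depends on the exchange matrix alone. *)
Definition tmut k g B (i : 'I_n) : {poly int} :=
  if i == k then tmax (tlin g (posexp B k)) (tlin g (negexp B k)) - g k else g i.

Fixpoint tword g B (w : seq 'I_n) : 'I_n -> {poly int} :=
  if w is k :: w' then tword (tmut k g B) (mx_mut k B) w' else g.

(** The tropical form of [ghat_mut]. *)
Definition hmut k g B (i : 'I_n) : {poly int} :=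
  if i == k then - g k
  else g i + g k *~ pospart (B k i) + tmax 0 (g k) *~ (- B k i).

Fixpoint hword g B (w : seq 'I_n) : 'I_n -> {poly int} :=
  if w is k :: w' then hword (hmut k g B) (mx_mut k B) w' else g.

Lemma tword_rcons g B w k :
  tword g B (rcons w k) = tmut k (tword g B w) (mx_word B w).
Proof. by elim: w g B => //= l w IH g B; rewrite IH. Qed.

Definition coef_mx g : 'M[int]_n := \matrix_(i, j) (g i)`_j.

Lemma det_reflection (k : 'I_n) (c : 'I_n -> int) :
  \det (\matrix_(i, j) (if i == k then (if j == k then -1 else c j)
                        else (i == j)%:R) : 'M[int]_n) = -1.
Proof.
set E : 'M[int]_n := (\matrix_(i, j) _).
rewrite (expand_det_col E k) (bigD1 k) //= big1 => [|i ik]; last first.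
  by rewrite mxE (negbTE ik) mul0r.
rewrite addr0 mxE !eqxx /cofactor addnn -mul2n exprM sqrrN !expr1n mul1r.
have -> : row' k (col' k E) = 1%:M; last by rewrite det1 mulr1.
apply/matrixP => i j; rewrite !mxE eq_sym (negbTE (neq_lift _ _)).
by rewrite (inj_eq lift_inj).
Qed.

Lemma det_row_reflection (k : 'I_n) (c : 'I_n -> int) (M M' : 'M[int]_n) :
  (forall i, i != k -> row i M' = row i M) ->
  row k M' = - row k M + \sum_(l | l != k) c l *: row l M ->
  \det M' = - \det M.
Proof.
move=> H1 H2; rewrite -mulN1r -(det_reflection k c) -det_mulmx; congr (\det _).
apply/row_matrixP => i; rewrite row_mul mulmx_sum_row.
have [->|ik] := eqVneq i k.
  rewrite H2 [RHS](bigD1 k) //= !mxE !eqxx scaleN1r; congr (_ + _).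
  by apply: eq_bigr => l lk; rewrite !mxE eqxx (negbTE lk).
rewrite H1 // [RHS](bigD1 i) //= !mxE (negbTE ik) eqxx scale1r big1 ?addr0 //.
by move=> l li; rewrite !mxE (negbTE ik) eq_sym (negbTE li) scale0r.
Qed.

Lemma det_col_reflection (k : 'I_n) (c : 'I_n -> int) (M M' : 'M[int]_n) :
  (forall i, i != k -> row i M' = row i M + c i *: row k M) ->
  row k M' = - row k M -> \det M' = - \det M.
Proof.
move=> H1 H2; rewrite -mulN1r -(det_reflection k c) -[X in _ = X * _]det_tr -det_mulmx.
congr (\det _); apply/row_matrixP => i; rewrite row_mul mulmx_sum_row.
have [->|ik] := eqVneq i k.
  rewrite H2 [RHS](bigD1 k) //= !mxE !eqxx scaleN1r big1 ?addr0 //.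
  by move=> l lk; rewrite !mxE (negbTE lk) scale0r.
rewrite H1 // [RHS](bigD1 k) //= !mxE eqxx (negbTE ik) addrC; congr (_ + _).
rewrite (bigD1 i) //= !mxE (negbTE ik) eqxx scale1r big1 ?addr0 //.
by move=> l /andP[lk li]; rewrite !mxE (negbTE lk) (negbTE li) scale0r.
Qed.

Lemma coef_mulrz (p : {poly int}) (m : int) j : (p *~ m)`_j = m * p`_j.
Proof.
have -> : p *~ m = m%:P * p by rewrite -mulrzl -[X in X%:P]intz rmorph_int.
by rewrite coefCM.
Qed.

(** Whichever monomial attains the maximum, row [k] becomes its opposite plus a combination of the
    other rows. *)
Lemma det_tmut k g B : B k k = 0 ->
  \det (coef_mx (tmut k g B)) = - \det (coef_mx g).
Proof.
move=> b0.
have [c [ck Ec]] : exists c : 'I_n -> int, c k = 0 /\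
    tmax (tlin g (posexp B k)) (tlin g (negexp B k)) = tlin g c.
  rewrite /tmax; case: ifP => _.
    by exists (posexp B k); rewrite /posexp b0 pospart0.
  by exists (negexp B k); rewrite /negexp b0 oppr0 pospart0.
apply: (@det_row_reflection k c) => [i ik|]; apply/rowP => j; rewrite !mxE.
  by rewrite /tmut (negbTE ik).
rewrite /tmut eqxx Ec coefD coefN addrC; congr (_ + _).
rewrite /tlin coef_sum summxE (bigD1 k) //= ck mulr0z coef0 add0r.
by apply: eq_bigr => l _; rewrite !mxE coef_mulrz.
Qed.

(** The maximum of 0 and [g k] is 0 or 1 times [g k], so every other row changes by a multiple of
    row [k], and row [k] changes sign. *)
Lemma det_hmut k g B : \det (coef_mx (hmut k g B)) = - \det (coef_mx g).
Proof.
have [c Ec] : exists c : int, tmax 0 (g k) = g k *~ c.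
  by rewrite /tmax; case: ifP => _; [exists 0; rewrite mulr0z | exists 1].
apply: (@det_col_reflection k (fun i => pospart (B k i) + c * - B k i)).
- move=> i ik; apply/rowP => j; rewrite !mxE /hmut (negbTE ik) Ec.
  rewrite -addrA -mulrzA -mulrzDr coefD; congr (_ + _).
  exact: coef_mulrz.
- by apply/rowP => j; rewrite !mxE /hmut eqxx coefN.
Qed.

Lemma det_tword g B w : totally_sign_skew_symmetric B ->
  \det (coef_mx (tword g B w)) = (-1) ^+ size w * \det (coef_mx g).
Proof.
elim: w g B => [|k w IH] g B tB /=; first by rewrite expr0 mul1r.
rewrite IH; last exact: tsss_mut.
by rewrite det_tmut ?exprS ?mulN1r ?mulrN ?mulNr // sss_diag //; apply: tsss_sss.
Qed.

Lemma det_hword g B w :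
  \det (coef_mx (hword g B w)) = (-1) ^+ size w * \det (coef_mx g).
Proof.
elim: w g B => [|k w IH] g B /=; first by rewrite expr0 mul1r.
by rewrite IH det_hmut exprS mulN1r mulrN mulNr.
Qed.

Lemma det_coef_perm g (sigma : 'S_n) (eps : int) :
  (forall j, g (sigma j) = eps *: 'X^j) ->
  (-1) ^+ sigma * \det (coef_mx g) = eps ^+ n.
Proof.
move=> E; rewrite -det_perm -det_mulmx -row_permE.
have -> : row_perm sigma (coef_mx g) = eps%:M; last exact: det_scalar.
apply/matrixP => i j; rewrite !mxE E coefZ coefXn -[eps in RHS]mulr1.
by rewrite -[RHS]mulr_natr mulr1 [(i == j)]eq_sym.
Qed.

End TropicalPattern.

Section TropicalEvaluation.

Variables (F : fieldType) (T : eqType) (tmul : T -> T -> T).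
Variables (e : T -> F) (theta : T -> trop) (t0 : T).
Hypothesis eM : forall s t, e (tmul s t) = e s * e t.
Hypothesis thetaM : forall s t, theta (tmul s t) = (theta s * theta t)%g.
Hypothesis e_inj : forall l l' : seq T,
  \sum_(t <- l) e t = \sum_(t <- l') e t -> perm_eq l l'.

Local Notation ev := (ev e theta).

Lemma ev_trop1 : ev 1 (0 : {poly int}).
Proof. exact: (ev1 eM thetaM e_inj t0). Qed.

Lemma ev_tropZ f (a : {poly int}) (m : int) : ev f a -> ev (f ^ m) (a *~ m).
Proof.
by move=> ef; rewrite -(zexpg_trop a m); apply: (ev_exprz eM thetaM e_inj t0).
Qed.

Lemma ev_tropM f g (a b : {poly int}) : ev f a -> ev g b -> ev (f * g) (a + b).
Proof. exact: ev_mul. Qed.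

Lemma ev_tropV f (a : {poly int}) : ev f a -> ev f^-1 (- a).
Proof. exact: ev_inv. Qed.

Lemma ev_tropD f g (a b : {poly int}) : ev f a -> ev g b ->
  ev (f + g) (tmax a b).
Proof. exact: ev_add. Qed.

Variable n : nat.
Implicit Types (s : gseed F n) (g : 'I_n -> {poly int}).

Lemma ev_trop_mon (x : 'I_n -> F) g c : (forall i, ev (x i) (g i)) ->
  ev (mon x c) (tlin g c).
Proof.
move=> ex; apply: (big_ind2 ev).
- exact: ev_trop1.
- by move=> f a h b; apply: ev_tropM.
- by move=> i _; apply: ev_tropZ.
Qed.

Lemma ev_gmut_trop mu k s g : (forall i, ev (gx s i) (g i)) ->
  (forall i, ev (gk s i) (0 : {poly int})) -> ev mu (0 : {poly int}) ->
  (forall i, ev (gx (gmut mu k s) i) (tmut k g (gB s) i)) /\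
  (forall i, ev (gk (gmut mu k s) i) (0 : {poly int})).
Proof.
move=> ex ek emu; split=> i; rewrite ffunE /tmut; case: eqP => // _.
- rewrite -[tlin g (posexp _ _)]add0r -[g k]add0r.
  apply: ev_tropM; last by apply: ev_tropV; apply: ev_tropM.
  apply: ev_tropD; last exact: ev_trop_mon.
  by apply: ev_tropM; [apply: ek | apply: ev_trop_mon].
- by rewrite -oppr0; apply: ev_tropV; apply: ek.
- have -> : 0 = 0 + 0 *~ pospart (gB s k i) + 0 *~ (- gB s k i) :> {poly int}.
    by rewrite !mul0rz !addr0.
  apply: ev_tropM; last exact: ev_tropZ.
  by apply: ev_tropM; [|apply: ev_tropZ]; apply: ek.
Qed.

Lemma ev_gmut_hat (Q : F -> Prop) k s g : pos_field Q -> gpos Q s ->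
  gB s k k = 0 -> (forall i, ev (ghat s i) (g i)) ->
  forall i, ev (ghat (gmut 1 k s) i) (hmut k g (gB s) i).
Proof.
move=> pQ ps b0 eh i; have [x0 k0] := gpos_neq0 pQ ps.
rewrite /hmut; have [->|ik] := eqVneq i k.
  by rewrite ghat_mut_same //; apply: ev_tropV.
have h0 : 1 + ghat s k != 0 by apply: ghat1_neq0 ps.
rewrite ghat_mut ?oner_eq0 //.
apply: ev_tropM; first by apply: ev_tropM => //; apply: ev_tropZ.
by apply: ev_tropZ; apply: ev_tropD => //; apply: ev_trop1.
Qed.

Lemma ev_gword_trop s g w : (forall i, ev (gx s i) (g i)) ->
  (forall i, ev (gk s i) (0 : {poly int})) ->
  forall i, ev (gx (gword s w) i) (tword g (gB s) w i).
Proof.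
elim: w s g => [|k w IH] s g ex ek //=.
by have [H1 H2] := ev_gmut_trop k ex ek ev_trop1; apply: IH.
Qed.

Lemma ev_gword_hat (Q : F -> Prop) s g w : pos_field Q -> gpos Q s ->
  totally_sign_skew_symmetric (gB s) -> (forall i, ev (ghat s i) (g i)) ->
  forall i, ev (ghat (gword s w) i) (hword g (gB s) w i).
Proof.
move=> pQ; elim: w s g => [|k w IH] s g ps tB eh //=.
apply: IH.
- by apply: gmut_pos => //; apply: pf1.
- exact: tsss_mut.
- apply: ev_gmut_hat ps _ eh => //.
  by apply: sss_diag; apply: tsss_sss.
Qed.

End TropicalEvaluation.

(** * Degrees of subtraction-free Laurent polynomials *)

Section Degree.

Variables (F : fieldType) (m : nat) (v : 'I_m -> F) (l : 'I_m).
Hypothesis fv : free_over (intr : {rmorphism int -> F}) v.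

Let A := laur (@Zimg F) v (predC1 l).
Let t := v l.

Let sA : subring A. Proof. by apply: laur_subring; apply: Zimg_subring. Qed.
Let tt : transc A t. Proof. exact: free_transc. Qed.
Let t0 : t != 0. Proof. exact: transc_neq0 tt. Qed.

Definition others (k : 'X_{1..m}) : 'X_{1..m} :=
  [multinom (if i == l then 0 else k i)%N | i < m].

Lemma othersE k : mmap1 v k = mmap1 v (others k) * t ^+ k l.
Proof.
rewrite /mmap1 (bigD1 l) //= [X in _ = X * _](bigD1 l) //= mnmE eqxx expr0 mul1r.
rewrite mulrC; congr (_ * _); apply: eq_bigr => i il.
by rewrite mnmE (negbTE il).
Qed.

Definition upoly (r : seq 'X_{1..m}) : {poly F} :=
  \sum_(k <- r) (mmap1 v (others k))%:P * 'X^(k l).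

Lemma upoly_horner r : (upoly r).[t] = \sum_(k <- r) mmap1 v k.
Proof.
by rewrite horner_sum; apply: eq_bigr => k _; rewrite !hornerE -othersE.
Qed.

Lemma upoly_over r : over A (upoly r).
Proof.
move=> i; rewrite coef_sum; apply: sr_sum => // k _.
rewrite coefCM coefXn; apply: srM => //; last exact: sr_nat.
apply: sr_prod => // j _; rewrite mnmE; have [->|jl] := eqVneq j l.
  by rewrite expr0; apply: sr1.
by apply: srX => //; apply: laur_var.
Qed.

Lemma coef_upoly r i :
  (upoly r)`_i = \sum_(k <- [seq others k | k : 'X_{1..m} <- r & k l == i]) mmap1 v k.
Proof.
rewrite coef_sum big_map big_filter [RHS]big_mkcond /=.
apply: eq_bigr => k _; rewrite coefCM coefXn eq_sym.
by case: eqP; rewrite ?mulr1 ?mulr0.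
Qed.

Lemma coef_upoly_eq0 r i :
  ((upoly r)`_i == 0) = ~~ has (fun k : 'X_{1..m} => k l == i) r.
Proof.
rewrite coef_upoly; apply/eqP/idP => [E|].
  have /perm_nilP : perm_eq [seq others k | k : 'X_{1..m} <- r & k l == i] [::].
    by apply: (free_monomials_inj fv); rewrite big_nil.
  rewrite has_filter; case: filter => //.
by rewrite has_filter negbK => /eqP ->; rewrite big_nil.
Qed.

(** In a sum of monomials with multiplicities nothing cancels, so the maximum of the exponents is
    the true degree. *)
Lemma osum_top (r : seq 'X_{1..m}) (a : {poly int}) :
  osum (fun k : 'X_{1..m} => ((k l)%:R : trop)) r = Some a ->
  exists2 d : nat, a = d%:R & size (upoly r) = d.+1.
Proof.
suff H : osum (fun k : 'X_{1..m} => ((k l)%:R : trop)) r = Some a ->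
    exists d : nat, [/\ a = d%:R, has (fun k : 'X_{1..m} => k l == d) r &
      all (fun k : 'X_{1..m} => k l <= d)%N r].
  move=> /H[d [-> hd ad]]; exists d => //; apply/eqP; rewrite eqn_leq.
  apply/andP; split.
    apply/leq_sizeP => i di; apply/eqP; rewrite coef_upoly_eq0.
    apply/hasPn => k kr; apply: contraTneq di => <-.
    by rewrite -leqNgt (allP ad).
  rewrite ltnNge; apply/negP => /(nth_default 0)/eqP.
  by rewrite coef_upoly_eq0 hd.
elim: r a => [|k r IH] a; first by rewrite /osum big_nil.
rewrite /osum big_cons -/(osum _ r).
case E: (osum _ r) => [b|]; last first.
  move=> -[<-]; exists (k l); rewrite /= eqxx leqnn; split=> //.
  case: r E {IH} => //= k' r; rewrite /osum big_cons.
  by case: (bigop.body _ _ _).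
have [d [Eb hd ad]] := IH _ E; rewrite oACE => -[<-].
rewrite [oplus _ _]/(tmax _ _) Eb /tmax.
have -> : (k l)%:R - d%:R = ((k l)%:R - d%:R)%:P :> {poly int}.
  by rewrite polyCB !rmorph_nat.
rewrite lead_coefC; case: ifP => dk.
  have dk' : (d <= k l)%N by move: dk; rewrite subr_ge0 ler_nat.
  exists (k l); rewrite /= eqxx leqnn; split=> //.
  by apply: sub_all ad => k' /leq_trans; apply.
have dk' : (k l <= d)%N.
  by move/negbT: dk; rewrite subr_ge0 ler_nat -ltnNge => /ltnW.
by exists d; rewrite /= hd orbT dk' ad.
Qed.

(** Opposite values turn the maximum into a minimum and give the order of vanishing. *)
Lemma osum_bot (r : seq 'X_{1..m}) (a : {poly int}) :
  osum (fun k : 'X_{1..m} => (- (k l)%:R : trop)) r = Some a ->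
  exists2 d : nat, a = - d%:R & (upoly r)`_d != 0 /\
    forall i, (i < d)%N -> (upoly r)`_i = 0.
Proof.
suff H : osum (fun k : 'X_{1..m} => (- (k l)%:R : trop)) r = Some a ->
    exists d : nat, [/\ a = - d%:R, has (fun k : 'X_{1..m} => k l == d) r &
      all (fun k : 'X_{1..m} => d <= k l)%N r].
  move=> /H[d [-> hd ad]]; exists d => //; split.
    by rewrite coef_upoly_eq0 hd.
  move=> i di; apply/eqP; rewrite coef_upoly_eq0.
  apply/hasPn => k kr; apply: contraTneq di => <-.
  by rewrite -leqNgt (allP ad).
elim: r a => [|k r IH] a; first by rewrite /osum big_nil.
rewrite /osum big_cons -/(osum _ r).
case E: (osum _ r) => [b|]; last first.
  move=> -[<-]; exists (k l); rewrite /= eqxx leqnn; split=> //.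
  case: r E {IH} => //= k' r; rewrite /osum big_cons.
  by case: (bigop.body _ _ _).
have [d [Eb hd ad]] := IH _ E; rewrite oACE => -[<-].
rewrite [oplus _ _]/(tmax _ _) Eb /tmax opprK addrC.
have -> : d%:R - (k l)%:R = (d%:R - (k l)%:R)%:P :> {poly int}.
  by rewrite polyCB !rmorph_nat.
rewrite lead_coefC; case: ifP => dk.
  have dk' : (k l <= d)%N by move: dk; rewrite subr_ge0 ler_nat.
  exists (k l); rewrite /= eqxx leqnn; split=> //.
  by apply: sub_all ad => k' /(leq_trans dk').
have dk' : (d <= k l)%N.
  by move/negbT: dk; rewrite subr_ge0 ler_nat -ltnNge => /ltnW.
by exists d; rewrite /= hd orbT dk' ad.
Qed.

(* The tropical evaluations in the directions of [v_l] and [v_l^-1] give the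
   degree and the order of [f] in [v_l]. *)
Lemma degree_monomial f (d : int) : lpoly A t f ->
  ev (mmap1 v) (fun k : 'X_{1..m} => ((k l)%:R : trop)) f (d%:~R : {poly int}) ->
  ev (mmap1 v) (fun k : 'X_{1..m} => (- (k l)%:R : trop)) f
    (- d%:~R : {poly int}) ->
  exists2 rho, A rho & f = rho * t ^ d.
Proof.
move=> Lf ev1 ev2.
have eM := mmap1D v; have e_inj := free_monomials_inj fv.
have th1 (k k' : 'X_{1..m}) : (((k + k')%MM l)%:R : trop) =
    (((k l)%:R : trop) * ((k' l)%:R : trop))%g by rewrite mnmDE natrD.
have th2 (k k' : 'X_{1..m}) : (- ((k + k')%MM l)%:R : trop) =
    ((- (k l)%:R : trop) * (- (k' l)%:R : trop))%g.
  by rewrite mnmDE natrD opprD.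
have f0 := ev_neq0 eM th1 e_inj ev1.
have [e [p [Ap p0 Ef]]] := lpoly_normal t0 Lf f0.
have pn0 : p != 0 by apply: contraNneq p0 => ->; rewrite coef0.
have natr_inj (a b : int) : a%:~R = b%:~R :> {poly int} -> a = b.
  move/(congr1 (fun q : {poly int} => q`_0)).
  by rewrite -!(rmorph_int polyC) !coefC /= !intz.
(* The evaluation with opposite exponents determines the order of [f] in [t]. *)
have e_d : e = d.
  have [r [r' [b [or' or E]]]] := ev_fraction eM th2 e_inj ev2.
  have [d1 Ed1 [c1 z1]] := osum_bot or; have [d2 Ed2 [c2 z2]] := osum_bot or'.
  have drop q k : over A q -> (forall i, (i < k)%N -> q`_i = 0) ->
      over A (drop_poly k q) /\ q = drop_poly k q * 'X^k.
    move=> Aq zq; split; first by move=> i; rewrite coef_drop_poly.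
    rewrite -{1}[q](poly_take_drop k) -[RHS]add0r; congr (_ + _).
    apply/polyP => i; rewrite coef_take_poly coef0; case: ltnP => // ik.
    exact: zq.
  have [A1 E1] := drop _ _ (upoly_over r) z1.
  have [A2 E2] := drop _ _ (upoly_over r') z2.
  have [ee _] : e + d2%:Z = d1%:Z /\ p * drop_poly d2 (upoly r') =
      drop_poly d1 (upoly r).
    apply: (lpoly_normal_uniq sA tt) => //.
    - exact: overM.
    - by rewrite coefM big_ord1 mulf_neq0 // coef_drop_poly.
    - by rewrite coef_drop_poly.
    - move: E; rewrite /esum -!upoly_horner.
      have -> : (upoly r).[t] = (drop_poly d1 (upoly r)).[t] * t ^+ d1.
        by rewrite {1}E1 hornerM hornerXn.
      have -> : (upoly r').[t] = (drop_poly d2 (upoly r')).[t] * t ^+ d2.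
        by rewrite {1}E2 hornerM hornerXn.
      rewrite Ef => E.
      by rewrite expfzDr // -!exprnP hornerM [RHS]mulrC -E; ring.
  have Ed : d + d2%:Z = d1%:Z.
    apply: natr_inj; apply: oppr_inj; rewrite rmorphD opprD /=.
    by rewrite Ed2 in Ed1; apply: Ed1.
  by move: ee Ed; lia.
(* The other evaluation shows that the degree is [d] as well, so the polynomial factor is
   constant. *)
have sp : size p = 1%N.
  have [r [r' [b [or' or E]]]] := ev_fraction eM th1 e_inj ev1.
  have [d1 Ed1 s1] := osum_top or; have [d2 Ed2 s2] := osum_top or'.
  have Ed : d + d2%:Z = d1%:Z.
    by apply: natr_inj; rewrite rmorphD /=; rewrite Ed2 in Ed1; apply: Ed1.
  have H : p.[t] * t ^ d * (upoly r').[t] = (upoly r).[t].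
    by rewrite !upoly_horner -/(esum _ r) -E Ef e_d [p.[t] * _]mulrC.
  have n2 : upoly r' != 0 by rewrite -size_poly_eq0 s2.
  have n1 : upoly r != 0 by rewrite -size_poly_eq0 s1.
  have sz q q' k : q != 0 -> q' != 0 -> over A q -> over A q' ->
      q.[t] = q'.[t] * t ^+ k -> size q = (size q' + k)%N.
    move=> q0 q'0 Aq Aq' E'; have -> : q = q' * 'X^k.
      apply: (transc_inj sA tt) => //; last by rewrite hornerM hornerXn.
      by apply: overM => //; apply: overXn.
    by rewrite size_mulXn // addnC.
  have pr0 : p * upoly r' != 0 by rewrite mulf_neq0.
  have Apr : over A (p * upoly r') by apply: overM => //; apply: upoly_over.
  have spr := size_mul pn0 n2; rewrite s2 in spr.
  have Ar := upoly_over r.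
  move: pn0; rewrite -size_poly_gt0 => sp.
  case: (d) Ed H => k Ed H.
    have := sz _ _ k n1 pr0 Ar Apr.
    rewrite hornerM -H -exprnP s1 spr => H'.
    have {}H' : d1.+1 = ((size p + d2.+1).-1 + k)%N by apply: H'; ring.
    by move: Ed; lia.
  have := sz _ _ k.+1 pr0 n1 Apr Ar.
  rewrite hornerM -H NegzE -exprnN s1 spr => H'.
  have {}H' : (size p + d2.+1).-1 = (d1.+1 + k.+1)%N.
    by apply: H'; field; rewrite expf_neq0.
  by move: Ed; rewrite NegzE; lia.
have Ep := size1_polyC (eq_leq sp).
by exists p`_0; [apply: Ap | rewrite Ef e_d Ep hornerC coefC mulrC].
Qed.

End Degree.

(** * Comparison of two seeds with proportional clusters *)

Section Transcendence.

Variable F : fieldType.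
Implicit Types (A : F -> Prop) (t P : F).

Lemma lpoly_sub A A' t f : (forall g, A g -> A' g) -> lpoly A t f ->
  lpoly A' t f.
Proof. by move=> sub [p [d [Ap Ep]]]; exists p, d; split=> // i; apply: sub. Qed.

(** Multiplied by a power of [t], a relation for [P / t] becomes one for [t]: the polynomial [q],
    with coefficients p_i P^i in reversed order. *)
Lemma transc_inv A t P : subring A -> transc A t -> A P -> P != 0 ->
  transc A (P / t).
Proof.
move=> sA tt AP P0 p Ap p0; have t0 := transc_neq0 sA tt.
pose q := \sum_(i < size p) (p`_i * P ^+ i)%:P * 'X^(size p - i).
have q0 : q = 0.
  apply: tt.
    move=> j; rewrite coef_sum; apply: sr_sum => // i _; rewrite coefCM coefXn.
    apply: srM => //; last exact: sr_nat.
    by apply: srM => //; apply: srX.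
  transitivity (t ^+ size p * p.[P / t]); last by rewrite p0 mulr0.
  rewrite horner_sum horner_coef mulr_sumr; apply: eq_bigr => i _.
  rewrite !hornerE /= -[in t ^+ size p](subnK (ltnW (ltn_ord i))) exprD exprMn.
  by rewrite exprVn; field; rewrite expf_neq0.
apply/polyP => j; rewrite coef0; have [js|js] := ltnP j (size p); last first.
  by rewrite nth_default.
have := congr1 (fun r : {poly F} => r`_(size p - j)) q0.
rewrite coef0 coef_sum (bigD1 (Ordinal js)) //= big1 => [|i ij].
  rewrite coefCM coefXn eqxx mulr1 addr0 => /eqP.
  by rewrite mulf_eq0 expf_eq0 (negbTE P0) andbF orbF => /eqP.
rewrite coefCM coefXn; case: eqP => [E|]; last by rewrite mulr0.
case/eqP: ij; apply: val_inj => /=; move: (ltn_ord i) js E; lia.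
Qed.

Lemma transc_frac A A' t : subring A -> transc A t ->
  (forall f, A' f -> exists q, [/\ A q, q != 0 & A (q * f)]) -> transc A' t.
Proof.
move=> sA tt frac p Ap p0.
have [q [Aq q0 Aqp]] : exists q, [/\ A q, q != 0 &
    forall r, (r < size p)%N -> A (q * p`_r)].
  elim: (size p) => [|k [q [Aq q0 H]]].
    by exists 1; split; rewrite ?oner_eq0 //; apply: sr1.
  have [q' [Aq' q'0 H']] := frac _ (Ap k).
  exists (q' * q); split; [exact: srM | by rewrite mulf_neq0 |].
  move=> r; rewrite ltnS leq_eqVlt => /predU1P[->|rk].
    by rewrite mulrAC; apply: srM.
  by rewrite -mulrA; apply: srM => //; apply: H.
apply/eqP; have : q *: p = 0.
  apply: tt; last by rewrite hornerZ p0 mulr0.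
  move=> i; rewrite coefZ; have [si|si] := ltnP i (size p); first exact: Aqp.
  by rewrite nth_default // mulr0; apply: sr0.
by move/eqP; rewrite scaler_eq0 (negbTE q0).
Qed.

End Transcendence.

Lemma mon_perm (F : fieldType) n (x : 'I_n -> F) e (sigma : 'S_n) :
  mon x e = mon (fun i => x (sigma i)) (fun i => e (sigma i)).
Proof. by rewrite /mon (reindex_inj (@perm_inj _ sigma)). Qed.

Section SeedComparison.

Variables (F : fieldType) (n : nat) (C Q : F -> Prop).
Hypotheses (sC : subring C) (CV : forall f, C f -> C f^-1) (pQ : pos_field Q).
Variables (s s' : gseed F n) (sigma : 'S_n) (c : 'I_n -> F) (k : 'I_n).
Hypotheses (ps : gpos Q s) (ps' : gpos Q s').
Hypotheses (Ck : forall i, C (gk s i)) (Ck' : forall i, C (gk s' i)).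
Hypotheses (bkk : gB s k k = 0) (bkk' : gB s' (sigma k) (sigma k) = 0).
Hypothesis Cc : forall i, C (c i) /\ c i != 0.
Hypothesis xE : forall i, gx s' (sigma i) = c i * gx s i.
Hypothesis tr : forall l, transc (laur C (gx s) (predC1 l)) (gx s l).

Let A l := laur C (gx s) (predC1 l).
Let sA l : subring (A l). Proof. exact: laur_subring. Qed.
Let x0 : forall i, gx s i != 0. Proof. by case: (gpos_neq0 pQ ps). Qed.
Let x'0 : forall i, gx s' i != 0. Proof. by case: (gpos_neq0 pQ ps'). Qed.
Let k0 : forall i, gk s i != 0. Proof. by case: (gpos_neq0 pQ ps). Qed.
Let k'0 : forall i, gk s' i != 0. Proof. by case: (gpos_neq0 pQ ps'). Qed.
Let c0 i : c i != 0. Proof. by case: (Cc i). Qed.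
Let h := ghat s k.
Let h' := ghat s' (sigma k).
Let h0 : h != 0. Proof. by apply: (pf_neq0 pQ); apply: ghat_pos. Qed.
Let h10 : 1 + h != 0. Proof. by apply: ghat1_neq0 ps. Qed.

Let mon'E e : mon (gx s') e =
  mon c (fun i => e (sigma i)) * mon (gx s) (fun i => e (sigma i)).
Proof.
by rewrite (mon_perm _ _ sigma) -monM; apply: eq_bigr => i _; rewrite xE.
Qed.

Let Cunit f l : C f -> f != 0 -> runit (A l) f.
Proof. by move=> Cf f0; split=> //; apply: laur_const => //; apply: CV. Qed.

Let Cmon e : C (mon c e).
Proof.
apply: sr_prod => // i _; apply: sr_exprz => //; first by case: (Cc i).
by apply: CV; case: (Cc i).
Qed.

Let Amon e l : e l = 0 -> runit (A l) (mon (gx s) e).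
Proof.
move=> el; apply: runit_mon => // i ei; have il : i != l.
  by apply: contraNneq ei => ->; rewrite el.
by split=> //; [apply: laur_var | apply: laur_inv].
Qed.

Let Ah : runit (A k) h.
Proof. by apply: runitM => //; [apply: Cunit | apply: Amon]. Qed.

Let h'E : h' = gk s' (sigma k) * mon c (fun i => gB s' (sigma i) (sigma k)) *
  mon (gx s) (fun i => gB s' (sigma i) (sigma k)).
Proof. by rewrite /h' /ghat mon'E mulrA. Qed.

Let Ah' : runit (A k) h'.
Proof.
rewrite h'E; apply: runitM => //; last exact: Amon.
by apply: Cunit; [apply: srM | rewrite mulf_neq0 // mon_neq0].
Qed.

(** Up to factors from [A k], the ratio is that of the new variables [z'] and [z], hence Laurent in
    [z] over [A k]. Being also a quotient of elements of [A k], it lies in [A k] by [lpoly_div]. *)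
Lemma mut_ratio mu mu' : C mu -> C mu' -> mu != 0 -> mu' != 0 ->
  laur C (gx (gmut mu k s)) predT (gx (gmut mu' (sigma k) s') (sigma k)) ->
  A k ((1 + h') / (1 + h)).
Proof.
move=> Cmu Cmu' mu0 mu'0 Lz'.
set z := gx (gmut mu k s) k; set z' := gx _ _ in Lz'.
pose N := mon (gx s) (negexp (gB s) k).
pose N' := mon (gx s') (negexp (gB s') (sigma k)).
have uN : runit (A k) N by apply: Amon; rewrite /negexp bkk oppr0 pospart0.
have uN' : runit (A k) N'.
  rewrite /N' mon'E; apply: runitM => //; last first.
    by apply: Amon; rewrite /negexp bkk' oppr0 pospart0.
  by apply: Cunit => //; rewrite mon_neq0.
have [_ _ N0] := uN; have [_ _ N'0] := uN'.
have A1 := sr1 (sA k); have [Ah1 _ _] := Ah; have [Ah1' _ _] := Ah'.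
have zE : z = (1 + h) * N / mu / gx s k by rewrite /z gx_mut // invfM mulrA.
have AP : A k ((1 + h) * N / mu).
  have [AN _ _] := uN; have [_ AVmu _] := Cunit k Cmu mu0.
  by do 2 (apply: srM => //); apply: srD.
have P0 : (1 + h) * N / mu != 0.
  by rewrite mulf_neq0 ?invr_eq0 // mulf_neq0.
have tz : transc (A k) z.
  by rewrite zE; apply: (transc_inv (sA k) (@tr k) AP P0).
have z0 := transc_neq0 (sA k) tz.
have Lz : lpoly (A k) z z'.
  have Lz1 : lpoly (laur C (gx (gmut mu k s)) (predC1 k)) z z'.
    apply: laur_lpoly Lz' => // i _.
    by have [->|ik] := eqVneq i k; [left | right].
  apply: lpoly_sub Lz1 => f; apply: laur_min => //.
    by move=> a Ca; apply: laur_const.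
  move=> i /= ik; rewrite gx_mut_other //.
  by split; [apply: laur_var | apply: laur_inv].
have sL := lpoly_subring z (sA k).
have E : (1 + h') / (1 + h) = z' * (mu' * c k * N / mu / N') / z.
  rewrite /z' gx_mut // -/N' -/h' xE zE.
  by field; rewrite h10 N0 N'0 mu0 mu'0 x0 c0.
have A1h : A k (1 + h) by apply: srD.
have A1h' : A k ((1 + h) * ((1 + h') / (1 + h))).
  by rewrite mulrC divfK //; apply: srD.
apply: (lpoly_div (sA k) tz _ A1h h10 A1h').
rewrite E; apply: srM => //; last exact: lpolyV.
apply: srM => //; apply: lpolyA => //.
have [AN _ _] := uN; have [_ AVN' _] := uN'.
apply: srM => //; apply: srM => //; last by have [] := Cunit k Cmu mu0.
by apply: srM => //; apply: laur_const; apply: srM => //; case: (Cc k).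
Qed.

Variable l : 'I_n.
Hypotheses (lk : l != k) (blk : gB s l k != 0).

Let L_lpoly f : A k f -> lpoly (A l) (gx s l) f.
Proof.
move=> Af; apply: laur_lpoly Af => // i _.
by have [->|il] := eqVneq i l; [left | right].
Qed.

Let a := gk s k * mon (gx s) (fun i => if i == l then 0 else gB s i k).
Let a' := gk s' (sigma k) * mon c (fun i => gB s' (sigma i) (sigma k)) *
  mon (gx s) (fun i => if i == l then 0 else gB s' (sigma i) (sigma k)).

Let aE : h = a * gx s l ^ gB s l k.
Proof.
by rewrite /h /ghat /a (@mon_split _ _ (gx s) _ l) //; ring.
Qed.

Let a'E : h' = a' * gx s l ^ gB s' (sigma l) (sigma k).
Proof. by rewrite h'E /a' (@mon_split _ _ (gx s) (gx s) l) //; ring. Qed.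

Let ua : runit (A l) a.
Proof.
by apply: runitM => //; [apply: Cunit | apply: Amon; rewrite eqxx].
Qed.

Let ua' : runit (A l) a'.
Proof.
apply: runitM => //; last by apply: Amon; rewrite eqxx.
by apply: Cunit; [apply: srM | rewrite mulf_neq0 // mon_neq0].
Qed.

(** Read in the single variable [gx s l], with nonzero exponent in [h], the ratio is invertible, so
    it is a monomial and the two binomials are proportional. *)
Lemma hat_eq_or_inv : A k ((1 + h') / (1 + h)) -> A k ((1 + h) / (1 + h')) ->
  h' = h \/ h' = h^-1.
Proof.
move=> /L_lpoly Lr /L_lpoly LVr.
have h'10 : 1 + h' != 0 by apply: ghat1_neq0 ps'.
have rr : (1 + h') / (1 + h) * ((1 + h) / (1 + h')) = 1.
  by field; rewrite h10 h'10.
have A1 := sr1 (sA l).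
have [e [rho [rho' [Arho _ Er _ rho1]]]] :=
  lpoly_factor (sA l) (@tr l) Lr LVr A1 (oner_neq0 F) rr.
have rho0 : rho != 0.
  by apply/eqP => r0; move/eqP: rho1; rewrite r0 mul0r eq_sym oner_eq0.
have [Aa _ a0] := ua; have [Aa' _ a'0] := ua'.
have E : rho * gx s l ^ e * (1 + a * gx s l ^ gB s l k) =
    1 + a' * gx s l ^ gB s' (sigma l) (sigma k).
  by rewrite -Er -aE -a'E divfK.
have [[Eb Ea]|[Eb Ea]] :=
  binomial_ratio_unit (sA l) (@tr l) Aa Aa' Arho a0 a'0 rho0 blk E.
  by left; rewrite aE a'E Eb Ea.
right; apply: (mulIf h0); rewrite mulVf // aE a'E Eb mulrACA Ea mul1r.
by rewrite -expfzDr // addNr expr0z.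
Qed.

Lemma hat_inv : A k ((1 + h') / (1 + h)) ->
  (forall i, gB s' (sigma i) (sigma k) = - gB s i k) -> h' = h^-1.
Proof.
move=> /L_lpoly Lr EB.
have [Aa _ a0] := ua; have [Aa' _ a'0] := ua'.
have E : (1 + h') / (1 + h) * (1 + a * gx s l ^ gB s l k) =
    1 + a' * gx s l ^ (- gB s l k).
  by rewrite -aE -EB -a'E divfK.
have Ea := binomial_ratio_opp (sA l) (@tr l) Lr Aa Aa' a0 a'0 blk E.
apply: (mulIf h0); rewrite mulVf // aE a'E EB mulrACA Ea mul1r.
by rewrite -expfzDr // addNr expr0z.
Qed.

End SeedComparison.

Section MonomialIndependence.

Variables (F : fieldType) (n : nat) (C : F -> Prop) (x : 'I_n -> F).
Hypotheses (sC : subring C).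
Hypothesis tr : forall l, transc (laur C x (predC1 l)) (x l).

Lemma mon_indep a b (e e' : 'I_n -> int) : C a -> C b -> a != 0 -> b != 0 ->
  a * mon x e = b * mon x e' -> e =1 e' /\ a = b.
Proof.
move=> Ca Cb a0 b0 E.
have x0 i : x i != 0.
  by apply: (transc_neq0 _ (@tr i)); apply: laur_subring.
have Ee : e =1 e'.
  move=> l; have sA := laur_subring x (predC1 l) sC.
  move: E; rewrite (@mon_split _ _ x _ l) // [X in _ = _ * X](@mon_split _ _ x _ l) //.
  set m := mon _ _; set m' := mon _ _ => E.
  have Am f : f l = 0 -> laur C x (predC1 l) (mon x f).
    by move=> fl; apply: mon_laur => // i; rewrite /= negbK => /eqP ->.
  have [] // := @lpoly_monomial_eq _ _ (x l) (a * m) (b * m') (e l) (e' l) sA (@tr l).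
  - by apply: srM => //; [apply: laur_const | apply: Am; rewrite eqxx].
  - by apply: srM => //; [apply: laur_const | apply: Am; rewrite eqxx].
  - by rewrite mulf_neq0 // mon_neq0.
  - by rewrite mulf_neq0 // mon_neq0.
  - by rewrite mulrAC -mulrA E; ring.
split=> //; apply: (mulIf (mon_neq0 e' x0)).
by rewrite -E (eq_mon _ Ee).
Qed.

End MonomialIndependence.

(** * The sign obstruction in odd rank *)

Section SignObstruction.

Variable n : nat.

Section FreeSeed.

Variables (B : 'M[int]_n) (w : seq 'I_n) (sigma : 'S_n).
Hypothesis tB : totally_sign_skew_symmetric B.
Hypothesis col_neq0 : forall k, exists2 l, l != k & B l k != 0.
Hypothesis wB : forall i k, mx_word B w (sigma i) (sigma k) = - B i k.
Hypothesis wT : forall (g : 'I_n -> {poly int}) j, tword g B w (sigma j) = g j.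

Variables (F : fieldType) (v : 'I_(n + n) -> F) (Q : F -> Prop).
Variable s : gseed F n.
Hypothesis fv : free_over (intr : {rmorphism int -> F}) v.
Hypotheses (pQ : pos_field Q) (ps : gpos Q s) (sB : gB s = B).
Hypothesis xv : forall i, gx s i = v (lshift n i).
Hypothesis kv : forall i, gk s i = v (rshift n i).

Let s' := gword s w.
Local Notation x := (gx s).
Let ps' : gpos Q s'. Proof. exact: gword_pos. Qed.
Let x0 : forall i, x i != 0. Proof. by case: (gpos_neq0 pQ ps). Qed.
Let k0 : forall i, gk s i != 0. Proof. by case: (gpos_neq0 pQ ps). Qed.
Let tsB : totally_sign_skew_symmetric (gB s). Proof. by rewrite sB. Qed.

Let e_inj := free_monomials_inj fv.
Let eM := mmap1D v.
Let Zs : subring (@Zimg F) := Zimg_subring F.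

Let xE i : x i = mmap1 v U_(lshift n i)%MM.
Proof. by rewrite xv mmap1U. Qed.
Let kE i : gk s i = mmap1 v U_(rshift n i)%MM.
Proof. by rewrite kv mmap1U. Qed.
Let vE a : v (unsplit a) = gvar s a.
Proof. by case: a => i; rewrite /gvar ?xv ?kv. Qed.

Definition coef_laur : F -> Prop := laur (@Zimg F) (gk s) predT.

Let C0 : subring coef_laur. Proof. exact: laur_subring. Qed.

Let D l := laur (@Zimg F) v (predC1 (lshift n l)).

Let D_C0 l f : laur coef_laur x (predC1 l) f <-> D l f.
Proof.
have sD : subring (D l) by apply: laur_subring.
have sL : subring (laur coef_laur x (predC1 l)) by apply: laur_subring.
split; apply: laur_min => //.
- move=> a; apply: laur_min => //; first by move=> b Zb; apply: laur_const.
  move=> i _; rewrite kv.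
  have rl : predC1 (lshift n l) (rshift n i) by rewrite /= eq_rlshift.
  by split; [apply: laur_var | apply: laur_inv].
- move=> i /= il; rewrite xv.
  have ll : predC1 (lshift n l) (lshift n i) by rewrite /= eq_lshift.
  by split; [apply: laur_var | apply: laur_inv].
- by move=> a Za; apply: laur_const; apply: laur_const.
- move=> i; rewrite -[i](splitK i); case: (split i) => j /=.
    rewrite eq_lshift => jl.
    rewrite -xv.
    by split; [apply: laur_var | apply: laur_inv].
  rewrite -kv.
  by split; apply: laur_const; [apply: laur_var | apply: laur_inv].
Qed.

Let tr0 l : transc (laur coef_laur x (predC1 l)) (x l).
Proof.
apply: (@transc_sub _ (D l)) => [f /D_C0 //|].
by rewrite xE mmap1U; apply: free_transc; apply: fv.
Qed.

Let X_laur j : glaur s (gx s' j).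
Proof. exact: (laurent_phenomenon w j pQ ps tsB). Qed.

(** By [wT], giving [x l] the tropical value 1 or -1 and every other variable the value 0 returns
    the same value at [sigma j] as at [j] initially: degree and order in [x l] coincide. *)
Lemma variable_degree j l :
  exists2 rho, D l rho & gx s' (sigma j) = rho * x l ^ (j == l)%:Z.
Proof.
rewrite xv.
have th1 (k k' : 'X_{1..n + n}) : (((k + k')%MM (lshift n l))%:R : trop) =
    (((k (lshift n l))%:R : trop) * ((k' (lshift n l))%:R : trop))%g.
  by rewrite mnmDE natrD.
have th2 (k k' : 'X_{1..n + n}) : (- ((k + k')%MM (lshift n l))%:R : trop) =
    ((- (k (lshift n l))%:R : trop) * (- (k' (lshift n l))%:R : trop))%g.
  by rewrite mnmDE natrD opprD.
apply: degree_monomial; first exact: fv.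
- have vl0 : v (lshift n l) != 0 by apply: free_neq0; apply: fv.
  apply: (@laur_lpoly _ _ _ _ predT) => //.
    by move=> i _; have [->|il] := eqVneq i (lshift n l); [left | right].
  move: (X_laur (sigma j)).
  by apply: (laur_reindex (h := @unsplit n n)); [exact: Zs | exact: vE |].
- pose g (i : 'I_n) : {poly int} := (i == l)%:R.
  rewrite -[(j == l)%:Z%:~R]/(g j) -(wT g j) -sB.
  apply: (ev_gword_trop 0%MM eM th1 e_inj) => i.
    by rewrite xE /g -(eq_lshift n) -mnm1E; apply: ev_base.
  rewrite kE; have <- : (U_(rshift n i)%MM (lshift n l))%:R = 0 :> {poly int}.
    by rewrite mnm1E eq_rlshift.
  exact: ev_base.
- pose g (i : 'I_n) : {poly int} := - (i == l)%:R.
  rewrite -[- (j == l)%:Z%:~R]/(g j) -(wT g j) -sB.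
  apply: (ev_gword_trop 0%MM eM th2 e_inj) => i.
    by rewrite xE /g -(eq_lshift n) -mnm1E; apply: ev_base.
  rewrite kE; have <- : - (U_(rshift n i)%MM (lshift n l))%:R = 0 :> {poly int}.
    by rewrite mnm1E eq_rlshift oppr0.
  exact: ev_base.
Qed.

Let c j := gx s' (sigma j) / x j.

(** The quotient is a Laurent polynomial free of each [x l] separately, so [laur_cap] leaves only
    coefficients. *)
Lemma ratio_const j : coef_laur (c j).
Proof.
have xj l : l != j -> D l (x j)^-1.
  move=> lj; apply/D_C0; apply: laur_inv => /=.
  by rewrite eq_sym.
apply: (@laur_cap _ _ _ x (enum 'I_n)) => //.
  have sL : subring (laur coef_laur x (mem (enum 'I_n))) by apply: laur_subring.
  apply: srM => //; last by apply: laur_inv; rewrite /= mem_enum.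
  move: (X_laur (sigma j)); apply: laur_min => //.
    by move=> a Za; apply: laur_const; apply: laur_const.
  case=> i _; rewrite /gvar.
    by split; [apply: laur_var | apply: laur_inv]; rewrite /= mem_enum.
  by split; apply: laur_const; [apply: laur_var | apply: laur_inv].
move=> l _; apply/D_C0; have [rho Drho E] := variable_degree j l.
rewrite /c E; have [->|jl] := eqVneq j l; first by rewrite expr1z mulfK.
rewrite expr0z mulr1; apply: srM => //; first exact: laur_subring.
by apply: xj; rewrite eq_sym.
Qed.

(** The comparison of seeds requires constants closed under inverses, while the ratios [c j] are
    only Laurent polynomials in the coefficients. *)
Definition coef_frac (f : F) :=
  exists a b, [/\ coef_laur a, coef_laur b, b != 0 & f = a / b].

Let Cf_sub f : coef_laur f -> coef_frac f.
Proof.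
by exists f, 1; rewrite divr1 oner_eq0; split=> //; apply: sr1.
Qed.

Let sCf : subring coef_frac.
Proof.
split; try by apply: Cf_sub; [apply: sr1 || apply: srN1].
- move=> _ _ [a [b [Ca Cb b0 ->]]] [a' [b' [Ca' Cb' b'0 ->]]].
  exists (a * b' + a' * b), (b * b'); rewrite mulf_neq0 //; split=> //.
  + by apply: srD => //; apply: srM.
  + exact: srM.
  + by field; rewrite b0 b'0.
- move=> _ _ [a [b [Ca Cb b0 ->]]] [a' [b' [Ca' Cb' b'0 ->]]].
  exists (a * a'), (b * b'); rewrite mulf_neq0 //; split=> //; try exact: srM.
  by field; rewrite b0 b'0.
Qed.

Let CfV f : coef_frac f -> coef_frac f^-1.
Proof.
move=> [a [b [Ca Cb b0 ->]]]; have [->|a0] := eqVneq a 0.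
  by rewrite mul0r invr0; apply: Cf_sub; apply: sr0.
by exists b, a; rewrite invf_div.
Qed.

Let Cf_clear S f : laur coef_frac x S f ->
  exists q, [/\ coef_laur q, q != 0 & laur coef_laur x S (q * f)].
Proof.
have sL : subring (laur coef_laur x S) by apply: laur_subring.
have c1 : coef_laur 1 by apply: sr1.
elim=> {f} [_ [a [b [Ca Cb b0 ->]]]|i Si|i Si|f g _ [q [Cq q0 Lf]] _ [r [Cr r0 Lg]]|].
- exists b; split=> //; rewrite mulrCA mulfV // mulr1.
  exact: laur_const.
- by exists 1; rewrite mul1r oner_eq0; split=> //; apply: laur_var.
- by exists 1; rewrite mul1r oner_eq0; split=> //; apply: laur_inv.
- exists (q * r); rewrite mulf_neq0 //; split=> //; first exact: srM.
  have -> : q * r * (f + g) = r * (q * f) + q * (r * g) by ring.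
  by apply: srD => //; apply: srM => //; apply: laur_const.
- move=> f g _ [q [Cq q0 Lf]] _ [r [Cr r0 Lg]].
  exists (q * r); rewrite mulf_neq0 //; split=> //; first exact: srM.
  by rewrite mulrACA; apply: srM.
Qed.

Let tr l : transc (laur coef_frac x (predC1 l)) (x l).
Proof.
apply: (@transc_frac _ (laur coef_laur x (predC1 l))) => //.
  exact: laur_subring.
move=> f /Cf_clear[q [Cq q0 Lq]]; exists q; split=> //.
exact: laur_const.
Qed.

Let Bdiag k : gB s k k = 0. Proof. by apply: sss_diag; apply: tsss_sss. Qed.
Let B'E : gB s' = mx_word B w. Proof. by rewrite gB_word sB. Qed.

Let runit_k i : runit coef_laur (gk s i).
Proof. by split=> //; [apply: laur_var | apply: laur_inv]. Qed.

Let Cgk' i : coef_frac (gk s' i).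
Proof.
apply: Cf_sub; suff : runit coef_laur (gk s' i) by case.
rewrite /s'; elim/last_ind: (w) i => [|w' k IH] i; first exact: runit_k.
rewrite /gword foldl_rcons; apply: runit_gk_mut => //.
exact: runit1.
Qed.

(** The exponents are already opposite by [wB], so one ratio of exchange binomials suffices
    ([hat_inv]). *)
Lemma hat_inverse k : ghat s' (sigma k) = (ghat s k)^-1.
Proof.
have [l lk Blk] := col_neq0 k; rewrite -sB in Blk.
have B'diag : gB s' (sigma k) (sigma k) = 0 by rewrite B'E wB -sB Bdiag oppr0.
have Ck i : coef_frac (gk s i) by apply: Cf_sub; case: (runit_k i).
have cP i : coef_frac (c i) /\ c i != 0.
  split; first by apply: Cf_sub; apply: ratio_const.
  rewrite mulf_neq0 ?invr_eq0 //.
  by have [] := gpos_neq0 pQ ps'.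
have xc i : gx s' (sigma i) = c i * gx s i by rewrite divfK.
have EB i : gB s' (sigma i) (sigma k) = - gB s i k by rewrite B'E wB sB.
have C1 : coef_frac 1 by apply: sr1.
suff H : laur coef_frac x (predC1 k)
    ((1 + ghat s' (sigma k)) / (1 + ghat s k)).
  exact: (hat_inv sCf CfV pQ ps ps' Ck Cgk' cP xc tr Blk H EB).
apply: (mut_ratio (sigma := sigma) (mu := gk s k) (mu' := 1) sCf CfV pQ ps ps'
  Ck Cgk' (Bdiag k) B'diag cP xc tr (Ck k) C1 (k0 k) (oner_neq0 _)).
(* Mutation of [sR] at [k] with scalar 1 gives back [s], so the variable to be expanded is reached
   from [sR] by a word and the Laurent phenomenon applies to it. *)
set sR := gmut (gk s k) k s.
have pR : gpos Q sR by apply: gmut_pos => //; case: ps.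
have E : gmut 1 (sigma k) s' = gword sR (k :: rcons w (sigma k)).
  by rewrite gword_cons (gmutK pQ ps) // /gword foldl_rcons.
rewrite E.
have tR : totally_sign_skew_symmetric (gB sR) by apply: tsss_mut.
have := laurent_phenomenon (k :: rcons w (sigma k)) (sigma k) pQ pR tR.
have sL : subring (laur coef_frac (gx sR) predT) by apply: laur_subring.
apply: laur_min => //.
  by move=> a Za; apply: laur_const; apply: Cf_sub; apply: laur_const.
case=> i _; rewrite /gvar.
  by split; [apply: laur_var | apply: laur_inv].
have [Lk LVk _] : runit coef_laur (gk sR i) by apply: runit_gk_mut.
by split; apply: laur_const; apply: Cf_sub.
Qed.

(** Cluster variables get the value 0 and the coefficient of index [i] the value ['X^i]; hence
    [ghat s i] has value ['X^i] whatever the exchange matrix. *)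
Let theta (k : 'X_{1..n + n}) : trop := \sum_(i < n) 'X^i *+ k (rshift n i).

(** Both determinants start at 1 and are multiplied by -1 at each letter of [w]. Up to [sigma], the
    cluster ends at the identity and the [ghat] at minus the identity, so the same sign equals 1 and
    (-1)^n. *)
Lemma free_sign_obstruction : ~~ odd n.
Proof.
have thM k k' : theta (k + k')%MM = (theta k * theta k')%g.
  transitivity (\sum_(i < n) ('X^i *+ k (rshift n i) + 'X^i *+ k' (rshift n i))
    : {poly int}); last exact: big_split.
  by apply: eq_bigr => i _; rewrite mnmDE mulrnDr.
pose g (i : 'I_n) : {poly int} := 'X^i.
have det_g : \det (coef_mx g) = 1.
  rewrite (_ : coef_mx g = 1%:M) ?det1 //; apply/matrixP => i j.
  by rewrite !mxE coefXn eq_sym.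
have ek i : ev (mmap1 v) theta (gk s i) (g i).
  have -> : g i = theta U_(rshift n i)%MM.
    rewrite /theta (bigD1 i) //= mnm1E eqxx mulr1n big1 ?addr0 // => j ji.
    by rewrite mnm1E eq_rshift eq_sym (negbTE ji) mulr0n.
  by rewrite kE; apply: ev_base.
have ex i : ev (mmap1 v) theta (x i) (0 : {poly int}).
  have -> : 0 = theta U_(lshift n i)%MM :> {poly int}.
    by rewrite /theta big1 // => j _; rewrite mnm1E eq_lrshift mulr0n.
  by rewrite xE; apply: ev_base.
have eh i : ev (mmap1 v) theta (ghat s i) (g i).
  have -> : g i = g i + tlin (fun=> 0) (fun l => gB s l i).
    by rewrite /tlin big1 ?addr0 // => j _; rewrite mul0rz.
  apply: ev_tropM => //.
  exact: (ev_trop_mon 0%MM eM thM e_inj).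
have hE i : hword g B w (sigma i) = (-1) *: 'X^i.
  have E1 := ev_gword_hat 0%MM eM thM e_inj w pQ ps tsB eh (sigma i).
  rewrite sB in E1.
  have E2 := ev_tropV (eh i); rewrite -hat_inverse in E2.
  by rewrite (ev_fun eM thM e_inj E1 E2) scaleN1r.
have tE i : tword g B w (sigma i) = 1 *: 'X^i by rewrite wT scale1r.
have := det_coef_perm hE; have := det_coef_perm tE.
rewrite det_hword det_tword // det_g expr1n => -> H.
by apply/negP => n_odd; move: H; rewrite -signr_odd n_odd.
Qed.

End FreeSeed.

Theorem sign_obstruction (B : 'M[int]_n) (w : seq 'I_n) (sigma : 'S_n) :
  totally_sign_skew_symmetric B ->
  (forall k, exists2 l, l != k & B l k != 0) ->
  (forall i k, mx_word B w (sigma i) (sigma k) = - B i k) ->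
  (forall (g : 'I_n -> {poly int}) j, tword g B w (sigma j) = g j) -> ~~ odd n.
Proof.
move=> tB col wB wT.
apply: (free_sign_obstruction tB col wB wT (@std_free n) (std_pos_field n)
  (std_gpos B)) => // i; exact: ffunE.
Qed.

End SignObstruction.

(** * Seeds of a cluster pattern *)

Lemma seed_ext (P : semifieldType) (F : fieldType) n (s s' : seed P F n) :
  xs s =1 xs s' -> ys s =1 ys s' -> bmx s =2 bmx s' -> s = s'.
Proof.
case: s s' => [x y B] [x' y' B'] /= ex ey eB.
by congr Seed; [apply/ffunP | apply/ffunP | apply/matrixP].
Qed.

Section Pattern.

Variables (P : semifieldType) (QP F : fieldType) (iota : P -> QP).
Variables (phi : {rmorphism QP -> F}) (n : nat) (S : tree n -> seed P F n).
Hypotheses (hQP : is_QP iota) (hS : cluster_pattern iota phi S).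

Definition pcoef (p : P) : F := phi (iota p).

Lemma pcoef1 : pcoef 1%g = 1.
Proof. by rewrite /pcoef (QP_one hQP) rmorph1. Qed.

Lemma pcoefM p q : pcoef (p * q)%g = pcoef p * pcoef q.
Proof. by rewrite /pcoef (QP_mul hQP) rmorphM. Qed.

Lemma pcoef_neq0 p : pcoef p != 0.
Proof.
apply/eqP => p0; have := pcoefM p p^-1%g; rewrite mulgV pcoef1 p0 mul0r.
by move/eqP; rewrite oner_eq0.
Qed.

Lemma pcoefV p : pcoef p^-1%g = (pcoef p)^-1.
Proof.
by apply: (mulfI (pcoef_neq0 p)); rewrite -pcoefM mulgV pcoef1 mulfV ?pcoef_neq0.
Qed.

Lemma pcoefZ p (m : int) : pcoef (zexpg p m) = pcoef p ^ m.
Proof.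
have E k : pcoef (p ^+ k)%g = pcoef p ^+ k.
  by elim: k => [|k IH]; rewrite ?expg0 ?pcoef1 // expgS exprS pcoefM IH.
by case: m => m //=; rewrite pcoefV E NegzE -exprnN.
Qed.

Lemma pcoef_inj : injective pcoef.
Proof.
move=> p q /fmorph_inj E.
have : perm_eq [:: p] [:: q] by apply: (iota_sum_inj hQP); rewrite !big_seq1.
by move/perm_mem/(_ p); rewrite !inE eqxx => /esym/eqP.
Qed.

Lemma img_pcoef p : img phi (pcoef p).
Proof. by exists (iota p). Qed.

Definition embed (s : seed P F n) : gseed F n :=
  GSeed (xs s) [ffun i => pcoef (ys s i)] (bmx s).

Definition smut := seed_mut (n := n) pcoef.

Lemma embed_mut k s :
  embed (smut k s) = gmut (pcoef (oplus (ys s k) 1%g)) k (embed s).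
Proof.
apply: gseed_eq => // i; rewrite !ffunE /= ?ffunE //.
by case: eqP => _; rewrite ?pcoefV // !pcoefM !pcoefZ.
Qed.

Lemma neighbor t k : exists t' : tree n, S t' = smut k (S t).
Proof.
suff [t' E] : exists t', tree_edge k t t' by exists t'; apply: hS.2.
case: t => [[|a w] sw].
  by exists (@TreeVertex n [:: k] isT); left.
have [E|ka] := eqVneq k a.
  by exists (TreeVertex (path_sorted sw)); right; rewrite /= E.
have sw' : sorted (fun i j => i != j) [:: k, a & w] by rewrite /= ka.
by exists (TreeVertex sw'); left.
Qed.

Definition swalk (s : seed P F n) w := foldl (fun s k => smut k s) s w.

Let root : tree n := @TreeVertex n [::] isT.

Lemma swalk_connect t t' : exists w, S t' = swalk (S t) w.
Proof.
have [w1 E1] : exists w, S root = swalk (S t) w.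
  case: t => w; elim: w => [|k w IH] sw.
    by exists [::]; rewrite (bool_irrelevance sw isT).
  have [w' Ew'] := IH (path_sorted sw).
  exists (k :: w'); rewrite Ew' /=; congr swalk.
  by apply: hS.2; right.
have [w2 E2] : exists w, S t' = swalk (S root) w.
  case: t' => w; elim: w => [|k w IH] sw.
    by exists [::]; rewrite (bool_irrelevance sw isT).
  have [w' Ew'] := IH (path_sorted sw).
  exists (rcons w' k); rewrite /swalk foldl_rcons -/(swalk _ _) -Ew'.
  by apply: hS.2; left.
by exists (w1 ++ w2); rewrite E2 E1 /swalk foldl_cat.
Qed.

Lemma bmx_walk s w : bmx (swalk s w) = mx_word (bmx s) w.
Proof. by elim: w s => //= k w IH s; rewrite IH. Qed.

Local Notation x t := (xs (S t)).
Local Notation B t := (bmx (S t)).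

Lemma pattern_free t : free_over phi (x t).
Proof. by have [[]] := hS.1 t. Qed.

Lemma pattern_tsss t : totally_sign_skew_symmetric (B t).
Proof. by have [] := hS.1 t. Qed.

Let Bdiag t k : B t k k = 0.
Proof. by apply: sss_diag; apply: tsss_sss; apply: pattern_tsss. Qed.

Local Notation C := (img phi).
Let sC : subring C := img_subring phi.
Let CV f : C f -> C f^-1. Proof. exact: img_inv. Qed.

Lemma pattern_transc t l : transc (laur C (x t) (predC1 l)) (x t l).
Proof. exact: (@free_transc _ _ phi n (x t) l (@pattern_free t)). Qed.

Let tinj t := term_inj hQP (@pattern_free t).
Let tM t := termM hQP phi (x t).

Lemma pcoef_term t p : pcoef p = term iota phi (x t) (p, 0%MM).
Proof. by rewrite /term mmap11 mulr1. Qed.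

Lemma var_term t i : x t i = term iota phi (x t) (1%g, U_(i)%MM).
Proof. by rewrite /term -/(pcoef _) pcoef1 mul1r mmap1U. Qed.

Definition ppos t f := exists a, ev (term iota phi (x t)) (fun=> 0 : trop) f a.

Lemma ppos_field t : pos_field (ppos t).
Proof.
apply: (@ev_pos_field _ trop _ _ _ (fun=> 0 : trop) (tM t) _ (@tinj t)).
  by move=> _ _; rewrite [RHS]addr0.
exact: (1%g, 0%MM).
Qed.

Lemma ppos_pcoef t p : ppos t (pcoef p).
Proof. by exists (0 : trop); rewrite (pcoef_term t); apply: ev_base. Qed.

Lemma ppos_walk t w : gpos (ppos t) (embed (swalk (S t) w)).
Proof.
elim/last_ind: w => [|w k IH].
  split=> i; last by rewrite ffunE; apply: ppos_pcoef.
  by exists (0 : trop); rewrite /= var_term; apply: ev_base.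
rewrite /swalk foldl_rcons -/(swalk _ _) embed_mut.
by apply: gmut_pos => //; [apply: ppos_field | apply: ppos_pcoef].
Qed.

Lemma ppos_vertex t t' : gpos (ppos t) (embed (S t')).
Proof. by have [w ->] := swalk_connect t t'; apply: ppos_walk. Qed.

(** The unnormalized walk is a rescaling of the pattern by constants, so its Laurent expansions
    transfer. *)
Lemma pattern_laurent t t' j : laur C (x t) predT (x t' j).
Proof.
have [w E] := swalk_connect t t'; rewrite E.
set s := embed (S t); have ps : gpos (ppos t) s by apply: ppos_vertex.
have pQ := ppos_field t.
have : rescaled C (gword s w) (embed (swalk (S t) w)).
  elim/last_ind: w {E} => [|w k IH].
    split=> //; exists (fun=> 1); split=> i; last by rewrite mul1r.
    by rewrite oner_eq0; split=> //; apply: sr1.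
  rewrite /swalk foldl_rcons -/(swalk _ _) embed_mut.
  rewrite /gword foldl_rcons -/(gword _ _).
  apply: (rescaled_mut sC CV pQ) IH.
  - exact: gword_pos.
  - exact: ppos_walk.
  - rewrite gB_word; apply: sss_diag; apply: tsss_sss; apply: tsss_word.
    exact: pattern_tsss.
  - exact: img_pcoef.
  - exact: ppos_pcoef.
move=> [_ _ [lam [Clam Ex]]].
have -> : xs (swalk (S t) w) j = lam j * gx (gword s w) j by apply: Ex.
have sL : subring (laur C (xs (S t)) predT) by apply: laur_subring.
apply: srM => //; first by apply: laur_const; case: (Clam j).
have := laurent_phenomenon w j pQ ps (pattern_tsss t).
apply: laur_min => //.
  by move=> _ [z ->]; apply: laur_const; exists z%:~R; rewrite rmorph_int.
case=> i _; rewrite /gvar; first by split; [apply: laur_var | apply: laur_inv].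
by rewrite ffunE; split; apply: laur_const; [|apply: CV]; apply: img_pcoef.
Qed.

(** With all [x t i] sent to 1, an exchange relation evaluates to the quotient of y_k ⊕ 1 by itself:
    the normalization keeps the value 1. *)
Lemma pattern_ev1 t t' j :
  ev (term iota phi (x t)) (fun u : P * 'X_{1..n} => u.1) (x t' j) 1%g.
Proof.
have thM (u v : P * 'X_{1..n}) : (term_mul u v).1 = (u.1 * v.1)%g by [].
have e1 := ev1 (tM t) thM (@tinj t) (1%g, 0%MM).
have ec p : ev (term iota phi (x t)) (fun u => u.1) (pcoef p) p.
  by rewrite (pcoef_term t); apply: (ev_base _ _ (p, 0%MM)).
have [w E] := swalk_connect t t'; rewrite E {E}.
elim/last_ind: w j => [|w k IH] j.
  by rewrite /= var_term; apply: (ev_base _ _ (1%g, U_(j)%MM)).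
rewrite /swalk foldl_rcons -/(swalk _ _) ffunE; case: eqP => // _.
set s := swalk (S t) w in IH *; set q := ys s k.
have em (c : 'I_n -> int) :
    ev (term iota phi (x t)) (fun u => u.1) (\prod_i xs s i ^ c i) 1%g.
  apply: (big_ind (fun f => ev _ _ f 1%g)) => //.
    by move=> f g ef eg; rewrite -(mulg1 1%g); apply: ev_mul.
  move=> i _; have -> : 1%g = zexpg 1%g (c i) :> P.
    by case: (c i) => m /=; rewrite expg1n ?invg1.
  exact: (ev_exprz (tM t) thM (@tinj t) (1%g, 0%MM)).
have E1 : (oplus (q * 1) 1 * (oplus q 1 * 1)^-1)%g = 1%g :> P.
  by rewrite !mulg1 mulgV.
rewrite -[X in ev _ _ _ X]E1; apply: ev_mul; last first.
  by apply: ev_inv; apply: ev_mul; [apply: ec | apply: IH].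
by apply: ev_add; [apply: ev_mul; [apply: ec | apply: em] | apply: em].
Qed.

(** Coefficients are sent to 0 and [x t i] to an arbitrary [g i], so the outcome no longer refers to
    [P] and can be used for independent coefficients. *)
Lemma pattern_tropical t w (sigma : 'S_n) :
  (forall j, xs (swalk (S t) w) (sigma j) = x t j) ->
  forall (g : 'I_n -> {poly int}) j, tword g (B t) w (sigma j) = g j.
Proof.
move=> E g j.
pose th (u : P * 'X_{1..n}) : trop := \sum_i g i *+ u.2 i.
have thM u v : th (term_mul u v) = (th u * th v)%g.
  transitivity (\sum_i (g i *+ u.2 i + g i *+ v.2 i)); last exact: big_split.
  by apply: eq_bigr => i _; rewrite mnmDE mulrnDr.
have ec p : ev (term iota phi (x t)) th (pcoef p) (0 : {poly int}).
  have -> : 0 = th (p, 0%MM) :> {poly int}.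
    by rewrite /th big1 // => i _; rewrite mnm0E mulr0n.
  by rewrite (pcoef_term t); apply: ev_base.
have ex i : ev (term iota phi (x t)) th (x t i) (g i).
  have -> : g i = th (1%g, U_(i)%MM).
    rewrite /th (bigD1 i) //= mnm1E eqxx mulr1n big1 ?addr0 // => l li.
    by rewrite mnm1E eq_sym (negbTE li) mulr0n.
  by rewrite var_term; apply: ev_base.
have ew : (forall i, ev (term iota phi (x t)) th (xs (swalk (S t) w) i)
    (tword g (B t) w i)).
  elim/last_ind: (w) => [|w' k IH] //.
  rewrite tword_rcons /swalk foldl_rcons -/(swalk _ _) => i.
  have ek l : ev (term iota phi (x t)) th (gk (embed (swalk (S t) w')) l)
      (0 : {poly int}) by rewrite ffunE; apply: ec.
  have ex' l : ev (term iota phi (x t)) th (gx (embed (swalk (S t) w')) l)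
      (tword g (B t) w' l) by apply: IH.
  have [H _] := ev_gmut_trop (1%g, 0%MM) (tM t) thM (@tinj t) k ex' ek
    (ec (oplus (ys (swalk (S t) w') k) 1%g)).
  by move: (H i); rewrite -embed_mut /= bmx_walk.
by apply: (ev_fun (tM t) thM (@tinj t) _ (ex j)); rewrite -E.
Qed.

(** Otherwise the square of [x t k] would equal the exchange polynomial up to a constant, which is
    free of [x t k]. *)
Lemma mut_neq t t' k : S t' = smut k (S t) -> x t' k <> x t k.
Proof.
move=> E Ex; have pQ := ppos_field t; have ps := ppos_vertex t t.
have [x0 k0] := gpos_neq0 pQ ps.
have sA := laur_subring (x t) (predC1 k) sC; have tt := @pattern_transc t k.
set mu := pcoef (oplus (ys (S t) k) 1%g).
pose N := (1 + ghat (embed (S t)) k) * mon (x t) (negexp (B t) k) / mu.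
have zE : x t' k = N / x t k.
  have -> : x t' k = gx (embed (S t')) k by [].
  by rewrite E embed_mut gx_mut // -/mu invfM mulrA.
have AN : laur C (x t) (predC1 k) N.
  have Am f : f k = 0 -> laur C (x t) (predC1 k) (mon (x t) f).
    by move=> fk; apply: mon_laur => // i; rewrite /= negbK => /eqP ->.
  apply: srM => //; last by apply: laur_const; apply: CV; apply: img_pcoef.
  apply: srM => //; last by apply: Am; rewrite /negexp Bdiag oppr0 pospart0.
  apply: srD => //; first exact: sr1.
  apply: srM => //; last by apply: Am; rewrite Bdiag.
  by rewrite ffunE; apply: laur_const; apply: img_pcoef.
have /(congr1 (fun p : {poly F} => p`_2)) : 'X^2 - N%:P = 0.
  apply: tt; last by rewrite !hornerE expr2 -{1}Ex zE divfK ?subrr.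
  by apply: overD => //; [apply: overXn | apply: overN => //; apply: overC].
by rewrite coefB coefXn coefC coef0 subr0 => /eqP; rewrite oner_eq0.
Qed.

Section Compare.

Variables (t t' : tree n) (sigma : 'S_n) (c : 'I_n -> F).
Hypothesis Cc : forall i, C (c i) /\ c i != 0.
Hypothesis xc : forall i, x t' (sigma i) = c i * x t i.
Hypothesis col_neq0 : forall k, exists2 l, l != k & B t l k != 0.

Let s := embed (S t).
Let s' := embed (S t').
Let pQ := ppos_field t.
Let ps : gpos (ppos t) s := ppos_vertex t t.
Let ps' : gpos (ppos t) s' := ppos_vertex t t'.
Let Ck i : C (gk s i). Proof. by rewrite ffunE; apply: img_pcoef. Qed.
Let Ck' i : C (gk s' i). Proof. by rewrite ffunE; apply: img_pcoef. Qed.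

Lemma compare_hat k :
  ghat s' (sigma k) = ghat s k \/ ghat s' (sigma k) = (ghat s k)^-1.
Proof.
have [l lk blk] := col_neq0 k.
have [t1 E1] := neighbor t k; have [t2 E2] := neighbor t' (sigma k).
have Cmu p : C (pcoef p) := img_pcoef p.
have H1 : laur C (x t) (predC1 k) ((1 + ghat s' (sigma k)) / (1 + ghat s k)).
  apply: (mut_ratio (sigma := sigma) (c := c) sC CV pQ ps ps' Ck Ck' _ _ Cc xc
    (@pattern_transc t) (Cmu (oplus (ys (S t) k) 1%g))
    (Cmu (oplus (ys (S t') (sigma k)) 1%g)) (pcoef_neq0 _) (pcoef_neq0 _)).
  - exact: Bdiag.
  - exact: Bdiag.
  - by rewrite -!embed_mut -E1 -E2; apply: pattern_laurent.
(* The roles of [t] and [t'] are exchanged, with the inverse permutation and inverse constants; the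
   two Laurent rings agree because the variables are proportional. *)
have H2 : laur C (x t) (predC1 k) ((1 + ghat s k) / (1 + ghat s' (sigma k))).
  pose c' i := (c ((sigma^-1)%g i))^-1.
  have Cc' i : C (c' i) /\ c' i != 0.
    by rewrite invr_eq0; have [Ci ci0] := Cc ((sigma^-1)%g i); split=> //; apply: CV.
  have xc' i : x t ((sigma^-1)%g i) = c' i * x t' i.
    rewrite -{3}[i](permKV sigma) xc mulKf //.
    by case: (Cc ((sigma^-1)%g i)).
  have H : laur C (x t') (predC1 (sigma k))
      ((1 + ghat s ((sigma^-1)%g (sigma k))) / (1 + ghat s' (sigma k))).
    apply: (mut_ratio (sigma := (sigma^-1)%g) (c := c') sC CV pQ ps' ps Ck' Ck
      _ _ Cc' xc' (@pattern_transc t')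
      (Cmu (oplus (ys (S t') (sigma k)) 1%g))
      (Cmu (oplus (ys (S t) ((sigma^-1)%g (sigma k))) 1%g))
      (pcoef_neq0 _) (pcoef_neq0 _)).
    - exact: Bdiag.
    - exact: Bdiag.
    - by rewrite -!embed_mut permK -E1 -E2; apply: pattern_laurent.
  rewrite permK in H; move: H; apply: laur_min; first exact: laur_subring.
    by move=> a Ca; apply: laur_const.
  move=> i /= ik; rewrite -[i](permKV sigma) xc.
  have jk : (sigma^-1)%g i != k by apply: contraNneq ik => <-; rewrite permKV.
  have [Ci _] := Cc ((sigma^-1)%g i); rewrite invfM; split; apply: laur_mul.
  - exact: laur_const.
  - exact: laur_var.
  - by apply: laur_const; apply: CV.
  - exact: laur_inv.
apply: (hat_eq_or_inv (c := c) sC CV pQ ps ps' Ck Ck' Cc xc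
  (@pattern_transc t) blk H1 H2).
Qed.

(** Monomials in free variables are independent, so exponents and constants of [ghat] compare
    separately. The factors [c] are kept because they later exhibit a power of a unit as a
    coefficient. *)
Lemma compare_column k :
  ((forall i, B t' (sigma i) (sigma k) = B t i k) /\
   pcoef (ys (S t') (sigma k)) * mon c (fun i => B t' (sigma i) (sigma k)) =
   pcoef (ys (S t) k)) \/
  ((forall i, B t' (sigma i) (sigma k) = - B t i k) /\
   pcoef (ys (S t') (sigma k)) * mon c (fun i => B t' (sigma i) (sigma k)) =
   (pcoef (ys (S t) k))^-1).
Proof.
have c0 i : c i != 0 by case: (Cc i).
have h'E : ghat s' (sigma k) = pcoef (ys (S t') (sigma k)) *
    mon c (fun i => B t' (sigma i) (sigma k)) *
    mon (x t) (fun i => B t' (sigma i) (sigma k)).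
  rewrite /ghat ffunE (mon_perm _ _ sigma) -mulrA -monM; congr (_ * _).
  by apply: eq_bigr => i _; rewrite -xc.
have Ca : C (pcoef (ys (S t') (sigma k)) *
    mon c (fun i => B t' (sigma i) (sigma k))).
  apply: srM => //; first exact: img_pcoef.
  apply: sr_prod => // i _; apply: sr_exprz => //; first by case: (Cc i).
  by apply: CV; case: (Cc i).
have a0 : pcoef (ys (S t') (sigma k)) *
    mon c (fun i => B t' (sigma i) (sigma k)) != 0.
  by rewrite mulf_neq0 ?pcoef_neq0 // mon_neq0.
have [] := compare_hat k; rewrite h'E /ghat ffunE => E.
  left; have [] := mon_indep sC (@pattern_transc t) Ca (img_pcoef _) a0
    (pcoef_neq0 _) E.
  by [].
right; rewrite invfM -monN in E.
have b0 : (pcoef (ys (S t) k))^-1 != 0 by rewrite invr_eq0 pcoef_neq0.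
by have [] := mon_indep sC (@pattern_transc t) Ca (CV (img_pcoef _)) a0 b0 E.
Qed.

End Compare.

Hypothesis hB : forall t, indecomposable (bmx (S t)).

(** A zero column is also a zero row and would split off [k] from a nonempty complement. *)
Lemma column_neq0 t k : (1 < n)%N -> exists2 l, l != k & B t l k != 0.
Proof.
move=> n1; have sB := tsss_sss (pattern_tsss t).
case: (boolP [exists l, (l != k) && (B t l k != 0)]).
  by case/existsP=> l /andP[]; exists l.
move=> /existsPn none; case: (hB (t := t)); exists [set k], (~: [set k]).
have zero l : l != k -> B t l k = 0.
  by move=> lk; have := none l; rewrite lk /= negbK => /eqP.
split.
- exact: setUCr.
- by rewrite -setI_eq0 setICr.
- by apply/set0Pn; exists k; rewrite inE.
- rewrite -card_gt0 cardsC1 card_ord -subn1 subn_gt0 //.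
- move=> i j; rewrite !inE => /eqP -> jk; have z := zero _ jk.
  by split=> //; apply: sss_eq0 z.
Qed.

Lemma cluster_determines_seed (sigma : 'S_n) t t' : odd n -> (1 < n)%N ->
  (forall i, x t' (sigma i) = x t i) -> S t = seed_perm sigma (S t').
Proof.
move=> n_odd n1 xE; have col k := column_neq0 t k n1.
pose c (i : 'I_n) : F := 1.
have Cc i : C (c i) /\ c i != 0.
  by rewrite oner_eq0; split=> //; apply: sr1.
have xc i : x t' (sigma i) = c i * x t i by rewrite mul1r xE.
have cmp k := compare_column Cc xc col k.
have mon1 e : mon c e = 1 by apply: big1 => i _; rewrite exp1rz.
pose I := [set k | [forall i, B t' (sigma i) (sigma k) == B t i k]].
have inI k : k \in I -> forall i, B t' (sigma i) (sigma k) = B t i k.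
  by rewrite inE => /forallP H i; apply/eqP.
have notI k : k \notin I -> forall i, B t' (sigma i) (sigma k) = - B t i k.
  case: (cmp k) => -[E _] //; case/negP; rewrite inE.
  by apply/forallP => i; rewrite E.
have [IT|InT] := eqVneq I [set: 'I_n].
  have EB i j : B t' (sigma i) (sigma j) = B t i j by apply: inI; rewrite IT inE.
  apply: seed_ext => [i|k|i j]; rewrite ?ffunE ?mxE; last by rewrite EB.
    by rewrite xE.
  case: (cmp k) => -[E]; first by rewrite mon1 mulr1 => /pcoef_inj.
  have [l _ /eqP[]] := col k; move: (E l); rewrite EB; lia.
(* All columns are reversed; this is the case where the parity of [n] enters. *)
have [I0|In0] := eqVneq I set0.
  have [w Ew] := swalk_connect t t'.
  have wB i k : mx_word (B t) w (sigma i) (sigma k) = - B t i k.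
    by rewrite -bmx_walk -Ew; apply: notI; rewrite I0 inE.
  have wx j : xs (swalk (S t) w) (sigma j) = x t j by rewrite -Ew -xE.
  have := sign_obstruction (@pattern_tsss t) col wB (pattern_tropical wx).
  by rewrite n_odd.
case: (hB (t := t)); exists I, (~: I); split.
- exact: setUCr.
- by rewrite -setI_eq0 setICr.
- by [].
- by apply: contraNneq InT => E; rewrite -[I]setCK E setC0.
(* One of the two entries at [i], [j] keeps its sign and the other changes it, so their product and
   its opposite are both nonpositive; it vanishes, and [I] is cut off from its complement. *)
- move=> i j iI; rewrite inE => jI.
  have E1 := notI _ jI i; have E2 := inI _ iI j.
  have [H1 H2] := tsss_sss (@pattern_tsss t) i j.
  have [H3 _] := tsss_sss (@pattern_tsss t') (sigma i) (sigma j).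
  by apply: H2; rewrite E1 E2 in H3; lia.
Qed.

End Pattern.

(** * Adjacent clusters *)

Lemma binomial_not_unit (F : fieldType) (A : F -> Prop) t a rho (b e : int) :
  subring A -> transc A t -> A a -> A rho -> a != 0 -> rho != 0 -> b != 0 ->
  1 + a * t ^ b <> rho * t ^ e.
Proof.
move=> sA tt Aa Arho a0 rho0 b0; have t0 := transc_neq0 sA tt.
have [m [s [c0 -> _]]] := binomial_normal a t0 b0.
set u := (if s then 1 else a); set v := (if s then a else 1) => E.
have u0 : u != 0 by rewrite /u; case: (s); rewrite ?oner_eq0.
have v0 : v != 0 by rewrite /v; case: (s); rewrite ?oner_eq0.
have Au : A u by rewrite /u; case: (s) => //; apply: sr1.
have Av : A v by rewrite /v; case: (s) => //; apply: sr1.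
have [_] : m = e /\ u%:P + v%:P * 'X^`|b| = rho%:P.
  apply: (lpoly_normal_uniq sA tt).
  - exact: over_binomial.
  - exact: overC.
  - by rewrite coef_binomial.
  - by rewrite coefC.
  - by rewrite E hornerC mulrC.
move/(congr1 (fun p : {poly F} => size p)); rewrite size_binomial //.
by rewrite size_polyC rho0; case: absz c0.
Qed.

Lemma cluster_eq (P : semifieldType) (F : fieldType) n (s s' : seed P F n)
    (sigma : 'S_n) :
  (forall i, xs s' i = xs s (sigma i)) -> cluster s' = cluster s.
Proof.
move=> E; apply/fsetP => f; apply/imfsetP/imfsetP => -[i _ ->].
  by exists (sigma i).
by exists ((sigma^-1)%g i) => //; rewrite E permKV.
Qed.

Lemma seed_mut_perm (P : semifieldType) (F : fieldType) (e : P -> F) n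
    (s : seed P F n) (sigma : 'S_n) k i :
  xs (seed_mut e k (seed_perm sigma s)) i = xs (seed_mut e (sigma k) s) (sigma i).
Proof.
rewrite !ffunE /= (inj_eq perm_inj); case: eqP => _ //.
congr ((_ * _ + _) / _); rewrite [RHS](reindex_inj (@perm_inj _ sigma)).
  by apply: eq_bigr => j _; rewrite ffunE mxE.
by apply: eq_bigr => j _; rewrite ffunE mxE.
Qed.

Lemma seed_perm1 (P : semifieldType) (F : fieldType) n (s : seed P F n) :
  seed_perm 1 s = s.
Proof. by apply: seed_ext => [i|i|i j]; rewrite ?ffunE ?mxE !perm1. Qed.

Section Adjacency.

Variables (P : semifieldType) (QP F : fieldType) (iota : P -> QP).
Variables (phi : {rmorphism QP -> F}) (n : nat) (S : tree n -> seed P F n).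
Hypotheses (hQP : is_QP iota) (hS : cluster_pattern iota phi S).
Hypothesis hB : forall t, indecomposable (bmx (S t)).

Local Notation x t := (xs (S t)).
Local Notation C := (img phi).
Local Notation A t k := (laur C (x t) (predC1 k)).
Local Notation hat t k := (ghat (embed iota phi (S t)) k).

Let sC : subring C := img_subring phi.
Let CV f : C f -> C f^-1. Proof. exact: img_inv. Qed.
Let sA t k : subring (A t k). Proof. exact: laur_subring. Qed.
Let tr t k : transc (A t k) (x t k). Proof. exact: (pattern_transc hS). Qed.
Let x0 t k : x t k != 0. Proof. exact: transc_neq0 (@tr t k). Qed.

Let Bdiag t k : bmx (S t) k k = 0.
Proof. by apply: sss_diag; apply: tsss_sss; apply: (pattern_tsss hS). Qed.

Let runit_x t k i : i != k -> runit (A t k) (x t i).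
Proof. by move=> ik; split=> //; [apply: laur_var | apply: laur_inv]. Qed.

Let runit_hat t k : runit (A t k) (hat t k).
Proof.
apply: runitM => //.
  rewrite ffunE; split; first by apply: laur_const; apply: img_pcoef.
    by apply: laur_const; apply: CV; apply: img_pcoef.
  exact: (pcoef_neq0 phi hQP).
apply: runit_mon => // i ik; apply: runit_x.
by apply: contraNneq ik => ->; rewrite Bdiag.
Qed.

Let hat1_neq0 t k : 1 + hat t k != 0.
Proof.
exact: (ghat1_neq0 (ppos_field hQP hS t) k (ppos_vertex hQP hS t t)).
Qed.

Lemma exchange_relation t t1 k : S t1 = smut iota phi k (S t) ->
  (forall i, i != k -> x t1 i = x t i) /\
  exists2 m, runit (A t k) m & x t1 k = (1 + hat t k) * m / x t k.
Proof.
move=> E; split=> [i ik|]; first by rewrite E ffunE (negbTE ik).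
set mu := pcoef iota phi (oplus (ys (S t) k) 1%g).
exists (mon (x t) (negexp (bmx (S t)) k) / mu).
  apply: runitM => //.
    apply: runit_mon => // i ik; apply: runit_x.
    by apply: contraNneq ik => ->; rewrite /negexp Bdiag oppr0 pospart0.
  apply: runitV; split; first by apply: laur_const; apply: img_pcoef.
    by apply: laur_const; apply: CV; apply: img_pcoef.
  exact: (pcoef_neq0 phi hQP).
have -> : x t1 k = gx (embed iota phi (S t1)) k by [].
by rewrite E (embed_mut _ hQP) gx_mut //= -/mu invfM !mulrA.
Qed.

(** Some [x t l] occurs in [hat t j] with nonzero exponent; a unit would be a monomial in it, while
    [1 + hat t j] has two terms. *)
Lemma hat1_not_unit t j : (1 < n)%N -> ~ A t j (1 + hat t j)^-1.
Proof.
move=> n1 AV; have [l lj blj] := column_neq0 hS hB t j n1.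
have A1 := sr1 (sA t j); have [Ah _ _] := runit_hat t j.
have A1h : A t j (1 + hat t j) by apply: srD.
have L f : A t j f -> lpoly (A t l) (x t l) f.
  move=> Af; apply: laur_lpoly Af => // i _.
  by have [->|il] := eqVneq i l; [left | right].
have [e [rho [rho' [Arho _ E _ E1]]]] := lpoly_factor (sA t l) (@tr t l)
  (L _ A1h) (L _ AV) (sr1 (sA t l)) (oner_neq0 F) (mulfV (hat1_neq0 t j)).
have rho0 : rho != 0.
  by apply/eqP => r0; move/eqP: E1; rewrite r0 mul0r eq_sym oner_eq0.
pose a := pcoef iota phi (ys (S t) j) *
  mon (x t) (fun i => if i == l then 0 else bmx (S t) i j).
have [Aa _ a0] : runit (A t l) a.
  apply: runitM => //.
    split; first by apply: laur_const; apply: img_pcoef.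
      by apply: laur_const; apply: CV; apply: img_pcoef.
    exact: (pcoef_neq0 phi hQP).
  apply: runit_mon => // i; have [->|il _] := eqVneq i l; first by rewrite eqxx.
  exact: runit_x.
apply: (binomial_not_unit (e := e) (sA t l) (@tr t l) Aa Arho a0 rho0 blj).
rewrite -E /ghat ffunE (@mon_split _ _ (x t) (x t) l) //; congr (1 + _).
by rewrite /a; ring.
Qed.

(* If [e < 0], a Laurent expansion in the cluster obtained from [t] by the
   mutation at [j] would have a power of the exchange binomial in its
   denominator. *)
Lemma unit_exponent_ge0 t t' j k i rho (e : int) : (1 < n)%N -> k != j ->
  runit (A t j) rho -> rho * x t j ^ e * x t k = x t' i -> 0 <= e.
Proof.
move=> n1 kj urho E; rewrite leNgt; apply/negP => e_lt0.
have [t1 Et1] := neighbor hS t j.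
have [other [m um zE]] := exchange_relation Et1.
have [Am AVm m0] := um; have h0 := hat1_neq0 t j.
have A1 := sr1 (sA t j); have [Ah _ _] := runit_hat t j.
have A1h : A t j (1 + hat t j) by apply: srD.
set z := x t1 j in zE; pose N := (1 + hat t j) * m.
have N0 : N != 0 by rewrite mulf_neq0.
have AN : A t j N by apply: srM.
have tz : transc (A t j) z by rewrite zE; apply: transc_inv.
have z0 := transc_neq0 (sA t j) tz.
have Lf : lpoly (A t j) z (x t' i).
  have : laur C (x t1) predT (x t' i) by apply: (pattern_laurent hQP hS).
  move/(laur_lpoly sC (x0 t1 j)) => /(_ (predC1 j)) H.
  have {}H : lpoly (A t1 j) z (x t' i).
    by apply: H => l _; have [->|lj] := eqVneq l j; [left | right].
  apply: lpoly_sub H => f; apply: laur_min => //.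
    by move=> a Ca; apply: laur_const.
  move=> l /= lj; rewrite other //.
  by split; [apply: laur_var | apply: laur_inv].
have [d De] : exists d : nat, e = - d.+1%:Z.
  by case: (e) e_lt0 => // d _; exists d; rewrite NegzE.
have [_ AVrho rho0] := urho; have [_ AVk xk0] := runit_x t kj.
have sL := lpoly_subring z (sA t j).
have LN : lpoly (A t j) z (N ^+ d.+1)^-1.
  have -> : (N ^+ d.+1)^-1 = x t' i * rho^-1 * (x t k)^-1 * z^-1 ^+ d.+1.
    have -> : z^-1 = x t j * N^-1 by rewrite zE invf_div.
    rewrite -E De -exprnN (exprMn d.+1 (x t j) N^-1) [N^-1 ^+ _]exprVn.
    have Nd := expf_neq0 d.+1 N0; have xd := expf_neq0 d.+1 (x0 t j).
    by field; rewrite Nd xd rho0 xk0.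
  have LVz : lpoly (A t j) z z^-1 by apply: lpolyV.
  apply: srM => //; last exact: srX.
  by apply: srM => //; [apply: srM => // |]; apply: lpolyA.
have ANd : A t j (N ^+ d.+1)^-1.
  apply: (lpoly_div (sA t j) tz LN); first exact: (srX d.+1 (sA t j) AN).
    exact: expf_neq0.
  by rewrite mulfV ?expf_neq0 //; apply: sr1.
apply: (@hat1_not_unit t j n1).
have -> : (1 + hat t j)^-1 = m * (N ^+ d * (N ^+ d.+1)^-1).
  rewrite exprS invfM [N ^+ d * _]mulrCA mulfV ?expf_neq0 // mulr1.
  by rewrite /N invfM mulrCA mulfV // mulr1.
by apply: srM => //; apply: srM => //; apply: srX.
Qed.

(** In each other variable [x t j] the unit [u] is a monomial. Its exponent and the opposite one are
    both nonnegative, by [unit_exponent_ge0] applied in both directions, so no variable occurs. *)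
Lemma unit_ratio_const t t' (sigma : 'S_n) k u : (1 < n)%N ->
  (forall i, i != k -> x t' (sigma i) = x t i) -> runit (A t k) u ->
  x t' (sigma k) = u * x t k -> C u.
Proof.
move=> n1 xE [Au AVu u0] xk.
apply: (@laur_cap _ _ _ (x t) (enum 'I_n) u sC (@tr t)).
  by apply: laur_subset Au => // i _; rewrite /= mem_enum.
move=> j _; have [->//|jk] := eqVneq j k.
pose Rj := laur C (x t) [pred i | (i != k) && (i != j)].
have sRj : subring Rj by apply: laur_subring.
have Rj_sub f : Rj f -> A t j f.
  by apply: laur_subset => // i /= /andP[].
have tj : transc Rj (x t j) by apply: transc_sub (@tr t j).
have L f : A t k f -> lpoly Rj (x t j) f.
  move=> Af; apply: laur_lpoly Af => // i /= ik.
  by have [->|ij] := eqVneq i j; [left | right; rewrite /= ik].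
have [e [rho [rho' [Rrho Rrho' E E' E1]]]] := lpoly_factor sRj tj (L _ Au)
  (L _ AVu) (sr1 sRj) (oner_neq0 F) (mulfV u0).
have rho0 : rho != 0.
  by apply/eqP => r0; move/eqP: E1; rewrite r0 mul0r eq_sym oner_eq0.
have rho'E : rho' = rho^-1 by apply: (mulfI rho0); rewrite E1 mulfV.
suff e0 : e = 0 by rewrite E e0 expr0z mulr1; apply: Rj_sub.
have e_ge0 : 0 <= e.
  apply: (@unit_exponent_ge0 t t' j k (sigma k) rho e n1).
  - by rewrite eq_sym.
  - by split=> //; apply: Rj_sub; rewrite -?rho'E.
  - by rewrite -E xk.
have e_le0 : 0 <= - e.
  have skj : sigma k != sigma j by rewrite (inj_eq perm_inj) eq_sym.
  have Rj_sub' f : Rj f -> A t' (sigma j) f.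
    apply: laur_min => //; first by move=> a Ca; apply: laur_const.
    move=> i /= /andP[ik ij]; rewrite -xE //.
    have sij : sigma i != sigma j by rewrite (inj_eq perm_inj).
    by split; [apply: laur_var | apply: laur_inv].
  apply: (@unit_exponent_ge0 t' t (sigma j) (sigma k) k rho' _ n1) => //.
  - split; rewrite ?rho'E ?invr_eq0 ?invrK //; apply: Rj_sub' => //.
    by rewrite -rho'E.
  - by rewrite xE // -E' xk mulKf.
by apply/eqP; rewrite eq_le e_ge0 -oppr_ge0 e_le0.
Qed.

Lemma const_ratio_eq1 t t' (sigma : 'S_n) k u : (1 < n)%N ->
  (forall i, i != k -> x t' (sigma i) = x t i) -> C u ->
  x t' (sigma k) = u * x t k -> u = 1.
Proof.
move=> n1 xE Cu xk; pose c i := if i == k then u else 1.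
have u0 : u != 0.
  by apply/eqP => u0; have := x0 t' (sigma k); rewrite xk u0 mul0r eqxx.
have Cc i : C (c i) /\ c i != 0.
  by rewrite /c; case: ifP => _ //; rewrite oner_eq0; split=> //; apply: sr1.
have xc i : x t' (sigma i) = c i * x t i.
  by rewrite /c; case: eqP => [->//|/eqP ik]; rewrite mul1r xE.
have col j := column_neq0 hS hB t j n1.
have [l lk blk] := col k.
have bkl : bmx (S t) k l != 0.
  apply: contraNneq blk => b0.
  by rewrite (sss_eq0 (tsss_sss (pattern_tsss hS t)) b0).
have mc e : mon c e = u ^ e k.
  rewrite /mon (bigD1 k) //= /c eqxx big1 ?mulr1 // => i ik.
  by rewrite (negbTE ik) exp1rz.
(* Only index [k] has a factor other than 1, so comparing the coefficients of column [l] expresses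
   [u] to the power of a nonzero entry as an element of [P]. *)
have [m [m0 [p Ep]]] : exists m : int, m != 0 /\ exists p,
    u ^ m = pcoef iota phi p.
  set b := bmx (S t') (sigma k) (sigma l).
  have y0 := pcoef_neq0 phi hQP (ys (S t') (sigma l)).
  case: (compare_column hQP hS Cc xc col l) => -[EB]; rewrite mc -/b => E.
    exists b; rewrite /b EB; split=> //.
    exists ((ys (S t') (sigma l))^-1 * ys (S t) l)%g.
    by rewrite (pcoefM phi hQP) (pcoefV phi hQP) -E -/b -(EB k) mulKf.
  exists b; rewrite /b EB oppr_eq0; split=> //.
  exists ((ys (S t') (sigma l))^-1 * (ys (S t) l)^-1)%g.
  by rewrite (pcoefM phi hQP) !(pcoefV phi hQP) -E -/b -(EB k) mulKf.
have thM (a b : P * 'X_{1..n}) : (term_mul a b).1 = (a.1 * b.1)%g by [].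
have tM := termM hQP phi (x t).
have tinj := term_inj hQP (@pattern_free _ _ _ _ _ _ _ hS t).
have eu : ev (term iota phi (x t)) (fun a : P * 'X_{1..n} => a.1) u 1%g.
  have -> : u = x t' (sigma k) / x t k by rewrite xk mulfK.
  rewrite -(mulgV 1%g); apply: ev_mul; last apply: ev_inv.
    exact: (pattern_ev1 hQP hS).
  exact: (pattern_ev1 hQP hS).
have p1 : p = 1%g.
  have e1 : ev (term iota phi (x t)) (fun a : P * 'X_{1..n} => a.1) (u ^ m) p.
    rewrite Ep; have -> : pcoef iota phi p = term iota phi (x t) (p, 0%MM).
      by rewrite /term mmap11 mulr1.
    exact: (ev_base _ _ (p, 0%MM)).
  have := ev_exprz tM thM tinj (1%g, 0%MM) m eu.
  move/(ev_fun tM thM tinj e1) => ->.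
  by case: (m) => k' /=; rewrite expg1n ?invg1.
have um : u ^+ `|m| = 1.
  move: Ep; rewrite p1 (pcoef1 phi hQP); case: (m) => k' //.
  by rewrite NegzE abszN absz_nat -exprnN => /(congr1 GRing.inv); rewrite invrK invr1.
have pQ := ppos_field hQP hS t.
have pu : ppos iota phi S t u.
  have [px _] := ppos_vertex hQP hS t t'; have [px' _] := ppos_vertex hQP hS t t.
  have -> : u = x t' (sigma k) / x t k by rewrite xk mulfK.
  by apply: (pfM pQ (px _)); apply: (pfV pQ (px' _)).
(* The cofactor of [u - 1] is a geometric sum, subtraction-free and therefore nonzero. *)
apply/eqP; rewrite -subr_eq0; move/eqP: um; rewrite -subr_eq0 subrX1 mulf_eq0.
case/orP => // /eqP sum0.
have : ppos iota phi S t (\sum_(i < `|m|) u ^+ i).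
  case: (absz m) (absz_gt0 m) => [|d]; first by rewrite m0.
  move=> _; elim: d => [|d IH].
    by rewrite big_ord1 expr0; apply: pf1.
  rewrite big_ord_recr /=; apply: pfD => //.
  exact: pfX.
by move/(pf_neq0 pQ); rewrite sum0 eqxx.
Qed.

(** Over the Laurent ring [R] of the common variables, [x t k] and [x t1 k] are Laurent in [w] with
    product in [R], hence monomials in [w] of opposite exponents. Symmetrically [w] is a monomial in
    [x t k], so the exponents are 1 or -1 and [w] matches one of the two variables. *)
Lemma common_variables_unit t t' (sigma : 'S_n) k : 
  (forall i, i != k -> x t' (sigma i) = x t i) ->
  exists t1 u, [/\ t1 = t \/ S t1 = smut iota phi k (S t),
    forall i, i != k -> x t' (sigma i) = x t1 i, runit (A t1 k) u &
    x t' (sigma k) = u * x t1 k].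
Proof.
move=> xE; pose R := A t k; set w := x t' (sigma k).
have sR : subring R := sA t k.
have R_sub f : R f -> A t' (sigma k) f.
  apply: laur_min => //; first by move=> a Ca; apply: laur_const.
  move=> i /= ik; rewrite -xE //.
  have sik : sigma i != sigma k by rewrite (inj_eq perm_inj).
  by split; [apply: laur_var | apply: laur_inv].
have R_sup f : A t' (sigma k) f -> R f.
  apply: laur_min => //; first by move=> a Ca; apply: laur_const.
  move=> i /=; rewrite -[i](permKV sigma) (inj_eq perm_inj) => ik.
  by rewrite xE //; split; [apply: laur_var | apply: laur_inv].
have trw : transc R w by apply: transc_sub R_sub (@tr t' (sigma k)).
have trx : transc R (x t k) := @tr t k.
have [t1 Et1] := neighbor hS t k; have [t2 Et2] := neighbor hS t' (sigma k).
have [other1 [m1 [Rm1 _ m10] E1]] := exchange_relation Et1.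
have [_ [m2 um2 E2]] := exchange_relation Et2.
have {um2} [Rm2 _ m20] := runit_sub R_sup um2.
have R1 := sr1 sR.
have Lw j s : lpoly R w (x s j).
  apply: (lpoly_sub R_sup); apply: (@laur_lpoly _ _ _ _ predT) => //.
    by move=> i _; have [->|ik] := eqVneq i (sigma k); [left | right].
  exact: (pattern_laurent hQP hS).
have Lx j s : lpoly R (x t k) (x s j).
  apply: (@laur_lpoly _ _ _ _ predT) => //.
    by move=> i _; have [->|ik] := eqVneq i k; [left | right].
  exact: (pattern_laurent hQP hS).
have RN1 : R ((1 + hat t k) * m1).
  by apply: srM => //; apply: srD => //; case: (runit_hat t k).
have RN2 : R ((1 + hat t' (sigma k)) * m2).
  apply: srM => //; apply: srD => //; apply: R_sup.
  by case: (runit_hat t' (sigma k)).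
have N10 : (1 + hat t k) * m1 != 0 by rewrite mulf_neq0.
have N20 : (1 + hat t' (sigma k)) * m2 != 0 by rewrite mulf_neq0.
have p1 : x t k * x t1 k = (1 + hat t k) * m1 by rewrite E1 mulrC divfK.
have p2 : w * x t2 (sigma k) = (1 + hat t' (sigma k)) * m2.
  by rewrite E2 mulrC divfK.
have [e [a [b [Ra Rb xa zb ab]]]] :=
  lpoly_factor sR trw (Lw k t) (Lw k t1) RN1 N10 p1.
have [e' [a' [b' [Ra' Rb' wa zb' ab']]]] :=
  lpoly_factor sR trx (Lx (sigma k) t') (Lx (sigma k) t2) RN2 N20 p2.
have a0 : a != 0 by apply: contraNneq N10 => a0; rewrite -ab a0 mul0r.
have b0 : b != 0 by apply: contraNneq N10 => b0; rewrite -ab b0 mulr0.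
have a'0 : a' != 0 by apply: contraNneq N20 => z; rewrite -ab' z mul0r.
have ee : e * e' = 1.
  (* The power of [a] is split between the two sides because the inverse of [a] is not known to lie
     in [R]. *)
  have Ex : a ^ pospart (- e') * w ^ 1 = a' * a ^ pospart e' * w ^ (e * e').
    have -> : a ^ pospart e' = a ^ e' * a ^ pospart (- e').
      by rewrite -expfzDr // -{2}(pospartB e') subrK.
    rewrite expr1z {1}/w wa xa expfzMl exprz_exp.
    by ring.
  have Rz (m : int) : 0 <= m -> R (a ^ m) by case: m => // m _; apply: srX.
  have [] := lpoly_monomial_eq sR trw _ _ _ _ Ex.
  - exact: Rz (pospart_ge0 _).
  - by apply: srM => //; apply: Rz (pospart_ge0 _).
  - exact: expfz_neq0.
  - by rewrite mulf_neq0 // expfz_neq0.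
  - by move=> <-.
have [[e1 e1']|[e1 e1']] : (e = 1 /\ e' = 1) \/ (e = -1 /\ e' = -1).
  have /eqP := congr1 absz ee; rewrite abszM muln_eq1 => /andP[ae _].
  have [E|E] : e = 1 \/ e = -1 by move: ae; lia.
    by left; move: ee; rewrite E mul1r.
  by right; split=> //; move: ee; rewrite E mulN1r => /(congr1 -%R); rewrite opprK.
- exists t, a'; split=> //; first by left.
    split=> //; have -> : a'^-1 = a; last by [].
    apply: (mulIf a'0); rewrite mulVf //; apply: (mulIf (x0 t k)).
    have wx : w = a' * x t k by rewrite /w wa e1' expr1z.
    have xw : x t k = a * w by rewrite {1}xa e1 expr1z.
    by rewrite mul1r -mulrA -wx.
  by rewrite /w wa e1' expr1z.
(* Here [w] is proportional to the variable of the neighbour [t1]; expanding [w] in that cluster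
   shows that the factor is invertible. *)
- have Ez : x t1 k = b * w by rewrite zb e1 opprK expr1z.
  have At1 f : A t1 k f <-> R f.
    split; apply: laur_min => //; try by move=> c Cc; apply: laur_const.
      move=> i /= ik; rewrite other1 //.
      by split; [apply: laur_var | apply: laur_inv].
    move=> i /= ik; rewrite -other1 //.
    by split; [apply: laur_var | apply: laur_inv].
  exists t1, b^-1; split=> //.
  + by right.
  + by move=> i ik; rewrite xE // other1.
  + apply: (@runit_sub _ R); first by move=> f /At1.
    split; rewrite ?invrK ?invr_eq0 //.
    have trz : transc R (x t1 k).
      by apply: transc_sub (@tr t1 k) => f /At1.
    have z0 := x0 t1 k.
    apply: (lpoly_div sR trz _ Rb b0); last by rewrite mulfV.
    have -> : b^-1 = w * (x t1 k)^-1.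
      have w0 := x0 t' (sigma k).
      by rewrite Ez; field; rewrite b0 w0.
    apply: (srM (lpoly_subring _ sR)); last exact: lpolyV.
    have H : lpoly (A t1 k) (x t1 k) w.
      apply: (@laur_lpoly _ _ _ _ predT) => //.
        by move=> i _; have [->|ik] := eqVneq i k; [left | right].
      exact: (pattern_laurent hQP hS).
    by apply: lpoly_sub H => f /At1.
  + by rewrite Ez mulKf.
Qed.

End Adjacency.

(** A reduced word in a single letter has length at most one. *)
Lemma tree_rank1 n (t t' : tree n) : (forall i j : 'I_n, i = j) ->
  t = t' \/ exists k, tree_edge k t t'.
Proof.
move=> eqI.
have short (w : seq 'I_n) : sorted (fun i j => i != j) w -> (size w <= 1)%N.
  by case: w => [|a [|b w]] //=; rewrite (eqI a b) eqxx.
case: t t' => [w sw] [w' sw'].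
case: w sw (short _ sw) => [|a [|b w]] sw //= _;
  case: w' sw' (short _ sw') => [|a' [|b' w']] sw' //= _.
- by left; rewrite (bool_irrelevance sw sw').
- by right; exists a'; left.
- by right; exists a; right.
- by left; move: sw'; rewrite (eqI a' a) => sw'; rewrite (bool_irrelevance sw sw').
Qed.

Section ClusterSets.

Variables (P : semifieldType) (F : fieldType) (n : nat).
Implicit Types s : seed P F n.

Lemma cluster_mem s i : xs s i \in cluster s.
Proof. by apply/imfsetP; exists i. Qed.

Lemma card_cluster s : injective (xs s) -> #|` cluster s| = n.
Proof. by move=> inj; rewrite card_imfset //= -cardE card_ord. Qed.

Lemma cluster_matching s s' : injective (xs s) -> injective (xs s') ->
  (0 < n)%N -> #|` (cluster s `&` cluster s')%fset| = n.-1 ->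
  exists (sigma : 'S_n) k, (forall i, i != k -> xs s' (sigma i) = xs s i) /\
    xs s k \notin cluster s'.
Proof.
move=> inj inj' n0 card.
have D1 : #|` (cluster s `\` cluster s')%fset| == 1%N.
  by rewrite cardfsD card card_cluster // -subn1 subKn.
have D1' : #|` (cluster s' `\` cluster s)%fset| == 1%N.
  by rewrite cardfsD fsetIC card card_cluster // -subn1 subKn.
have [a Ea] := cardfs1P _ D1; have [a' Ea'] := cardfs1P _ D1'.
have : a \in (cluster s `\` cluster s')%fset by rewrite Ea inE.
rewrite inE => /andP[as' /imfsetP[k _ ak]].
have : a' \in (cluster s' `\` cluster s)%fset by rewrite Ea' inE.
rewrite inE => /andP[a's /imfsetP[k' _ a'k']].
(* The default value is never taken: for [i != k] the variable lies in both clusters. *)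
pose f i := if i == k then k' else odflt k' [pick j | xs s' j == xs s i].
have fE i : i != k -> xs s' (f i) = xs s i.
  move=> ik; rewrite /f (negbTE ik); case: pickP => [j /eqP //|none].
  have : xs s i \notin (cluster s `\` cluster s')%fset.
    by rewrite Ea inE ak (inj_eq inj).
  rewrite inE cluster_mem andbT negbK => /imfsetP[j _ E].
  by have := none j; rewrite E eqxx.
have fk : f k = k' by rewrite /f eqxx.
have f_inj : injective f.
  have notk j : j != k -> f j <> k'.
    by move=> jk E; case/negP: a's; rewrite a'k' -E fE // cluster_mem.
  move=> i j; have [->|ik] := eqVneq i k; have [->|jk] := eqVneq j k => // E.
  - by case: (notk j jk); rewrite -E.
  - by case: (notk i ik); rewrite E.
  - by apply: inj; rewrite -!fE // E.
exists (perm f_inj), k; split=> [i ik|]; first by rewrite permE fE.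
by rewrite -ak.
Qed.

End ClusterSets.

Section MainTheorem.

Variables (P : semifieldType) (QP F : fieldType) (iota : P -> QP).
Variables (phi : {rmorphism QP -> F}) (n : nat) (S : tree n -> seed P F n).
Hypotheses (hQP : is_QP iota) (hS : cluster_pattern iota phi S).

Lemma variables_inj t : injective (xs (S t)).
Proof.
move=> i j E; apply/eqP; apply/negPn/negP => ij.
have sA := laur_subring (xs (S t)) (predC1 i) (img_subring phi).
have /eqP : 'X - (xs (S t) j)%:P = 0.
  apply: (@pattern_transc _ _ _ _ _ _ _ hS t i); last first.
    by rewrite !hornerE E subrr.
  apply: overD => //; first by rewrite -['X]expr1; apply: overXn.
  apply: overN => //; apply: overC => //; apply: laur_var.
  by rewrite /= eq_sym.
by rewrite polyXsubC_eq0.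
Qed.

Lemma card_adjacent t t1 k : S t1 = smut iota phi k (S t) ->
  #|` (cluster (S t) `&` cluster (S t1))%fset| = n.-1.
Proof.
move=> E; have other i : i != k -> xs (S t1) i = xs (S t) i.
  by move=> ik; rewrite E ffunE (negbTE ik).
have -> : (cluster (S t) `&` cluster (S t1) = cluster (S t) `\ xs (S t) k)%fset.
  apply/fsetP => f; rewrite !inE; apply/andP/andP => -[].
    move=> ft ft1; split=> //; apply/eqP => fk; move: ft1.
    rewrite fk => /imfsetP[j _]; have [->|jk] := eqVneq j k.
      by move/esym; apply: (mut_neq hQP hS E).
    by rewrite other // => /variables_inj kj; rewrite kj eqxx in jk.
  move=> fk /imfsetP[j _ fj]; rewrite fj in fk *; split; first exact: cluster_mem.
  rewrite -other ?cluster_mem //; by apply: contraNneq fk => ->.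
have := cardfsD1 (xs (S t) k) (cluster (S t)).
rewrite cluster_mem card_cluster; last exact: variables_inj.
by move/(congr1 predn) => /=.
Qed.

End MainTheorem.

Theorem theorem5p9 (P : semifieldType) (QP F : fieldType)
    (iota : P -> QP) (phi : {rmorphism QP -> F}) (n : nat)
    (S : tree n -> seed P F n)
    (hQP : is_QP iota)
    (hn : odd n)
    (hS : cluster_pattern iota phi S)
    (hB : forall t, indecomposable (bmx (S t))) :
  (forall (sigma : 'S_n) (t t' : tree n),
     [ffun i => xs (S t') (sigma i)] = xs (S t) ->
     S t = seed_perm sigma (S t')) /\
  (forall t t' : tree n,
     exchange_adj (fun p => phi (iota p)) (unlabeled (S t)) (unlabeled (S t'))
     <-> #|` (cluster (S t) `&` cluster (S t'))%fset | = n.-1).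
Proof.
have n0 : (0 < n)%N by case: n hn {S hS hB}.
have self t : unlabeled (S t) (S t) by exists 1%g; rewrite seed_perm1.
have rank1 : ~~ (1 < n)%N -> forall i j : 'I_n, i = j.
  rewrite -leqNgt => n1 i j; apply: val_inj => /=.
  by move: n1 (ltn_ord i) (ltn_ord j); lia.
have part1 (sigma : 'S_n) (t t' : tree n) :
    (forall i, xs (S t') (sigma i) = xs (S t) i) -> S t = seed_perm sigma (S t').
  move=> E; have [n1|/rank1 eqI] := boolP (1 < n)%N.
    exact: (cluster_determines_seed hQP hS hB hn n1 E).
  have [->|[k /hS.2 Ek]] := tree_rank1 t t' eqI.
    have sE i : sigma i = i by apply: eqI.
    by apply: seed_ext => [i|i|i j]; rewrite ?ffunE ?mxE !sE.
  by case: (mut_neq hQP hS Ek); rewrite -E (eqI (sigma k) k).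
split=> [sigma t t' E|t t'].
  by apply: part1 => i; rewrite -E ffunE.
split=> [[s [s' [k [[sigma Es] [tau Es'] E]]]]|card].
  (* Mutation at [k] after the permutation [sigma] has the same cluster as mutation at [sigma k]
     before it. *)
  have [t1 Et1] := neighbor hS t (sigma k).
  rewrite -(card_adjacent hQP hS Et1); congr (#|` _ `&` _|)%fset.
  transitivity (cluster s').
    by apply/esym; apply: (@cluster_eq _ _ _ _ _ tau) => i; rewrite Es' ffunE.
  apply: (@cluster_eq _ _ _ _ _ sigma) => i.
  by rewrite E Es seed_mut_perm Et1.
have [n1|/rank1 eqI] := boolP (1 < n)%N; last first.
  have [E|[k /hS.2 Ek]] := tree_rank1 t t' eqI.
    move: card; rewrite E fsetIid card_cluster; last exact: variables_inj hS _.
    by move=> En; exfalso; move: n0 En; lia.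
  by exists (S t), (S t'), k.
have [sigma [k [xE xk]]] := cluster_matching (variables_inj hS (t := t))
  (variables_inj hS (t := t')) n0 card.
have [t1 [u [t1E xE1 uu xk1]]] := common_variables_unit hQP hS xE.
have Cu := unit_ratio_const hQP hS hB n1 xE1 uu xk1.
have u1 := const_ratio_eq1 hQP hS hB n1 xE1 Cu xk1.
have all_eq i : xs (S t') (sigma i) = xs (S t1) i.
  by have [->|ik] := eqVneq i k; [rewrite xk1 u1 mul1r | apply: xE1].
(* If [t1] were [t], the clusters would coincide, although [xs (S t) k] is not in the second one. *)
case: t1E => [t1t|Et1].
  by case/negP: xk; rewrite -t1t -all_eq cluster_mem.
exists (S t), (S t1), k; split=> //.
by exists sigma; apply: part1.
Qed.
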